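(* Let $n$ be a positive integer and let $\sigma,\sigma'$ be $m$-component welded string links. Then $\sigma$ and $\sigma'$ are $(2n+\mathrm{sv})$-equivalent if and only if both of the following hold: (i) $\mu^{\mathrm w}_{\sigma}(I)\equiv\mu^{\mathrm w}_{\sigma'}(I)\pmod n$ for every non-repeated sequence $I$ of elements of $\{1,\dots,m\}$; (ii) $\mu^{\mathrm w}_{\sigma}(ij)-\mu^{\mathrm w}_{\sigma}(ji)=\mu^{\mathrm w}_{\sigma'}(ij)-\mu^{\mathrm w}_{\sigma'}(ji)$ for all $1\le i<j\le m$.
   Context: An $m$-component virtual string link diagram is an ordered, oriented string link diagram of $m$ strands in the plane whose transverse double points are either classical crossings (with over/under information) or virtual crossings. A welded string link is an equivalence class of such diagrams under welded Reidemeister moves: the classical Reidemeister moves R1–R3, the virtual moves V1–V4 (the virtual Reidemeister moves and the mixed move in which a strand with only virtual crossings passes a classical crossing), and the overcrossings commute move OC (two consecutive classical crossings in which a strand passes under two over-strands may be exchanged). A sequence of such moves is a welded isotopy. Welded Milnor invariants. Given a virtual diagram $D=D_1\cup\dots\cup D_m$ of $\sigma$, an arc is a piece of strand whose boundary points are strand endpoints or classical undercrossings and whose interior contains no classical undercrossing. Label the arcs of $D_i$ as $a_{i1},\dots,a_{ir(i)}$ in order along the orientation starting from the initial arc. The group $G(\sigma)$ has the Wirtinger presentation with generators $a_{ij}$ and relations $a_{i,j+1}^{-1}u_{ij}^{-1}a_{ij}u_{ij}$ ($1\le j\le r(i)-1$), where $u_{ij}$ is the generator of the over-arc at the crossing separating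 $a_{ij}$ and $a_{i,j+1}$, or its inverse, according to the sign of that crossing. Put $v_{ij}=u_{i1}\cdots u_{ij}$; the preferred $i$th longitude is $l_i=a_{i1}^{s}v_{i,r(i)-1}$ with $s\in\mathbb Z$ chosen so that the total exponent of generators of the $i$th component in $l_i$ is zero. Let $G(\sigma)_q$ be the $q$th lower central series term; $G(\sigma)/G(\sigma)_q$ is generated by the images $\alpha_1,\dots,\alpha_m$ of $a_{11},\dots,a_{m1}$, so the image of $l_i$ is represented by a word $\lambda_i$ in the free group $\langle\alpha_1,\dots,\alpha_m\rangle$. The Magnus expansion $E$ is the homomorphism into the ring of noncommutative formal power series $\mathbb Z\langle\langle X_1,\dots,X_m\rangle\rangle$ with $E(\alpha_i)=1+X_i$, $E(\alpha_i^{-1})=1-X_i+X_i^2-\cdots$. For a sequence $I=j_1\dots j_k i$ with $k<q$, $\mu^{\mathrm w}_\sigma(I)$ is the coefficient of $X_{j_1}\cdots X_{j_k}$ in $E(\lambda_i)$; this is an invariant of welded string links. A sequence is non-repeated if its entries are pairwise distinct. A $2n$-move is the local move replacing two parallel strands (without crossings) in a disk by two strands twisted around each other with $2n$ consecutive classical crossings (i.e. $2n$ half-twists), or the inverse. A self-crossing virtualization replaces a classical crossing whose two strands belong to the same component by a virtual crossing (or conversely). The $(2n+\mathrm{sv})$-equivalence is the equivalence relation on welded string links generated by $2n$-moves, self-crossing virtualizations and welded isotopy. *)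

(* Defs.v *)
(* Welded string links are encoded by Gauss diagrams on m
   ordered, oriented intervals (virtual string link diagrams modulo the
   virtual moves V1-V4 and planar isotopy correspond exactly to Gauss
   diagrams); the classical / welded / local moves are their Gauss diagram
   counterparts. *)
From HB Require Import structures.
From mathcomp Require Import all_boot all_order all_algebra.
From Stdlib Require Import Relation_Operators.
Set Implicit Arguments. Unset Strict Implicit. Unset Printing Implicit Defensive.
Import Order.TTheory GRing.Theory Num.Theory.

(* An endpoint of a crossing on a strand:
   (label of the crossing, is_over (true = over-passing endpoint),
    sign of the crossing (true = positive)). *)
Definition ep := (nat * bool * bool)%type.
Definition lab (e : ep) : nat := e.1.1.
Definition ov (e : ep) : bool := e.1.2.
Definition sg (e : ep) : bool := e.2.

(* A Gauss diagram of an m-component (virtual) string link diagram: for each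
   strand, the sequence of classical crossing endpoints met along its
   orientation. *)
Definition gd (m : nat) := 'I_m -> seq ep.

Definition cnt m (D : gd m) (l : nat) (b : bool) : nat :=
  \sum_(i < m) count (fun e => (lab e == l) && (ov e == b)) (D i).

Definition wf m (D : gd m) : Prop :=
  (forall l, cnt D l true = cnt D l false /\ cnt D l true <= 1) /\
  (forall i j (e e' : ep), e \in D i -> e' \in D j -> lab e = lab e' -> sg e = sg e').

Definition hgd (m : nat) := 'I_m -> seq (ep + nat).

Definition fill m (H : hgd m) (f : nat -> seq ep) : gd m :=
  fun i => flatten [seq match x with inl e => [:: e] | inr k => f k end | x <- H i].

Definition holes_ok m (H : hgd m) (nh : nat) : Prop :=
  forall k, \sum_(i < m) count (pred1 (inr k : ep + nat)) (H i) = (k < nh).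

Definition local_move m (nh : nat) (Hcond : hgd m -> Prop)
  (P : (nat -> seq ep) -> (nat -> seq ep) -> Prop) (D D' : gd m) : Prop :=
  wf D /\ wf D' /\
  exists (H : hgd m) (f f' : nat -> seq ep),
    [/\ holes_ok H nh, Hcond H, P f f',
        (forall i, D i = fill H f i) & (forall i, D' i = fill H f' i)].

Definition no_cond m (H : hgd m) : Prop := True.

Definition R1_pat (f f' : nat -> seq ep) : Prop :=
  f 0 = [::] /\ exists l b s, f' 0 = [:: (l, b, s); (l, ~~ b, s)].

Definition R2_pat (f f' : nat -> seq ep) : Prop :=
  f 0 = [::] /\ f 1 = [::] /\
  exists a b s, f' 0 = [:: (a, true, s); (b, true, ~~ s)] /\
    (f' 1 = [:: (a, false, s); (b, false, ~~ s)] \/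
     f' 1 = [:: (b, false, ~~ s); (a, false, s)]).

(* R3: strands top (hole 0), middle (hole 1), bottom (hole 2);
   crossings a = top/middle, b = top/bottom, c = middle/bottom.
   x: a before b on top; y: a before c on middle; z: b before c on bottom.
   The admissible configurations are exactly those with
   (x != y) = (sign b != sign c) and (y != z) = (sign a != sign b);
   the move reverses the order on each of the three strands. *)
Definition ord2 (x : bool) (e1 e2 : ep) : seq ep :=
  if x then [:: e1; e2] else [:: e2; e1].

Definition R3_fill a b c ea eb ec (x y z : bool) (f : nat -> seq ep) : Prop :=
  [/\ f 0 = ord2 x (a, true, ea) (b, true, eb),
      f 1 = ord2 y (a, false, ea) (c, true, ec)
    & f 2 = ord2 z (b, false, eb) (c, false, ec)].

Definition R3_pat (f f' : nat -> seq ep) : Prop :=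
  exists a b c ea eb ec (x y z : bool),
    [/\ (x != y) = (eb != ec), (y != z) = (ea != eb),
        R3_fill a b c ea eb ec x y z f
      & R3_fill a b c ea eb ec (~~ x) (~~ y) (~~ z) f'].

Definition OC_pat (f f' : nat -> seq ep) : Prop :=
  exists a b sa sb, f 0 = [:: (a, true, sa); (b, true, sb)] /\
                    f' 0 = [:: (b, true, sb); (a, true, sa)].

Definition relabel m (D D' : gd m) : Prop :=
  wf D /\ wf D' /\ exists g : nat -> nat, injective g /\
    forall i, D' i = [seq (g (lab e), ov e, sg e) | e <- D i].

Definition welded_step m (D D' : gd m) : Prop :=
  local_move 1 (@no_cond m) R1_pat D D' \/
  local_move 2 (@no_cond m) R2_pat D D' \/
  local_move 3 (@no_cond m) R3_pat D D' \/
  local_move 1 (@no_cond m) OC_pat D D' \/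
  relabel D D'.

Definition welded_iso m : gd m -> gd m -> Prop :=
  clos_refl_sym_trans (gd m) (@welded_step m).

(* self-crossing virtualization: a crossing whose two endpoints lie on the
   same component is created (its inverse is obtained by symmetry). *)
Definition same_comp m (H : hgd m) : Prop :=
  exists i, (inr 0 : ep + nat) \in H i /\ (inr 1 : ep + nat) \in H i.

Definition sv_pat (f f' : nat -> seq ep) : Prop :=
  f 0 = [::] /\ f 1 = [::] /\
  exists a s, f' 0 = [:: (a, true, s)] /\ f' 1 = [:: (a, false, s)].

(* 2n-move: 2n half-twists between two parallel strand pieces; along the
   first piece the crossings l_0, ..., l_{2n-1} are met in this order, the
   over strand alternates, all signs are equal, and along the second piece
   they are met in the same order (parallel orientations) or in the reverse
   order (antiparallel orientations). *)
Definition twist1 (ls : seq nat) (p s : bool) : seq ep :=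
  [seq (nth 0 ls k, odd k (+) p, s) | k <- iota 0 (size ls)].
Definition twist2 (ls : seq nat) (p s : bool) : seq ep :=
  [seq (nth 0 ls k, ~~ (odd k (+) p), s) | k <- iota 0 (size ls)].

Definition twist_pat (n : nat) (f f' : nat -> seq ep) : Prop :=
  f 0 = [::] /\ f 1 = [::] /\
  exists (ls : seq nat) (p s par : bool), size ls = (2 * n)%N /\
    f' 0 = twist1 ls p s /\
    f' 1 = (if par then twist2 ls p s else rev (twist2 ls p s)).

Definition step_2n_sv m (n : nat) (D D' : gd m) : Prop :=
  welded_step D D' \/
  local_move 2 (@same_comp m) sv_pat D D' \/
  local_move 2 (@no_cond m) (twist_pat n) D D'.

Definition equiv_2n_sv m (n : nat) : gd m -> gd m -> Prop :=
  clos_refl_sym_trans (gd m) (@step_2n_sv m n).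

(* words in the free group on alpha_1..alpha_m: (generator, true = positive) *)
Definition word m := seq ('I_m * bool).
Definition winv m (w : word m) : word m := rev [seq (x.1, ~~ x.2) | x <- w].

(* under-endpoints of strand i, in order; the arc a_{i,j+1} (0-based index j)
   starts right after the j-th of them *)
Definition unders m (D : gd m) (i : 'I_m) : seq ep := [seq e <- D i | ~~ ov e].

Definition is_over_of (l : nat) (e : ep) : bool := (lab e == l) && ov e.

(* component and (0-based) arc index of the over-arc at crossing l *)
Definition over_arc m (D : gd m) (i0 : 'I_m) (l : nat) : 'I_m * nat :=
  match [pick j : 'I_m | has (is_over_of l) (D j)] with
  | Some j => (j, count (fun e => ~~ ov e) (take (find (is_over_of l) (D j)) (D j)))
  | None => (i0, 0)
  end.

Definition uletter m (D : gd m) (i0 : 'I_m) (F : 'I_m -> nat -> word m) (e : ep)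
  : word m :=
  let ca := over_arc D i0 (lab e) in
  if sg e then F ca.1 ca.2 else winv (F ca.1 ca.2).

(* Milnor's iteration: arcw D k i j is a word in the alpha's representing
   the arc a_{i,j+1} modulo the (k+1)-th lower central subgroup *)
Fixpoint arcw m (D : gd m) (k : nat) (i : 'I_m) (j : nat) {struct k} : word m :=
  match k with
  | 0 => [:: (i, true)]
  | k'.+1 =>
      let V := flatten [seq uletter D i (arcw D k') e | e <- take j (unders D i)] in
      winv V ++ (i, true) :: V
  end.

Definition self_exp m (D : gd m) (i : 'I_m) : int :=
  \sum_(e <- unders D i | (over_arc D i (lab e)).1 == i)
     (if sg e then 1 else -1)%R.

Definition wpow m (i : 'I_m) (s : int) : word m :=
  match s with
  | Posz k => nseq k (i, true)
  | Negz k => nseq k.+1 (i, false)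
  end.

(* lambda_i, correct modulo the (q+1)-th lower central subgroup *)
Definition lambda m (D : gd m) (i : 'I_m) (q : nat) : word m :=
  wpow i (- self_exp D i)%R ++
  flatten [seq uletter D i (arcw D q) e | e <- unders D i].

(* coefficient of X_g^p in the Magnus expansion of alpha_g^{+1} / alpha_g^{-1} *)
Definition letc (b : bool) (p : nat) : int :=
  if b then (if (p <= 1)%N then 1 else 0)%R else ((-1) ^+ p)%R.

(* coefficient of the monomial X_{j1}...X_{jk} (J = [:: j1; ...; jk]) in the
   Magnus expansion E(w) *)
Fixpoint mcoef m (w : word m) (J : seq 'I_m) : int :=
  match w with
  | [::] => if J is [::] then 1%R else 0%R
  | x :: w' =>
      (\sum_(p < (size J).+1)
         (if all (pred1 x.1) (take p J) then letc x.2 p * mcoef w' (drop p J)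
          else 0))%R
  end.

(* mu^w(j1 ... jk i) = coefficient of X_{j1}...X_{jk} in E(lambda_i),
   lambda_i computed modulo F_{q+1} with q = k+1 > k. *)
Definition mu m (D : gd m) (I : seq 'I_m) : int :=
  match rev I with
  | [::] => 0%R
  | i :: rJ => mcoef (lambda D i (size I)) (rev rJ)
  end.

(* Main.v *)
Require Import Defs.
From HB Require Import structures.
From mathcomp Require Import all_boot all_order all_algebra.
From mathcomp Require Import boolp generic_quotient.
From Stdlib Require Import Relation_Operators.
From mathcomp Require Import zify ring.
Set Implicit Arguments. Unset Strict Implicit. Unset Printing Implicit Defensive.
Import Order.TTheory GRing.Theory Num.Theory.

(* Only if: colour the arcs of a diagram by the group [G] of words modulo equality
   mod [n] of their Magnus coefficients on non-repeated monomials. In [G] every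
   generator commutes with its conjugates and has [n]-th power [1], so the moves
   transport colourings and preserve the colours of the terminal arcs. The terminal
   colour of strand [i] is the conjugate of its generator by the [i]-th longitude,
   hence determines the [mu(J i)] mod [n]. Condition (ii) holds because a 2n-move
   adds the same multiple of [n] to both linking numbers of a pair of strands.

   If: modulo self-crossing virtualization the word read along the undercrossings
   of a strand may be changed by the Wirtinger relations and by commutation of the
   conjugates of the meridians of each strand. In the group so defined every
   meridian is a word in the initial ones, which gives a normal form with all
   overcrossings before all undercrossings, i.e. one word [w_i] for each strand.
   A 2n-move inserts [a_j^n] in [w_k] and [a_k^n] in [w_j]; it thus makes [a_j^n]
   central and, under (i) and (ii), equalizes the linking numbers. By Milnor's
   theorem on reduced groups the remaining coefficients mod [n] then determine
   the [w_i]. *)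

(** * Words, congruences and quotient groups *)

(** Equality of the coefficients on non-repeated monomials is a congruence, because a product cuts
    such a monomial into two of the same kind; its classes already form a group, and nilpotent
    quotients enter only when this group is compared with Milnor's iteration. Modulus 0 gives the
    integral version, so that for condition (ii) only the 2n-move requires a count of crossings. In
    the converse, an arc of strand [j] is a conjugate of the initial one, but by a word in arcs that
    are not initial themselves. The circularity breaks because the conjugator matters only modulo
    the arcs of [j]: each round kills one more strand. The power [a_j^n] becomes central as follows.
    A letter [a_k] of a third strand is moved behind an empty region of [k] parallel to [j]; a
    2n-move there turns the arc it refers to into [a_k] conjugated by [a_j^n]; the letter is
    rewritten in initial arcs and the move is undone. Since [a_j^n] becomes central without becoming
    trivial, linking numbers must agree as integers before Milnor's theorem applies, whereas the
    iterated commutators of [a_j] have exponent [n] and are detected by coefficients modulo [n]. *)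

Section Words.
Local Open Scope quotient_scope.
Variable T : choiceType.
Implicit Types (x : T * bool) (u v w : seq (T * bool)).

Definition linv x : T * bool := (x.1, ~~ x.2).
Definition ginv w := rev [seq linv x | x <- w].

Lemma linvK : involutive linv.
Proof. by case=> x b; rewrite /linv /= negbK. Qed.

Lemma ginv_cat u v : ginv (u ++ v) = ginv v ++ ginv u.
Proof. by rewrite /ginv map_cat rev_cat. Qed.

Lemma ginv_cons x w : ginv (x :: w) = rcons (ginv w) (linv x).
Proof. by rewrite /ginv /= rev_cons. Qed.

Lemma ginvK : involutive ginv.
Proof.
by move=> w; rewrite /ginv map_rev revK -map_comp map_id_in // => x _; rewrite /= linvK.
Qed.

(** Bundled so that one quotient construction serves the Magnus congruences, their truncations by
    degree and the groups given by relations. As [linv] is an involution, the last field yields both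
    inverse laws. *)
Record wcongr := WCongr {
  wc_rel :> seq (T * bool) -> seq (T * bool) -> Prop;
  wc_refl : forall u, wc_rel u u;
  wc_sym : forall u v, wc_rel u v -> wc_rel v u;
  wc_trans : forall u v w, wc_rel u v -> wc_rel v w -> wc_rel u w;
  wc_cat : forall u u' v v', wc_rel u u' -> wc_rel v v' -> wc_rel (u ++ v) (u' ++ v');
  wc_cancel : forall x, wc_rel [:: x; linv x] [::] }.

Section Quot.
Variable E : wcongr.

Definition wc_bool u v : bool := `[< E u v >].
Lemma wc_bool_refl : reflexive wc_bool.
Proof. by move=> u; apply/asboolP; apply: wc_refl. Qed.
Lemma wc_bool_sym : symmetric wc_bool.
Proof. by move=> u v; apply/asboolP/asboolP; apply: wc_sym. Qed.
Lemma wc_bool_trans : transitive wc_bool.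
Proof. by move=> v u w /asboolP uv /asboolP vw; apply/asboolP; apply: wc_trans uv vw. Qed.
Canonical wc_equiv := EquivRel wc_bool wc_bool_refl wc_bool_sym wc_bool_trans.

Definition wquot := {eq_quot wc_equiv}%qT.
HB.instance Definition _ := Choice.on wquot.

Definition wpi w : wquot := \pi_wquot w.

Lemma wpiP u v : wpi u = wpi v <-> E u v.
Proof.
split; last by move=> h; apply/eqmodP/asboolP.
by move/eqmodP/asboolP.
Qed.

Lemma wpi_surj (g : wquot) : exists w, g = wpi w.
Proof. by exists (repr g); rewrite /wpi reprK. Qed.

Lemma wc_catV w : E (w ++ ginv w) [::].
Proof.
elim: w => [|x w IH]; first exact: wc_refl.
rewrite ginv_cons -cats1 catA -cat1s -!catA [w ++ _]catA.
apply: (wc_trans _ (wc_cancel E x)); rewrite -[[:: x; linv x]]/([:: x] ++ ([::] ++ [:: linv x])).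
by do 2!(apply: wc_cat; first exact: wc_refl || exact: IH); exact: wc_refl.
Qed.

Lemma wc_catVl w : E (ginv w ++ w) [::].
Proof. by have := wc_catV (ginv w); rewrite ginvK. Qed.

Lemma wc_ginv u v : E u v -> E (ginv u) (ginv v).
Proof.
move=> uv; have h1 : E (ginv u ++ (v ++ ginv v)) (ginv u).
  by rewrite -{2}[ginv u]cats0; apply: wc_cat; [apply: wc_refl | apply: wc_catV].
apply: wc_trans (wc_sym h1) _; rewrite catA -{2}[ginv v]cat0s.
apply: wc_cat; last exact: wc_refl.
apply: wc_trans (wc_catVl u); apply: wc_cat; [exact: wc_refl | exact: wc_sym].
Qed.

Definition wmul (g h : wquot) : wquot := wpi (repr g ++ repr h).
Definition wone : wquot := wpi [::].
Definition winvq (g : wquot) : wquot := wpi (ginv (repr g)).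

Lemma repr_wpi w : E (repr (wpi w)) w.
Proof. by apply/wpiP; rewrite /wpi reprK. Qed.

Lemma wmulE u v : wmul (wpi u) (wpi v) = wpi (u ++ v).
Proof. by apply/wpiP; apply: wc_cat; apply: repr_wpi. Qed.

Lemma winvE u : winvq (wpi u) = wpi (ginv u).
Proof. by apply/wpiP; apply: wc_ginv; apply: repr_wpi. Qed.

Lemma wmulA : associative wmul.
Proof.
by move=> f g h; have [[u ->] [[v ->] [w ->]]] := (wpi_surj f, (wpi_surj g, wpi_surj h));
  rewrite !wmulE catA.
Qed.
Lemma wmul1 : left_id wone wmul.
Proof. by move=> g; have [u ->] := wpi_surj g; rewrite wmulE. Qed.
Lemma wmulg1 : right_id wone wmul.
Proof. by move=> g; have [u ->] := wpi_surj g; rewrite wmulE cats0. Qed.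
Lemma wmulV : left_inverse wone winvq wmul.
Proof.
by move=> g; have [u ->] := wpi_surj g; rewrite winvE wmulE; apply/wpiP; apply: wc_catVl.
Qed.
Lemma wmulgV : right_inverse wone winvq wmul.
Proof.
by move=> g; have [u ->] := wpi_surj g; rewrite winvE wmulE; apply/wpiP; apply: wc_catV.
Qed.
HB.instance Definition _ := isGroup.Build wquot wmulA wmul1 wmulg1 wmulV wmulgV.

Local Open Scope group_scope.

Lemma wpi_cat u v : wpi (u ++ v) = wpi u * wpi v.
Proof. by rewrite -wmulE. Qed.
Lemma wpi_ginv u : wpi (ginv u) = (wpi u)^-1.
Proof. by rewrite -winvE. Qed.
Lemma wpi_cons x u : wpi (x :: u) = wpi [:: x] * wpi u.
Proof. by rewrite -cat1s wpi_cat. Qed.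
End Quot.

Local Open Scope group_scope.

Definition evl (G : groupType) (a : T -> G) x : G := if x.2 then a x.1 else (a x.1)^-1.
Definition ev (G : groupType) (a : T -> G) w : G := \prod_(x <- w) evl a x.

Lemma ev_nil (G : groupType) (a : T -> G) : ev a [::] = 1.
Proof. by rewrite /ev big_nil. Qed.
Lemma ev_cons (G : groupType) (a : T -> G) x w : ev a (x :: w) = evl a x * ev a w.
Proof. by rewrite /ev big_cons. Qed.
Lemma ev_cat (G : groupType) (a : T -> G) u v : ev a (u ++ v) = ev a u * ev a v.
Proof. by rewrite /ev big_cat. Qed.
Lemma ev_ginv (G : groupType) (a : T -> G) u : ev a (ginv u) = (ev a u)^-1.
Proof.
elim: u => [|x u IH]; first by rewrite ev_nil invg1.
rewrite ginv_cons -cats1 ev_cat IH !ev_cons ev_nil mulg1 invgM; congr (_ * _).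
by case: x => x []; rewrite /evl //= ?invgK.
Qed.

Lemma wpi_ev (E : wcongr) w : wpi E w = ev (fun t => wpi E [:: (t, true)]) w.
Proof.
elim: w => [|x w IH]; first by rewrite ev_nil.
rewrite wpi_cons IH ev_cons; congr (_ * _).
by case: x => t [] //; rewrite /evl /= -wpi_ginv.
Qed.

(** The congruence generated by [R] and free cancellation; its quotient is the group presented by
    [R]. *)
Inductive pcl (R : seq (T * bool) -> seq (T * bool) -> Prop) :
  seq (T * bool) -> seq (T * bool) -> Prop :=
| pcl_refl u : pcl R u u
| pcl_sym u v : pcl R u v -> pcl R v u
| pcl_trans u v w : pcl R u v -> pcl R v w -> pcl R u w
| pcl_rel p u v q : R u v -> pcl R (p ++ u ++ q) (p ++ v ++ q)
| pcl_cancel p x q : pcl R (p ++ [:: x; linv x] ++ q) (p ++ q).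

Lemma pcl_ctx R p u v q : pcl R u v -> pcl R (p ++ u ++ q) (p ++ v ++ q).
Proof.
elim=> {u v} [u|u v _ ?|u v w _ h1 _ h2|a u v b h|a x b].
- exact: pcl_refl.
- exact: pcl_sym.
- exact: pcl_trans h1 h2.
- by rewrite -!catA catA [X in pcl _ _ X]catA; apply: pcl_rel.
- by rewrite -!catA catA [X in pcl _ _ X]catA; apply: pcl_cancel.
Qed.

Lemma pcl_cat R u u' v v' : pcl R u u' -> pcl R v v' -> pcl R (u ++ v) (u' ++ v').
Proof.
move=> h1 h2; apply: (@pcl_trans _ _ (u' ++ v)).
  by have := @pcl_ctx R [::] u u' v h1.
by have := @pcl_ctx R u' v v' [::] h2; rewrite !cats0.
Qed.

Lemma pcl_cancel1 R x : pcl R [:: x; linv x] [::].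
Proof. exact: (@pcl_cancel R [::] x [::]). Qed.

Definition pcongr R := WCongr (@pcl_refl R) (@pcl_sym R) (@pcl_trans R) (@pcl_cat R) (@pcl_cancel1 R).

End Words.

(** * Magnus coefficients on non-repeated monomials *)

Definition sgi (b : bool) : int := if b then 1%R else (-1)%R.

Section Magnus.
Variable T : choiceType.
Implicit Types (x : T * bool) (u v w : seq (T * bool)) (J : seq T) (j k : T).
Local Open Scope ring_scope.

(* On a monomial without repetition only the linear part of each [E(x)] counts,
   so that this is the Magnus coefficient for [uniq J] (and only then). *)
Fixpoint nc w J : int :=
  if w is x :: w' then
    nc w' J + (if J is j :: J' then if j == x.1 then sgi x.2 * nc w' J' else 0 else 0)
  else (J == [::])%:R.

Lemma nc_w0 w : nc w [::] = 1.
Proof. by elim: w => //= x w ->; rewrite addr0. Qed.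

(** The polynomials [1 + X] and [1 - X] simply multiply, so the formula holds for every [J]; only
    inverses force [J] to be without repetition. *)
Lemma nc_cat u v J :
  nc (u ++ v) J = \sum_(p < (size J).+1) nc u (take p J) * nc v (drop p J).
Proof.
elim: u J => [|x u IH] J /=.
  rewrite (bigD1 ord0) //= take0 drop0 mul1r big1 ?addr0 // => p p0.
  by case: J p p0 => [|j J] [[|p] //= ?]; rewrite ?mul0r.
rewrite IH; case: J => [|j J].
  by rewrite !big_ord_recl !big_ord0 /= !addr0.
rewrite IH big_ord_recl [in RHS]big_ord_recl /= addr0 -addrA; congr (_ + _).
under [in RHS]eq_bigr => p _ do rewrite mulrDl.
rewrite big_split /=; congr (_ + _).
case: eqP => _; last by rewrite big1 // => p _; rewrite mul0r.
by rewrite mulr_sumr; apply: eq_bigr => p _; rewrite mulrA.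
Qed.

Lemma eq_nc_cat u u' v v' J :
  (forall p, (p <= size J)%N -> nc u (take p J) = nc u' (take p J)) ->
  (forall p, (p <= size J)%N -> nc v (drop p J) = nc v' (drop p J)) ->
  nc (u ++ v) J = nc (u' ++ v') J.
Proof.
move=> h1 h2; rewrite !nc_cat; apply: eq_bigr => p _.
by rewrite h1 ?h2 // -ltnS.
Qed.

Lemma nc1 x J : nc [:: x] J = (J == [::])%:R + (J == [:: x.1])%:R * sgi x.2.
Proof.
case: J => [|j [|k J]] /=; rewrite ?mul0r ?mul1r ?addr0 ?add0r //.
  by rewrite eqseq_cons andbT; case: eqP => _; rewrite ?mulr1 ?mul1r ?mul0r.
by rewrite eqseq_cons andbF mul0r mulr0 if_same.
Qed.

(** The product is [1 - X^2], and a monomial without repetition does not see [X^2]. *)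
Lemma nc_cancel1 x J : uniq J -> nc [:: x; linv x] J = nc [::] J.
Proof.
case: J => [|j [|k J]] uJ //=; rewrite ?add0r ?mulr0 ?mulr1 ?addr0.
  by case: x => t [] /=; case: eqP => _.
move: uJ => /andP[]; rewrite inE negb_or => /andP[jk _] _.
case: (j =P x.1) => [e|//]; case: (k =P x.1) => [e'|]; last by rewrite mulr0.
by rewrite e e' eqxx in jk.
Qed.

Section Mod.
Variable N : nat.
(** Modulus 0 is allowed and means equality of integers. *)
Definition eqm u v := forall J, uniq J -> (nc u J = nc v J %[mod N%:Z])%Z.

Lemma eqm_refl u : eqm u u. Proof. by []. Qed.
Lemma eqm_sym u v : eqm u v -> eqm v u. Proof. by move=> h J uJ; rewrite h. Qed.
Lemma eqm_trans u v w : eqm u v -> eqm v w -> eqm u w.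
Proof. by move=> h1 h2 J uJ; rewrite h1 ?h2. Qed.

Lemma modz_sum (I : Type) (r : seq I) (F G : I -> int) :
  (forall i, (F i = G i %[mod N%:Z])%Z) ->
  (\sum_(i <- r) F i = \sum_(i <- r) G i %[mod N%:Z])%Z.
Proof.
move=> h; elim: r => [|i r IH]; first by rewrite !big_nil.
by rewrite !big_cons -modzDm h IH modzDm.
Qed.

Lemma nc_cat_mod u u' v v' J :
  (forall p, (p <= size J)%N -> (nc u (take p J) = nc u' (take p J) %[mod N%:Z])%Z) ->
  (forall p, (p <= size J)%N -> (nc v (drop p J) = nc v' (drop p J) %[mod N%:Z])%Z) ->
  (nc (u ++ v) J = nc (u' ++ v') J %[mod N%:Z])%Z.
Proof.
move=> h1 h2; rewrite !nc_cat; apply: modz_sum => p.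
have hp : (p <= size J)%N by rewrite -ltnS.
by rewrite -modzMm h1 // h2 // modzMm.
Qed.

Lemma eqm_cat u u' v v' : eqm u u' -> eqm v v' -> eqm (u ++ v) (u' ++ v').
Proof.
move=> h1 h2 J uJ; apply: nc_cat_mod => p _; [apply: h1 | apply: h2].
  exact: take_uniq.
exact: drop_uniq.
Qed.

Lemma eqm_cancel x : eqm [:: x; linv x] [::].
Proof. by move=> J uJ; rewrite nc_cancel1. Qed.

Definition mcongr := WCongr eqm_refl eqm_sym eqm_trans eqm_cat eqm_cancel.
End Mod.

Lemma eqm0 u v J : eqm 0 u v -> uniq J -> nc u J = nc v J.
Proof. by move=> h uJ; have := h J uJ; rewrite !modz0. Qed.

Lemma eqm0W N u v : eqm 0 u v -> eqm N u v.
Proof. by move=> h J uJ; rewrite (eqm0 h uJ). Qed.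

Lemma nc_catV w J : uniq J -> nc (w ++ ginv w) J = (J == [::])%:R.
Proof. by move=> uJ; rewrite (eqm0 (wc_catV (mcongr 0) w)). Qed.
Lemma nc_catVl w J : uniq J -> nc (ginv w ++ w) J = (J == [::])%:R.
Proof. by move=> uJ; rewrite (eqm0 (wc_catVl (mcongr 0) w)). Qed.

Lemma nc_filter j w J : j \notin J -> nc [seq x <- w | x.1 != j] J = nc w J.
Proof.
elim: w J => //= x w IH J jJ; case: ifP => h /=.
  rewrite IH //; case: J jJ => // k J; rewrite inE negb_or => /andP[_ jJ].
  by case: eqP => //; rewrite IH.
rewrite IH //; move/negbFE/eqP: h => ->.
case: J jJ => [|k J]; rewrite ?addr0 //= inE negb_or eq_sym => /andP[/negbTE -> _].
by rewrite addr0.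
Qed.

Lemma nc_notin j w J : j \in J -> all (fun x => x.1 != j) w -> nc w J = 0.
Proof.
elim: w J => [|x w IH] [|k J] //= jJ /andP[xj aw]; rewrite IH // add0r.
case: eqP => // e; rewrite IH ?mulr0 //; move: jJ; rewrite inE => /orP[] // /eqP ej.
by rewrite ej e eqxx in xj.
Qed.

Lemma filter_ginv (P : pred T) w :
  [seq x <- ginv w | P x.1] = ginv [seq x <- w | P x.1].
Proof. by rewrite /ginv filter_rev filter_map. Qed.

(* [unip j u]: the expansion of [u] is [1] modulo the ideal of [X_j]. *)
Definition unip j u := forall J, uniq J -> j \notin J -> nc u J = (J == [::])%:R.

Lemma unip_filter j u :
  (forall J, uniq J -> nc [seq x <- u | x.1 != j] J = (J == [::])%:R) -> unip j u.
Proof. by move=> h J uJ jJ; rewrite -(nc_filter u jJ) h. Qed.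

Lemma unip1 j b : unip j [:: (j, b)].
Proof. by apply: unip_filter => J _; rewrite /= eqxx. Qed.

Lemma unip_cat j u v : unip j u -> unip j v -> unip j (u ++ v).
Proof.
move=> hu hv J uJ jJ; rewrite -[RHS]/(nc [::] J) -(cat0s [::]).
apply: eq_nc_cat => p _.
  rewrite hu ?take_uniq //; apply: contra jJ; exact: mem_take.
rewrite hv ?drop_uniq //; apply: contra jJ; exact: mem_drop.
Qed.

Lemma unip_inv j u : unip j u -> unip j (ginv u).
Proof.
move=> hu J uJ jJ; rewrite -(nc_catV u uJ) -[ginv u in LHS]cat0s.
apply: eq_nc_cat => p _ //; rewrite hu ?take_uniq //.
apply: contra jJ; exact: mem_take.
Qed.

Lemma unip_conj j g u : unip j u -> unip j (ginv g ++ u ++ g).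
Proof.
move=> hu J uJ jJ; rewrite -(nc_catVl g uJ) -[g in RHS]cat0s.
apply: eq_nc_cat => p _ //; apply: eq_nc_cat => q _ //.
rewrite hu ?take_uniq ?drop_uniq //.
by apply: contra jJ => /mem_take/mem_drop.
Qed.

(** Apart from its constant 1 each series has only terms containing [X_j]. Two such terms would give
    [X_j] twice, so only the two extreme cuts of [J] contribute. *)
Lemma nc_unipD j u v J : unip j u -> unip j v -> uniq J -> j \in J ->
  nc (u ++ v) J = nc u J + nc v J.
Proof.
move=> hu hv uJ jJ; rewrite nc_cat.
case: J uJ jJ => // i J uJ jJ.
rewrite big_ord_recl big_ord_recr /= !nc_w0 mul1r.
rewrite add0n -/(size J) take_size drop_size nc_w0 mulr1 big1 ?add0r 1?addrC // => p _.
rewrite add0n.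
have [jt|jt] := boolP (j \in i :: take p J); last first.
  rewrite hu ?mul0r //; exact: (take_uniq p.+1 uJ).
have jd : j \notin drop p J.
  move: uJ; rewrite -[i :: J]/(i :: J) -(cat_take_drop p.+1 (i :: J)) cat_uniq => /and3P[_ h _].
  by apply: contra h => h; apply/hasP; exists j.
have dn : drop p J != [::].
  by rewrite -size_eq0 size_drop subn_eq0 -ltnNge.
rewrite hv ?(negbTE dn) ?mulr0 //.
by apply: drop_uniq; move: uJ => /= /andP[].
Qed.

(** Coefficients add on monomials containing [j], and both products are 1 on the others. This is why
    a generator commutes with its conjugates in the Magnus quotients. *)
Lemma nc_unipC j u v : unip j u -> unip j v -> eqm 0 (u ++ v) (v ++ u).
Proof.
move=> hu hv J uJ; congr (_ %% _)%Z.
have [jJ|jJ] := boolP (j \in J); last by rewrite !(unip_cat (j := j)).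
by rewrite !(nc_unipD _ _ uJ jJ) // addrC.
Qed.

Lemma nc_unipV j u J : unip j u -> uniq J -> j \in J -> nc (ginv u) J = - nc u J.
Proof.
move=> hu uJ jJ; apply/eqP; rewrite -addr_eq0 addrC; apply/eqP.
rewrite -(nc_unipD hu (unip_inv hu) uJ jJ) nc_catV //.
by case: J jJ {uJ}.
Qed.

Lemma nc_nseq j b (k : nat) J : uniq J -> j \in J -> nc (nseq k (j, b)) J = k%:R * nc [:: (j, b)] J.
Proof.
move=> uJ jJ.
have h i : unip j (nseq i (j, b)).
  elim: i => [|i IH] //; rewrite -[nseq _ _]/([:: (j, b)] ++ nseq i (j, b)).
  apply: unip_cat IH; exact: unip1.
elim: k => [|k IH]; first by rewrite mul0r /=; case: J jJ {uJ}.
rewrite -[nseq _ _]/([:: (j, b)] ++ nseq k (j, b)) (nc_unipD (@unip1 j b) (h k)) //.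
by rewrite IH -natr1 mulrDl mul1r addrC.
Qed.

(** Up to repeated monomials the power is [1 + N X_j] or [1 - N X_j]. Here the modulus meets the [n]
    undercrossings that a 2n-move puts on each strand. *)
Lemma eqm_nseq N j b : eqm N (nseq N (j, b)) [::].
Proof.
move=> J uJ; have [jJ|jJ] := boolP (j \in J).
  rewrite nc_nseq //= [X in _ = X](_ : _ = (0 %% N)%Z).
    by apply/eqP; rewrite eqz_mod_dvd subr0 natz dvdz_mulr.
  by case: J jJ {uJ}.
rewrite -(nc_filter _ jJ); congr (nc _ _ %% _)%Z.
by elim: (N) => //= k ->; rewrite eqxx.
Qed.

Lemma nc_rcons w k b J : nc (rcons w (k, b)) J =
  nc w J + (if J is j :: J' then if last j J' == k then sgi b * nc w (belast j J') else 0 else 0).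
Proof.
elim: w J => [|x w IH] J.
  rewrite -[rcons _ _]/[:: (k, b)] nc1; congr (_ + _); case: J => [|j [|i J]] /=.
  - by rewrite mul0r.
  - by rewrite eqseq_cons andbT; case: eqP; rewrite ?mul1r ?mulr1 ?mul0r.
  - by rewrite eqseq_cons andbF mul0r mulr0 if_same.
rewrite rcons_cons /= IH; case: J => [|j [|i J]] /=.
- by rewrite !addr0.
- rewrite IH !addr0 nc_w0 -!addrA; congr (_ + _); rewrite addrC; congr (_ + _).
- by rewrite IH /=; case: (j == x.1); case: (_ == k); ring.
Qed.

End Magnus.

(** * Milnor's theorem for reduced groups *)

Section Abel.
Variables (T : choiceType) (G : groupType) (a : T -> G).
Local Open Scope group_scope.

Definition reduced := forall j (g : G), commute (a j) (a j ^ g).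
Hypothesis redG : reduced.

(* [abel j] is an abelian normal subgroup containing [a j]. *)
Definition ctr j (x : G) := forall g, commute x (a j ^ g).
Definition abel j (x : G) := forall y, ctr j y -> commute x y.

Lemma commute_conj (x y g : G) : commute x y -> commute (x ^ g) (y ^ g).
Proof. by move=> h; rewrite /commute -!conjMg h. Qed.

Lemma commute_conjr (x y g : G) : commute x (y ^ g^-1) -> commute (x ^ g) y.
Proof. by move/(commute_conj g); rewrite conjgKV. Qed.

Lemma ctrJ j x g : ctr j x -> ctr j (x ^ g).
Proof. by move=> h k; apply: commute_conjr; rewrite -conjgM; apply: h. Qed.

Lemma ctrM j x y : ctr j x -> ctr j y -> ctr j (x * y).
Proof. by move=> hx hy g; apply/commute_sym/commuteM; apply/commute_sym; [apply: hx | apply: hy]. Qed.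

Lemma ctrV j x : ctr j x -> ctr j x^-1.
Proof. by move=> hx g; apply/commute_sym/commuteV/commute_sym/hx. Qed.

Lemma ctr_gen j : ctr j (a j).
Proof. by move=> g; apply: redG. Qed.

Lemma abelJ j x g : abel j x -> abel j (x ^ g).
Proof. by move=> h y hy; apply: commute_conjr; apply: h; apply: ctrJ. Qed.

Lemma abelM j x y : abel j x -> abel j y -> abel j (x * y).
Proof. by move=> hx hy z hz; apply/commute_sym/commuteM; apply/commute_sym; [apply: hx | apply: hy]. Qed.

Lemma abelV j x : abel j x -> abel j x^-1.
Proof. by move=> hx z hz; apply/commute_sym/commuteV/commute_sym/hx. Qed.

Lemma abel_gen j : abel j (a j).
Proof. by move=> y hy; have := hy 1; rewrite conjg1 => /commute_sym. Qed.

Lemma abel_ctr j x : abel j x -> ctr j x.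
Proof. by move=> h g; apply: h; apply/ctrJ/ctr_gen. Qed.

Lemma abel_comm j x y : abel j x -> abel j y -> commute x y.
Proof. by move=> hx hy; apply/hx/abel_ctr. Qed.

Lemma abelX j x n : abel j x -> abel j (x ^+ n).
Proof.
move=> h; elim: n => [|n IH]; last by rewrite expgS; apply: abelM.
by move=> y _; apply/commute_sym/commute1.
Qed.
End Abel.

Section Commutators.
Variable T : choiceType.
Variable j : T.
Implicit Types (R J : seq T).

(* The iterated commutator [[..[a_j, k_1], ..], k_r], indexed by [R = rev (k_1 .. k_r)]. *)
Fixpoint cw R : seq (T * bool) :=
  if R is k :: R' then ginv (cw R') ++ [:: (k, false)] ++ cw R' ++ [:: (k, true)]
  else [:: (j, true)].

Lemma unip_cw R : unip j (cw R).
Proof.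
elim: R => [|k R IH] /=; first exact: unip1.
apply: unip_cat; first exact: unip_inv.
rewrite -[(k, false) :: _]/(ginv [:: (k, true)] ++ (cw R ++ [:: (k, true)])).
exact: unip_conj.
Qed.

(** The commutators are dual to the monomials that begin with [j]: such a monomial does not see the
    leading inverse of [k] in [[u, k] = u^-1 k^-1 u k], and after [u] cancels against [u^-1] only
    [u X_k] is left. *)
Lemma nc_cw R J : j \notin R -> uniq (j :: J) ->
  nc (cw R) (j :: J) = (rev J == R)%:R%R.
Proof.
elim: R J => [|k R IH] J.
  by move=> _ _; rewrite nc1 /= eqseq_cons eqxx add0r mulr1 -size_eq0 -(size_eq0 (rev J)) size_rev.
rewrite inE negb_or => /andP[jk jR] uJ.
have hk : unip j ((k, false) :: cw R ++ [:: (k, true)]).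
  rewrite -[(k, false) :: _]/(ginv [:: (k, true)] ++ (cw R ++ [:: (k, true)])).
  exact: unip_conj (unip_cw R).
rewrite [cw _]/= (nc_unipD (unip_inv (unip_cw R)) hk uJ) ?mem_head //.
rewrite (nc_unipV (unip_cw R)) ?mem_head //= (negbTE jk) addr0 cats1 nc_rcons addKr.
case/lastP: J uJ => [|J l]; first by rewrite /= (negbTE jk).
rewrite last_rcons belast_rcons rev_rcons eqseq_cons => uJ; case: eqP => _ //=.
rewrite mul1r IH //; move: uJ; rewrite /= mem_rcons inE negb_or rcons_uniq.
by case/andP=> /andP[_ ->] /andP[_ ->].
Qed.

Variables (G : groupType) (a : T -> G).
Hypothesis redG : reduced a.
Local Open Scope group_scope.
Definition CR R : G := ev a (cw R).

Lemma CR_nil : CR [::] = a j.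
Proof. by rewrite /CR ev_cons ev_nil mulg1. Qed.

Lemma CR_cons k R : CR (k :: R) = [~ CR R, a k].
Proof.
by rewrite /CR /= ev_cat ev_ginv ev_cons ev_cat ev_cons ev_nil mulg1 /evl /= commgEl conjgE.
Qed.

Lemma CR_abel R : abel a j (CR R).
Proof.
elim: R => [|k R IH]; first by rewrite CR_nil; apply: abel_gen.
by rewrite CR_cons commgEl; apply: abelM; [apply: abelV | apply: abelJ].
Qed.

(** A commutator with [a k] is a product of conjugates of [a k] and its inverse, and further
    commutators keep this property. Hence a commutator with a repeated entry is trivial, and
    non-repeated monomials suffice. *)
Lemma CR_ctr k R : k \in R -> ctr a k (CR R).
Proof.
elim: R => // l R IH; rewrite inE CR_cons => /orP[/eqP <-|/IH h].
  rewrite commgEr; apply: ctrM; last exact: ctr_gen.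
  by apply/ctrJ/ctrV/ctr_gen.
by rewrite commgEl; apply: ctrM; [apply: ctrV | apply: ctrJ].
Qed.

Lemma CRJ k R : CR R ^ a k = CR R * CR (k :: R).
Proof. by rewrite CR_cons commgEl mulVKg. Qed.

Lemma CRJ_in k R : k \in R -> CR R ^ a k = CR R.
Proof.
move=> /CR_ctr h; have := h 1; rewrite conjg1 => hc.
by rewrite conjgE hc mulKg.
Qed.

Lemma CRJV k R : CR R ^ (a k)^-1 = CR R * (CR (k :: R))^-1.
Proof.
apply: (@conjg_inj _ (a k)); rewrite conjgKV conjMg conjVg CRJ CRJ_in ?mem_head //.
by rewrite mulgK.
Qed.

(** [CR (k :: R)] is a product of two commuting factors, so its [n]-th power is the commutator of
    [CR R ^+ n] with [a k], and the first of these powers is central. *)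
Lemma CR_exp n R : (forall k, commute (a j ^+ n) (a k)) -> R != [::] -> CR R ^+ n = 1.
Proof.
move=> cn; case: R => // k R _; elim: R k => [|l R IH] k.
  rewrite CR_cons commgEl expgMn; last first.
    by apply: (abel_comm redG (j := j)); rewrite -?CR_nil; [apply: abelV | apply: abelJ]; apply: CR_abel.
  by rewrite CR_nil expVgn -conjXg conjgE cn mulKg mulVg.
rewrite CR_cons commgEl expgMn; last first.
  by apply: (abel_comm redG (j := j)); [apply: abelV | apply: abelJ]; apply: CR_abel.
by rewrite expVgn -conjXg IH conj1g invg1 mul1g.
Qed.

Definition CP (L : seq (seq T * bool)) : G := \prod_(r <- L) (if r.2 then CR r.1 else (CR r.1)^-1).

Lemma CP_nil : CP [::] = 1. Proof. by rewrite /CP big_nil. Qed.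
Lemma CP_cons r L : CP (r :: L) = (if r.2 then CR r.1 else (CR r.1)^-1) * CP L.
Proof. by rewrite /CP big_cons. Qed.
Lemma CP_cat L L' : CP (L ++ L') = CP L * CP L'.
Proof. by rewrite /CP big_cat. Qed.

Lemma CP_abel L : abel a j (CP L).
Proof.
elim: L => [|[R b] L IH]; first by rewrite CP_nil => y _; apply/commute_sym/commute1.
rewrite CP_cons; apply: abelM => //=; case: b; last apply: abelV; exact: CR_abel.
Qed.

Lemma CP_split R L : CP L = CP [seq r <- L | r.1 == R] * CP [seq r <- L | r.1 != R].
Proof.
elim: L => [|r L IH] /=; first by rewrite CP_nil mul1g.
have hr : abel a j (if r.2 then CR r.1 else (CR r.1)^-1).
  by case: r.2; last apply: abelV; exact: CR_abel.
rewrite CP_cons IH; case: eqP => _ /=; rewrite CP_cons mulgA //.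
by rewrite mulgA (abel_comm redG hr (CP_abel [seq r <- L | r.1 == R])).
Qed.

Lemma CP_const R L : all (fun r => r.1 == R) L ->
  CP L = CR R ^+ count (fun r => r.2) L * (CR R) ^- count (fun r => ~~ r.2) L.
Proof.
elim: L => [|[S b] L IH] /=; first by rewrite CP_nil invg1 mulg1.
case/andP=> /eqP -> /IH {}IH; rewrite CP_cons IH /=.
have hR := CR_abel R.
case: b; rewrite /= ?add0n ?add1n; first by rewrite expgS -!mulgA.
rewrite expgSr invgM !mulgA; congr (_ * _).
by apply: (abel_comm redG (j := j)); [apply: abelV | apply: abelX].
Qed.

Definition cexp R (L : seq (seq T * bool)) : int :=
  (\sum_(r <- L | r.1 == R) sgi r.2)%R.

Lemma cexpE R L :
  cexp R L = ((count (fun r => r.2) [seq r <- L | r.1 == R])%:Z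
             - (count (fun r => ~~ r.2) [seq r <- L | r.1 == R])%:Z)%R.
Proof.
rewrite /cexp; elim: L => [|[S b] L IH]; first by rewrite big_nil.
rewrite big_cons /=; case: eqP => //= _; rewrite IH; case: b => /=; lia.
Qed.

Lemma expg_mod n p q (x : G) : x ^+ n = 1 -> (n%:Z %| (p%:Z - q%:Z)%R)%Z -> x ^+ p = x ^+ q.
Proof.
move=> xn; wlog le : p q / (p <= q)%N.
  move=> h; case: (leqP p q) => [/h//|/ltnW/h {}h d]; apply/esym/h.
  by rewrite -opprB rpredN.
rewrite -opprB rpredN subzn // dvdzE /= => /dvdnP[k e].
by rewrite -(subnKC le) expgnDr e mulnC expgnA xn expg1n mulg1.
Qed.

(** The index [[::]] stands for [a j] itself, whose [n]-th power is central but may be nontrivial;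
    hence its exponent has to vanish. The induction removes all factors with the index of the first
    one at once. *)
Lemma CP_trivial n L : (forall k, commute (a j ^+ n) (a k)) ->
  cexp [::] L = 0%R -> (forall R, R \in map fst L -> R != [::] -> (n%:Z %| cexp R L)%Z) ->
  CP L = 1.
Proof.
move=> cn; move: {2}(size L).+1 (ltnSn (size L)) => s; elim: s L => // s IH [|[R b] L]; first by rewrite CP_nil.
move=> sL e0 en; rewrite (CP_split R) [X in _ * X]IH ?mulg1.
- rewrite (@CP_const R); last by apply/allP=> r; rewrite mem_filter => /andP[].
  have [R0|R0] := eqVneq R [::].
    move: e0; rewrite -R0 cexpE => /eqP; rewrite subr_eq0 => /eqP [->].
    by rewrite mulgV.
  have := en R; rewrite mem_head => /(_ isT R0); rewrite cexpE => /expg_mod.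
  by move=> ->; rewrite ?mulgV // CR_exp.
- rewrite /= eqxx /=; apply: leq_ltn_trans (_ : size L < s)%N => //.
  by rewrite size_filter count_size.
- rewrite /cexp big_filter_cond; have [R0|R0] := eqVneq R [::].
    by rewrite big1 // => r /andP[]; rewrite R0 => /negbTE ->.
  rewrite -[RHS]e0 /cexp; apply: eq_bigl => r; rewrite andbC.
  by case: eqP => //= ->; rewrite eq_sym R0.
- move=> R' /mapP[r]; rewrite mem_filter => /andP[rR rL] -> r0.
  have -> : cexp r.1 [seq r <- (R, b) :: L | r.1 != R] = cexp r.1 ((R, b) :: L).
    rewrite /cexp big_filter_cond; apply: eq_bigl => q; rewrite andbC.
    by case: eqP => //= ->; rewrite rR.
  by apply: en => //; apply: map_f.
Qed.
End Commutators.

Section Milnor.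
Variable T : choiceType.

Definition okL (j : T) (L : seq (seq T * bool)) :=
  all (fun r => uniq r.1 && (j \notin r.1)) L.

Local Open Scope group_scope.

Lemma CP_conj (j : T) L x : okL j L -> x.1 != j ->
  exists2 L', okL j L' & forall (G : groupType) (a : T -> G), reduced a ->
     CP j a L ^ evl a x = CP j a L'.
Proof.
move=> ok xj; elim: L ok => [|[R b] L IH].
  by exists [::] => // G a _; rewrite CP_nil conj1g.
move=> /= /andP[/andP[uR jR] /IH[L' okL' h]].
have [xR|xR] := boolP (x.1 \in R).
  exists ((R, b) :: L'); first by rewrite /= uR jR.
  move=> G a red; rewrite !CP_cons conjMg h //; congr (_ * _).
  have e : CR j a R ^ evl a x = CR j a R.
    rewrite /evl; case: x.2; first exact: CRJ_in.
    by rewrite -{1}(CRJ_in j red xR) conjgK.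
  by case: b => /=; rewrite ?conjVg e.
exists ((R, b) :: (x.1 :: R, ~~ (b (+) x.2)) :: L').
  by rewrite /= uR jR xR /= inE negb_or eq_sym xj jR.
move=> G a red; rewrite !CP_cons conjMg h // mulgA; congr (_ * _).
rewrite /evl; case: x {h IH} xj xR => k c /= kj kR.
have hR : abel a j (CR j a R) by apply: CR_abel.
have hkR : abel a j (CR j a (k :: R)) by apply: CR_abel.
have cc := abel_comm red hR hkR.
case: b; case: c => /=; rewrite ?CRJ ?CRJV // conjVg ?CRJ ?CRJV // invgM ?invgK.
  by apply: (abel_comm red (j := j)); apply: abelV.
by apply: (abel_comm red (j := j)) => //; apply: abelV.
Qed.

(** A collection process: letters other than [j] move left past the commutators of [a j] collected
    so far and conjugate them. [L] is chosen before the group, so that it can be used in the given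
    group and read off in the Magnus quotient. *)
Lemma ev_decompose (j : T) w : exists2 L, okL j L &
  forall (G : groupType) (a : T -> G), reduced a ->
     ev a w = ev a [seq x <- w | x.1 != j] * CP j a L.
Proof.
elim/last_ind: w => [|w x [L ok IH]].
  by exists [::] => // G a _; rewrite !ev_nil CP_nil mulg1.
have evr (G : groupType) (a : T -> G) v : ev a (rcons v x) = ev a v * evl a x.
  by rewrite -cats1 ev_cat ev_cons ev_nil mulg1.
rewrite filter_rcons; have [xj|xj] := eqVneq x.1 j.
  exists (rcons L ([::], x.2)); first by rewrite /okL all_rcons /=.
  move=> G a red; rewrite /= evr IH // -(cats1 L) CP_cat CP_cons CP_nil mulg1 mulgA.
  by rewrite CR_nil /evl xj.
have [L' ok' h] := CP_conj ok xj; exists L' => // G a red.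
by rewrite /= !evr IH // -!mulgA -h // [CP _ _ _ * _]conjgC.
Qed.

Lemma reduced_magnus N : reduced (fun t : T => wpi (mcongr T N) [:: (t, true)]).
Proof.
move=> j g; have [w ->] := wpi_surj g.
have -> : wpi (mcongr T N) [:: (j, true)] ^ wpi (mcongr T N) w =
    wpi (mcongr T N) (ginv w ++ [:: (j, true)] ++ w).
  by rewrite conjgE !wpi_cat wpi_ginv.
rewrite /commute -!wpi_cat.
apply/wpiP/eqm0W/(nc_unipC (j := j)); first exact: unip1.
apply: unip_conj; exact: unip1.
Qed.

Lemma nc_CP j L J : okL j L -> uniq (j :: J) ->
  nc (flatten [seq if r.2 then cw j r.1 else ginv (cw j r.1) | r <- L]) (j :: J)
  = cexp (rev J) L.
Proof.
move=> + uJ; rewrite /cexp; elim: L => [|[R b] L IH] /=; first by rewrite big_nil.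
case/andP=> /andP[_ jR] ok; rewrite big_cons /=.
have uL (K : seq (seq T * bool)) : unip j (flatten [seq if r.2 then cw j r.1 else ginv (cw j r.1) | r <- K]).
  elim: K => [|[S c] K IHK] //=; apply: unip_cat => //.
  by case: c; [|apply: unip_inv]; apply: unip_cw.
rewrite (@nc_unipD _ j) ?mem_head //; last by case: (b); [|apply: unip_inv]; apply: unip_cw.
rewrite IH //; case: b.
  by rewrite nc_cw // eq_sym; case: eqP; rewrite ?add0r.
rewrite (nc_unipV (j := j) (@unip_cw _ j R)) ?mem_head // nc_cw // eq_sym.
by case: eqP; rewrite ?oppr0 ?add0r.
Qed.

(* Milnor: in a reduced group the Magnus coefficients on non-repeated
   monomials detect triviality. *)
Theorem magnus_trivial (G : groupType) (a : T -> G) n w :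
  reduced a -> (forall j k, commute (a j ^+ n) (a k)) ->
  (forall k, nc w [:: k] = 0%R) ->
  (forall J, uniq J -> J != [::] -> (n%:Z %| nc w J)%Z) ->
  ev a w = 1.
Proof.
move=> red cn.
have : {subset [seq x.1 | x <- w] <= undup [seq x.1 | x <- w]}.
  by move=> x; rewrite mem_undup.
elim: (undup _) {-2}w => {w} [|j s IH] w sub w1 wn.
  case: w sub {w1 wn} => [|x w] sub; first by rewrite ev_nil.
  by have := sub x.1; rewrite inE eqxx in_nil => /(_ isT).
have [L ok h] := ev_decompose j w.
rewrite (h G a red) IH ?mul1g.
(* The same decomposition in the integral Magnus quotient turns the coefficient of [w] at [j :: J]
   into the exponent of the commutator indexed by [rev J]. *)
- have hw : wpi (mcongr T 0) w =
    wpi (mcongr T 0) ([seq x <- w | x.1 != j] ++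
       flatten [seq if r.2 then cw j r.1 else ginv (cw j r.1) | r <- L]).
    rewrite wpi_cat [LHS]wpi_ev h; last exact: reduced_magnus.
    rewrite -wpi_ev; congr (_ * _); elim: (L) => [|r K IHK] /=; first by rewrite CP_nil.
    by rewrite CP_cons wpi_cat IHK /CR -wpi_ev; case: r.2; rewrite ?wpi_ginv.
  have e J : uniq (j :: J) -> nc w (j :: J) = cexp (rev J) L.
    move=> uJ; move/wpiP: hw => /= /eqm0 -> //; rewrite nc_cat big_ord_recl /= nc_w0 mul1r.
    rewrite big1 ?addr0 ?nc_CP // => p _.
    rewrite (@nc_notin _ j) ?mul0r //; first by rewrite /= mem_head.
    by apply/allP=> x; rewrite mem_filter => /andP[].
  apply: (@CP_trivial _ j _ _ red n) => [k||R].
  + exact: cn.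
  + by rewrite -[[::]]/(rev [::]) -e.
  + case/mapP=> r rL -> r0; move/allP: ok => /(_ r rL) /andP[u1 u2].
    rewrite -[r.1]revK -e ?wn //; rewrite /= ?mem_rev ?rev_uniq ?u1 ?u2 //.
- move=> y /mapP[x]; rewrite mem_filter => /andP[xj xw] ->.
  by have := sub x.1 (map_f _ xw); rewrite inE (negbTE xj).
- move=> k; have [->|kj] := eqVneq k j.
    rewrite (@nc_notin _ j) ?mem_head //.
    by apply/allP=> x; rewrite mem_filter => /andP[].
  by rewrite nc_filter ?inE 1?eq_sym // w1.
- move=> J uJ J0; have [jJ|jJ] := boolP (j \in J).
    rewrite (@nc_notin _ j) //.
    by apply/allP=> x; rewrite mem_filter => /andP[].
  by rewrite nc_filter // wn.
Qed.
End Milnor.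

(** * Wirtinger colourings *)

Section Coloring.
Variable G : groupType.
Local Open Scope group_scope.

Definition spow (b : bool) (x : G) : G := if b then x else x^-1.

(* [c l] is the colour of the over-arc at crossing [l], and [x] the colour of the
   arc on which the remaining part of the strand starts. *)
Fixpoint gok (c : nat -> G) (x : G) (s : seq ep) : Prop :=
  if s is e :: s' then
    if ov e then c (lab e) = x /\ gok c x s' else gok c (x ^ spow (sg e) (c (lab e))) s'
  else True.

Fixpoint gend (c : nat -> G) (x : G) (s : seq ep) : G :=
  if s is e :: s' then
    if ov e then gend c x s' else gend c (x ^ spow (sg e) (c (lab e))) s'
  else x.

Lemma gok_cat c x s t : gok c x (s ++ t) <-> gok c x s /\ gok c (gend c x s) t.
Proof.
elim: s x => [|e s IH] x /=; first by split=> [|[]].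
by case: (ov e); rewrite IH //; split=> [[-> [? ?]]|[[-> ?] ?]].
Qed.

Lemma gend_cat c x s t : gend c x (s ++ t) = gend c (gend c x s) t.
Proof. by elim: s x => //= e s IH x; case: (ov e). Qed.

Lemma gok_map c x s (g : nat -> nat) :
  gok c x [seq (g (lab e), ov e, sg e) | e <- s] <-> gok (c \o g) x s.
Proof.
elim: s x => //= -[[l b] t] s IH x; rewrite /ov /sg /lab /=; case: b => //.
by rewrite IH.
Qed.

Lemma gend_map c x s (g : nat -> nat) :
  gend c x [seq (g (lab e), ov e, sg e) | e <- s] = gend (c \o g) x s.
Proof. by elim: s x => //= -[[l b] t] s IH x; rewrite /ov /sg /lab /=; case: b. Qed.

Lemma gok_over c x s e : gok c x s -> e \in s -> ov e -> exists g, c (lab e) = x ^ g.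
Proof.
elim: s x => //= e' s IH x; rewrite inE; case: ifP => o.
  case=> cx h /orP[/eqP ->|/(IH x h)] //.
  by move=> _; exists 1; rewrite conjg1.
move=> h /orP[/eqP -> |es oe]; first by rewrite o.
have [g ->] := IH _ h es oe; exists (spow (sg e') (c (lab e')) * g).
by rewrite conjgM.
Qed.

Variables (m : nat) (a : 'I_m -> G).
Hypothesis red : reduced a.

Definition conjcl i (x : G) := exists g, x = a i ^ g.

Lemma conjcl_gen i : conjcl i (a i). Proof. by exists 1; rewrite conjg1. Qed.
Lemma conjclJ i x g : conjcl i x -> conjcl i (x ^ g).
Proof. by case=> h ->; exists (h * g); rewrite conjgM. Qed.
Lemma conjcl_gend i c x s : conjcl i x -> conjcl i (gend c x s).
Proof. by elim: s x => //= e s IH x h; case: (ov e); apply: IH => //; apply: conjclJ. Qed.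
Lemma conjcl_abel i x : conjcl i x -> abel a i x.
Proof. by case=> g ->; apply/abelJ/abel_gen. Qed.
Lemma conjcl_over i c x s e : conjcl i x -> gok c x s -> e \in s -> ov e -> conjcl i (c (lab e)).
Proof.
by move=> hx h es oe; have [g ->] := gok_over h es oe; apply: conjclJ.
Qed.

(** A move matters only inside its holes, provided the colour at the exit of each hole is kept. The
    induction carries along that the current colour is a conjugate of [a i], as virtualization and
    twists require. *)
Lemma fill_transport (H : hgd m) c1 c2 (f1 f2 : nat -> seq ep) :
  (forall i e, inl e \in H i -> c1 (lab e) = c2 (lab e)) ->
  (forall i k x, inr k \in H i -> conjcl i x -> gok c1 x (f1 k) ->
     gok c2 x (f2 k) /\ gend c1 x (f1 k) = gend c2 x (f2 k)) ->
  forall i, gok c1 (a i) (fill H f1 i) ->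
    gok c2 (a i) (fill H f2 i) /\ gend c1 (a i) (fill H f1 i) = gend c2 (a i) (fill H f2 i).
Proof.
move=> hl hh i; rewrite /fill.
have : {subset H i <= H i} by [].
move: (conjcl_gen i) => +; elim: {1 3 4 5 6}(H i) (a i) => //= y s IH x hx sub.
have sub' : {subset s <= H i} by move=> z zs; apply: sub; rewrite inE zs orbT.
rewrite !gok_cat !gend_cat => -[h1 h2].
case: y sub h1 h2 => [e|k] sub h1 h2.
  have e12 : c1 (lab e) = c2 (lab e) by apply: (hl i); apply: sub; rewrite mem_head.
  have e3 : gend c1 x [:: e] = gend c2 x [:: e] by rewrite /= e12.
  move: h1 h2; rewrite e3 => h1 h2.
  have [|? ->] := IH _ _ sub' h2; first exact: conjcl_gend.
  by split=> //; split=> //; move: h1; rewrite /= e12.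
have [||hk e3] := hh i k x _ _ h1 => //; first by apply: sub; rewrite mem_head.
rewrite e3 in h2 *.
have [|? ->] := IH _ _ sub' h2; first exact: conjcl_gend.
by split.
Qed.

Lemma fill_hole (H : hgd m) c f i k :
  inr k \in H i -> gok c (a i) (fill H f i) -> exists2 x, conjcl i x & gok c x (f k).
Proof.
rewrite /fill; move: (conjcl_gen i) => +; elim: (H i) (a i) => //= y s IH x hx.
rewrite inE gok_cat => /orP[/eqP <-|ks] [h1 h2]; first by exists x.
by apply: IH h2; first exact: conjcl_gend.
Qed.

Definition colors (c : nat -> G) (D : gd m) := forall i, gok c (a i) (D i).
Definition same_ends c (D : gd m) c' (D' : gd m) :=
  forall i, gend c (a i) (D i) = gend c' (a i) (D' i).
(** One direction is enough, since colourings exist on every well-formed diagram and the resulting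
    equality of coefficients is symmetric. A move that creates crossings is therefore read
    backwards, where no colour has to be found for a new crossing. *)
Definition cstep (D D' : gd m) :=
  forall c, colors c D -> exists2 c', colors c' D' & same_ends c D c' D'.

End Coloring.

(** * Endpoints and labels in a diagram with holes *)

Section Holes.
Variable m : nat.
Implicit Types (H : hgd m).

Lemma sum_count1 T (s : 'I_m -> seq T) (P : pred T) i :
  (count P (s i) <= \sum_(j < m) count P (s j))%N.
Proof. by rewrite (bigD1 i) //= leq_addr. Qed.

Lemma hole_lt H nh i k : holes_ok H nh -> inr k \in H i -> (k < nh)%N.
Proof.
move=> /(_ k) h hk; have := sum_count1 H (pred1 (inr k)) i; rewrite h.
by case: ltnP => // _; rewrite leqn0 -leqn0 leqNgt -has_count has_pred1 hk.
Qed.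

Lemma hole_ex H nh k : holes_ok H nh -> (k < nh)%N -> exists i, inr k \in H i.
Proof.
move=> /(_ k) h lt; case: (pickP (fun i => inr k \in H i)) => [i hi|no]; first by exists i.
move: h; rewrite lt big1 // => i _; apply/eqP; rewrite -leqn0 leqNgt -has_count has_pred1.
by rewrite no.
Qed.

Lemma hole_uniq H nh i j k : holes_ok H nh -> inr k \in H i -> inr k \in H j -> i = j.
Proof.
move=> /(_ k) h hi hj; apply/eqP/negPn/negP => ne; move: h.
rewrite (bigD1 i) // (bigD1 j) 1?eq_sym //=.
move: hi hj; rewrite -!has_pred1 !has_count.
set p := count _ _; set q := count _ _; set r := (\sum_(_ < _ | _) _)%N.
by have := leq_b1 (k < nh)%N; clearbody p q r; move: (nat_of_bool _) => b0; lia.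
Qed.

Definition inlp (P : pred ep) : pred (ep + nat) := fun x => if x is inl e then P e else false.

Lemma count_fill H f nh (P : pred ep) i : holes_ok H nh ->
  count P (fill H f i) =
  (count (inlp P) (H i) + \sum_(k < nh) count (pred1 (inr (nat_of_ord k) : ep + nat)) (H i) * count P (f k))%N.
Proof.
move=> ok; have : forall k, inr k \in H i -> (k < nh)%N by move=> k; apply: hole_lt.
rewrite /fill; elim: (H i) => [|y s IH] hk.
  by rewrite /= big1 // => k _.
have hk' k : inr k \in s -> (k < nh)%N by move=> ks; apply: hk; rewrite inE ks orbT.
rewrite /= count_cat {}IH //; case: y hk => [e|k] hk /=.
  by rewrite addn0 addnA; congr (_ + _)%N; apply: eq_bigr => l _; rewrite add0n.
under [in RHS]eq_bigr => l _ do rewrite mulnDl.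
rewrite big_split /= add0n addnCA; congr (_ + (_ + _))%N.
have lt := hk k (mem_head _ _).
rewrite (bigD1 (Ordinal lt)) //= eqxx mul1n big1 ?addn0 // => l ne.
rewrite (_ : _ == _ = false) //; apply/eqP => -[e]; case/negP: ne; apply/eqP/val_inj.
by rewrite /= e.
Qed.

Lemma sum_count_fill H f nh (P : pred ep) : holes_ok H nh ->
  (\sum_(i < m) count P (fill H f i) =
  \sum_(i < m) count (inlp P) (H i) + \sum_(k < nh) count P (f k))%N.
Proof.
move=> ok; under eq_bigr => i _ do rewrite (count_fill _ _ _ ok).
rewrite big_split /=; congr (_ + _)%N; rewrite exchange_big /=; apply: eq_bigr => k _.
by rewrite -big_distrl /= ok ltn_ord mul1n.
Qed.

Definition isep (l : nat) (b : bool) : pred ep := fun e => (lab e == l) && (ov e == b).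

(* By well-formedness an endpoint lying in a hole lies nowhere else. *)
Lemma fill_label_fresh (D : gd m) H f nh l b (k : nat) : holes_ok H nh -> wf D ->
  (forall i, D i = fill H f i) -> (k < nh)%N -> has (isep l b) (f k) ->
  (forall i e, inl e \in H i -> ~~ isep l b e) /\
  (forall k', (k' < nh)%N -> k' <> k -> ~~ has (isep l b) (f k')).
Proof.
move=> ok [/(_ l) [cl c1] _] hD lt hf.
have tot : cnt D l b = (\sum_(i < m) count (inlp (isep l b)) (H i) +
   \sum_(k < nh) count (isep l b) (f k))%N.
  by rewrite -(sum_count_fill f (isep l b) ok); apply: eq_bigr => i _; rewrite hD.
have hc : (cnt D l b <= 1)%N by case: (b); rewrite -?cl.
rewrite tot (bigD1 (Ordinal lt)) //= in hc.
have h3 : (0 < count (isep l b) (f k))%N by rewrite -has_count.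
split=> [i e ei|k' lt' ne]; apply/negP.
  move=> el; have h1 : (0 < count (inlp (isep l b)) (H i))%N.
    by rewrite -has_count; apply/hasP; exists (inl e).
  have := leq_trans h1 (sum_count1 H (inlp (isep l b)) i); move: hc h3.
  by move: (\sum_(_ < m) _)%N (count _ (f k)) (\sum_(_ < nh | _) _)%N => p q r; clear; lia.
rewrite has_count => h4; move: hc; rewrite (bigD1 (Ordinal lt')) /=; last by apply/eqP => -[].
move: h3 h4; move: (\sum_(_ < m) _)%N (count _ (f k)) (count _ (f k')) (\sum_(_ < nh | _) _)%N.
by clear; lia.
Qed.
End Holes.

(** * Transport of colourings through each move *)

Section MoveColorings.
Variables (G : groupType) (m : nat) (a : 'I_m -> G).
Hypothesis red : reduced a.
Local Open Scope group_scope.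
Notation cstep := (cstep a).

Lemma spowN b (x : G) : spow (~~ b) x = (spow b x)^-1.
Proof. by case: b; rewrite /spow /= ?invgK. Qed.

Lemma cstep_fill (nh : nat) (D D' : gd m) (H : hgd m) f f' : holes_ok H nh ->
  (forall i, D i = fill H f i) -> (forall i, D' i = fill H f' i) ->
  (forall c, colors a c D ->
   forall i k x, inr k \in H i -> conjcl a i x -> gok c x (f k) ->
     gok c x (f' k) /\ gend c x (f k) = gend c x (f' k)) ->
  cstep D D'.
Proof.
move=> ok hD hD' hh c cD; exists c => [i|i].
  rewrite hD'; case: (@fill_transport G m a H c c f f' _ _ i) => //; first exact: hh.
  by rewrite -hD.
rewrite hD hD'; case: (@fill_transport G m a H c c f f' _ _ i) => //; first exact: hh.
by rewrite -hD.
Qed.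

Lemma colors_hole c (D : gd m) H f i k : (forall i, D i = fill H f i) -> colors a c D ->
  inr k \in H i -> exists2 x, conjcl a i x & gok c x (f k).
Proof. by move=> hD cD hk; have := cD i; rewrite hD => /(fill_hole hk). Qed.

Lemma conj_self (x y : G) b : x = y -> x ^ spow b y = x.
Proof. by move=> ->; rewrite conjgE; case: b; rewrite /spow ?mulKg // mulgV mulg1 invgK. Qed.

Lemma cstep_R1 D D' : local_move 1 (@no_cond m) R1_pat D D' -> cstep D' D.
Proof.
move=> [_ [_ [H [f [f' [ok _ [f0 [l [b [s f'0]]]] hD hD']]]]]].
apply: (cstep_fill ok hD' hD) => c _ i k x hk _.
have := hole_lt ok hk; case: k hk => [|k] hk _ //; rewrite f0 f'0 /=.
rewrite /ov /sg /lab /=; case: (b) => /=; first by case=> e _; split=> //; apply: conj_self.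
case=> e _; split=> //; rewrite -e.
have -> : x = c l ^ (spow s (c l))^-1 by rewrite {1}e conjgK.
by rewrite -spowN conj_self.
Qed.

Lemma cstep_R2 D D' : local_move 2 (@no_cond m) R2_pat D D' -> cstep D' D.
Proof.
move=> [_ [_ [H [f [f' [ok _ [f0 [f1 [p [q [s [f'0 f'1]]]]]] hD hD']]]]]].
apply: (cstep_fill ok hD' hD) => c cD i k x hk _.
have [i0 h0] := hole_ex ok (isT : (0 < 2)%N).
have [y _] := colors_hole hD' cD h0; rewrite f'0 /= => -[e1 [e2 _]].
have := hole_lt ok hk; case: k hk => [|[|//]] hk _; rewrite ?f0 ?f1.
  by rewrite f'0 /= .
rewrite /lab /= in e1 e2.
by case: f'1 => -> /= _; split=> //; rewrite /lab /ov /sg /= e1 e2 spowN -conjgM ?mulgV ?mulVg conjg1.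
Qed.

Lemma cstep_OC D D' : local_move 1 (@no_cond m) OC_pat D D' -> cstep D D'.
Proof.
move=> [_ [_ [H [f [f' [ok _ [p [q [s [t [f0 f'0]]]]] hD hD']]]]]].
apply: (cstep_fill ok hD hD') => c cD i k x hk _.
have := hole_lt ok hk; case: k hk => [|k] hk _ //; rewrite f0 f'0 /=.
by move=> [-> [-> _]].
Qed.

Lemma cstep_relabel D D' : relabel D D' -> cstep D' D.
Proof.
move=> [_ [_ [g [_ hg]]]] c cD; exists (c \o g) => i.
  by have := cD i; rewrite hg gok_map.
by rewrite hg gend_map.
Qed.

(** Both colours at a self-crossing are conjugates of the same generator, and such conjugates
    commute. *)
Lemma cstep_sv D D' : local_move 2 (@same_comp m) sv_pat D D' -> cstep D' D.
Proof.
move=> [_ [_ [H [f [f' [ok [j [j0 j1]] [f0 [f1 [p [s [f'0 f'1]]]]] hD hD']]]]]].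
apply: (cstep_fill ok hD' hD) => c cD i k x hk hx.
have [y hy] := colors_hole hD' cD j0; rewrite f'0 /= => -[e _].
have := hole_lt ok hk; case: k hk => [|[|//]] hk _; rewrite ?f0 ?f1.
  by rewrite f'0 /= .
rewrite f'1 /= => _; split=> //; rewrite /sg /lab /= in e *; rewrite e.
have ij := hole_uniq ok hk j1; rewrite -ij in hy.
have cxy : commute x (spow s y).
  have h := abel_comm red (conjcl_abel hx) (conjcl_abel hy).
  by case: (s) => //; apply: commuteV.
by rewrite conjgE cxy mulKg.
Qed.

(* Inside a twist region the strand [j] is only conjugated by conjugates of
   [a i], so it acts on the abelian normal closure of [a i] as at its entrance. *)
Lemma twist_act i j c y sB e : conjcl a j y -> gok c y sB ->
  (forall e, e \in sB -> ~~ ov e -> conjcl a i (c (lab e))) ->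
  e \in sB -> ov e -> forall b x, abel a i x -> x ^ spow b (c (lab e)) = x ^ spow b y.
Proof.
move=> _ + hu es oe.
have actV z : (forall x, abel a i x -> x ^ z = x ^ y) ->
    forall b x, abel a i x -> x ^ spow b z = x ^ spow b y.
  move=> h [|] x hx; first exact: h.
  rewrite /spow; apply: (@conjg_inj _ z); rewrite conjgKV h ?conjgKV //.
  exact: abelJ.
move: {2 3}y (fun x (_ : abel a i x) => erefl (x ^ y)) => y'.
elim: sB y' hu es => // e' s IH y' hu es hy'.
have hu' : forall e, e \in s -> ~~ ov e -> conjcl a i (c (lab e)).
  by move=> e0 e0s; apply: hu; rewrite inE e0s orbT.
rewrite /=; case: ifP => o.
  case=> cy h; move: es; rewrite inE => /orP[/eqP ->|es]; last exact: IH h.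
  by rewrite cy; apply: actV => x /hy'.
move=> h; move: es; rewrite inE => /orP[/eqP ee|es]; first by rewrite -ee oe in o.
apply: (IH _ hu' es _ h) => x hx.
set g := spow _ _.
have hg : abel a i g.
  have : conjcl a i (c (lab e')) by apply: hu; rewrite ?mem_head ?o.
  by rewrite /g; case: (sg e') => /conjcl_abel // /abelV.
have fix_g z : abel a i z -> z ^ g = z.
  by move=> hz; rewrite conjgE (abel_comm red hz hg) mulKg.
have -> : x ^ (y' ^ g) = ((x ^ g^-1) ^ y') ^ g.
  by rewrite -!conjgM conjgE !mulgA.
have hgV : x ^ g^-1 = x by rewrite -[in LHS](fix_g x hx) conjgK.
by rewrite hgV fix_g ?hy' //; apply: abelJ.
Qed.

(** By [twist_act] each of the [n] undercrossings conjugates by the entrance colour of the other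
    strand, with a common sign; in all this is its [n]-th power, a conjugate of [a j ^+ n]. *)
Lemma twist_end i j c x y sA sB s n : conjcl a i x -> conjcl a j y ->
  a j ^+ n = 1 ->
  gok c y sB -> (forall e, e \in sB -> ~~ ov e -> conjcl a i (c (lab e))) ->
  (forall e, e \in sA -> ~~ ov e -> sg e = s /\
     exists2 e', e' \in sB & ov e' /\ lab e' = lab e) ->
  count (fun e => ~~ ov e) sA = n -> gend c x sA = x.
Proof.
move=> hx hy ajn ok hu hA hn.
have -> : gend c x sA = x ^ (spow s y ^+ n).
  rewrite -hn; elim: sA x hx hA {hn} => [|e sA IH] x hx hA /=; first by rewrite conjg1.
  have hA' : forall e, e \in sA -> ~~ ov e -> sg e = s /\
     exists2 e', e' \in sB & ov e' /\ lab e' = lab e.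
    by move=> e0 h0; apply: hA; rewrite inE h0 orbT.
  case: ifP => o; first by rewrite IH.
  have [-> [e' e'B [oe' <-]]] := hA e (mem_head _ _) (negbT o).
  rewrite (twist_act hy ok hu e'B oe') ?IH //=.
  - by rewrite expgS conjgM.
  - exact: conjclJ.
  - exact: conjcl_abel.
have yn : y ^+ n = 1 by case: hy => g ->; rewrite -conjXg ajn conj1g.
by case: (s); rewrite /spow ?expVgn yn ?invg1 conjg1.
Qed.

Lemma count_twist n p : count (fun k => ~~ (odd k (+) p)) (iota 0 (2 * n)) = n.
Proof.
elim: n => // n IH; rewrite mulnS addnC iotaD count_cat IH add0n /=.
by rewrite oddM /=; case: (p) => /=; lia.
Qed.

Lemma cstep_twist n D D' : (forall j, a j ^+ n = 1) ->
  local_move 2 (@no_cond m) (twist_pat n) D D' -> cstep D' D.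
Proof.
move=> an [_ [_ [H [f [f' [ok _ [f0 [f1 [ls [p [s [par [sz [f'0 f'1']]]]]]]] hD hD']]]]]].
pose t1 := twist1 ls p s; pose t2 := twist2 ls p s.
have m1 e : e \in f' 1%N = (e \in t2) by rewrite f'1'; case: (par); rewrite ?mem_rev.
have c1 P : count P (f' 1%N) = count P t2 by rewrite f'1'; case: (par); rewrite ?count_rev.
have t12 e : e \in t1 -> (lab e, ~~ ov e, sg e) \in t2.
  by case/mapP=> k hk ->; apply/mapP; exists k.
have t21 e : e \in t2 -> (lab e, ~~ ov e, sg e) \in t1.
  by case/mapP=> k hk ->; apply/mapP; exists k => //; rewrite /ov /= negbK.
have s1 e : e \in t1 -> sg e = s by case/mapP=> k _ ->.
have s2 e : e \in t2 -> sg e = s by case/mapP=> k _ ->.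
have n1 : count (fun e => ~~ ov e) t1 = n by rewrite count_map sz; exact: count_twist.
have n2 : count (fun e => ~~ ov e) t2 = n.
  rewrite count_map sz -[RHS](count_twist n (~~ p)); apply: eq_count => k.
  by rewrite /= /ov /= addbN.
apply: (cstep_fill ok hD' hD) => c cD i k x hk hx _.
have [i0 h0] := hole_ex ok (isT : (0 < 2)%N).
have [i1 h1] := hole_ex ok (isT : (1 < 2)%N).
have [y0 hy0 ok0] := colors_hole hD' cD h0.
have [y1 hy1 ok1] := colors_hole hD' cD h1.
have u1 e : e \in f' 1%N -> ~~ ov e -> conjcl a i0 (c (lab e)).
  rewrite m1 => /t21 h oe; have := conjcl_over hy0 ok0; rewrite f'0 => /(_ _ h).
  by apply.
have u0 e : e \in f' 0%N -> ~~ ov e -> conjcl a i1 (c (lab e)).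
  rewrite f'0 => /t12; rewrite -m1 => h oe; exact: (conjcl_over hy1 ok1 h).
have := hole_lt ok hk; case: k hk => [|[|//]] hk _; rewrite ?f0 ?f1 /=; split=> //.
  have e0 := hole_uniq ok hk h0; rewrite e0 in hx.
  apply: (twist_end (s := s) hx hy1 (an i1) ok1 u1); last by rewrite f'0.
  move=> e; rewrite f'0 => et oe; split; first exact: s1.
  by exists (lab e, ~~ ov e, sg e) => //; rewrite m1 t12.
have e0 := hole_uniq ok hk h1; rewrite e0 in hx.
apply: (twist_end (s := s) hx hy0 (an i0) ok0 u0); last by rewrite c1.
move=> e; rewrite m1 => et oe; split; first exact: s2.
by exists (lab e, ~~ ov e, sg e) => //; rewrite f'0 t21.
Qed.

Lemma conj_spow (x y : G) b : spow b x ^ y = spow b (x ^ y).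
Proof. by case: b; rewrite /spow ?conjVg. Qed.

(** Only the crossing [r] of the middle strand over the bottom one is recoloured, as the middle
    strand reaches it before the top strand on one side of the move and after it on the other. *)
Lemma cstep_R3 D D' : local_move 3 (@no_cond m) R3_pat D D' -> cstep D D'.
Proof.
move=> [wD [_ [H [f [f' [ok _ pat hD hD']]]]]] c cD.
case: pat => p [q [r [ep' [eq' [er [x [y [z [_ hyz [f0 f1 f2] [f'0 f'1 f'2]]]]]]]]]].
have ho b1 e1 e2 (P : pred ep) : has P (ord2 b1 e1 e2) = P e1 || P e2.
  by case: b1; rewrite /= orbF // orbC.
(* Both endpoints of [r] lie in the holes, so recolouring [r] disturbs nothing else. *)
have rt : has (isep r true) (f 1%N) by rewrite f1 ho /isep /lab /ov /= !eqxx orbT.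
have rf : has (isep r false) (f 2%N) by rewrite f2 ho /isep /lab /ov /= !eqxx orbT.
have [ht ht'] := fill_label_fresh ok wD hD (isT : (1 < 3)%N) rt.
have [hf _] := fill_label_fresh ok wD hD (isT : (2 < 3)%N) rf.
have rH i e : inl e \in H i -> lab e != r.
  move=> ei; have := ht i e ei; have := hf i e ei; rewrite /isep.
  by case: (lab e == r) => //; case: (ov e).
have := ht' 0%N isT; rewrite f0 ho negb_or /isep /lab /ov /= !andbT => /(_ _)[] //.
move=> /andP[pr qr].
have [i0 h0] := hole_ex ok (isT : (0 < 3)%N).
have [T _] := colors_hole hD cD h0.
have -> : gok c T (f 0%N) <-> c p = T /\ c q = T.
  by rewrite f0; case: x {f'0 f0} => /=; split=> [[? [? ?]]|[? ?]].
move=> [cp cq].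
(* If the middle strand met [p] first, the passage below the top strand is undone in the colour at
   [r]; otherwise it is added. *)
pose C := c r; pose C' := C ^ spow (y (+) ep') T.
pose c' l := if l == r then C' else c l.
have c'p : c' p = T by rewrite /c' (negbTE pr).
have c'q : c' q = T by rewrite /c' (negbTE qr).
have c'r : c' r = C' by rewrite /c' eqxx.
have key i : gok c (a i) (fill H f i) -> gok c' (a i) (fill H f' i) /\
    gend c (a i) (fill H f i) = gend c' (a i) (fill H f' i).
  apply: (fill_transport (c2 := c')) => [i' e ei|i' k w hk _].
    by rewrite /c' (negbTE (rH _ _ ei)).
  have := hole_lt ok hk; case: k hk => [|[|[|//]]] hk _.
  - rewrite f0 f'0; case: (x); rewrite /= /lab /ov /= ?c'p ?c'q cp cq.
      by move=> [-> _].
    by move=> [-> _].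
  - rewrite f1 f'1; rewrite /C' /C in c'r; case: (y) c'r => /= c'r; rewrite /= /lab /ov /sg /= ?c'p c'r cp.
      by move=> [-> _]; rewrite spowN conjgK.
    by move=> [-> _].
  - move=> _; split; first by rewrite f'2; case: (z).
    rewrite f2 f'2 /=; case: (z) hyz => /= hyz; rewrite /lab /ov /sg /= c'q c'r cq.
      have -> : spow er C' = spow er C ^ (spow eq' T)^-1.
        rewrite conj_spow /C' -spowN; congr (spow er (C ^ spow _ T)).
        by move: hyz; case: (y); case: (ep'); case: (eq').
      by rewrite -!conjgM -conjgCV.
    have -> : spow er C' = spow er C ^ (spow eq' T).
      rewrite conj_spow /C'; congr (spow er (C ^ spow _ T)).
      by move: hyz; case: (y); case: (ep'); case: (eq').
    by rewrite -!conjgM -conjgC.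
exists c' => i; first by rewrite hD'; apply: (key i _).1; rewrite -hD.
by rewrite hD hD'; apply: (key i _).2; rewrite -hD.
Qed.

End MoveColorings.

(** * Colourings compute Milnor invariants *)

Section Degree.
Variable T : choiceType.
Implicit Types (u v w V : seq (T * bool)) (J : seq T).
Variables (N : nat).
Local Open Scope ring_scope.

Definition cj (i : T) V := ginv V ++ (i, true) :: V.

Definition eqd d u v :=
  forall J, uniq J -> (size J <= d)%N -> (nc u J = nc v J %[mod N%:Z])%Z.

Lemma eqd_refl d u : eqd d u u. Proof. by []. Qed.
Lemma eqd_sym d u v : eqd d u v -> eqd d v u. Proof. by move=> h J uJ sJ; rewrite h. Qed.
Lemma eqd_trans d u v w : eqd d u v -> eqd d v w -> eqd d u w.
Proof. by move=> h1 h2 J uJ sJ; rewrite h1 ?h2. Qed.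
Lemma eqd_cat d u u' v v' : eqd d u u' -> eqd d v v' -> eqd d (u ++ v) (u' ++ v').
Proof.
move=> h1 h2 J uJ sJ; apply: nc_cat_mod => p hp; [apply: h1 | apply: h2].
- exact: take_uniq.
- by rewrite size_take_min; lia.
- exact: drop_uniq.
- by rewrite size_drop; lia.
Qed.
Lemma eqd_cancel d x : eqd d [:: x; linv x] [::].
Proof. by move=> J uJ _; rewrite nc_cancel1. Qed.

Definition dcongr d := WCongr (@eqd_refl d) (@eqd_sym d) (@eqd_trans d) (@eqd_cat d) (@eqd_cancel d).

Lemma eqm_eqd d u v : eqm N u v -> eqd d u v.
Proof. by move=> h J uJ _; apply: h. Qed.

Lemma nc_cjE i V J : uniq J -> nc (cj i V) J = (J == [::])%:R +
  \sum_(p < (size J).+1) nc (ginv V) (take p J) *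
     (if drop p J is j :: J' then if j == i then nc V J' else 0 else 0).
Proof.
move=> uJ; rewrite -(nc_catVl V uJ) /cj !nc_cat -big_split; apply: eq_bigr => p _ /=.
rewrite -mulrDr; congr (_ * (_ + _)).
by case: (drop p J) => // j J'; case: eqP => // _; rewrite mul1r.
Qed.

(** The conjugator contributes only through monomials that also contain the letter [i], so one
    degree is gained. This makes Milnor's iteration converge. *)
Lemma eqd_cj d i V V' : eqd d V V' -> eqd d.+1 (cj i V) (cj i V').
Proof.
move=> h J uJ sJ; rewrite !nc_cjE // -modzDm -[in RHS]modzDm; congr ((_ + _) %% _)%Z.
apply: modz_sum => p; have hp : (p <= size J)%N by rewrite -ltnS.
have hI := @wc_ginv _ (dcongr d) _ _ h.
case e : (drop p J) => [|j J']; rewrite ?mulr0 //; case: (j == i); last by rewrite !mulr0.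
have sz := congr1 size e; rewrite size_drop /= in sz.
rewrite -modzMm -[in RHS]modzMm hI ?take_uniq ?h //.
- by have := drop_uniq p uJ; rewrite e => /andP[].
- by lia.
- by rewrite size_take_min; lia.
Qed.

(** The monomial begins with [i] and contains it once, so the inverse of [V] contributes only its
    constant term. The conjugator is thus recovered from the conjugate. *)
Lemma nc_cj i V J : uniq (i :: J) -> nc (cj i V) (i :: J) = nc V J.
Proof.
move=> uJ; rewrite nc_cjE // add0r big_ord_recl big1 ?addr0 /=.
  by rewrite eqxx nc_w0 mul1r.
move=> p _; case e: (drop _ _) => [|j J']; rewrite ?mulr0 //.
case: eqP => [ji|]; last by rewrite mulr0.
move: uJ => /= /andP[/negP[]]; apply: (@mem_drop p); rewrite -ji.
by move: e => /= ->; rewrite mem_head.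
Qed.

End Degree.

Lemma mem_split (T : eqType) (x : T) s : x \in s -> exists p q, s = p ++ x :: q.
Proof. by case/splitPr=> p q; exists p, q. Qed.

Section MuColoring.
Variable m : nat.
Implicit Types (D : gd m) (J : seq 'I_m) (V : word m).
Local Open Scope ring_scope.

Lemma mcoef_nc (w : word m) J : uniq J -> mcoef w J = nc w J.
Proof.
elim: w J => [|x w IH] J uJ; first by case: J uJ.
rewrite [mcoef _ _]/= big_ord_recl /= take0 drop0 /= IH //.
have -> : letc x.2 0 = 1 by rewrite /letc; case: x.2.
rewrite mul1r; congr (_ + _); case: J uJ => [|j J] uJ; first by rewrite big_ord0.
have uJ' : uniq J by move: uJ => /= /andP[].
rewrite big_ord_recl [X in _ + X]big1 => [|p _]; rewrite /= ?take0 ?drop0 ?addr0.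
  rewrite andbT; case: eqP => // _; rewrite IH //.
case: J uJ uJ' p => [|k J] /=; first by move=> _ _ [].
rewrite inE negb_or => /andP[/andP[jk _] _] _ p.
by case: ifP => // /and3P[/eqP ej /eqP ek _]; rewrite ej ek eqxx in jk.
Qed.

Definition kpow (kp : nat -> word m) (e : ep) : word m :=
  if sg e then kp (lab e) else ginv (kp (lab e)).
Definition lon (kp : nat -> word m) (s : seq ep) : word m :=
  flatten [seq kpow kp e | e <- s & ~~ ov e].

Lemma lon_cat kp s t : lon kp (s ++ t) = lon kp s ++ lon kp t.
Proof. by rewrite /lon filter_cat map_cat flatten_cat. Qed.

Lemma lon_rcons kp s e : ~~ ov e -> lon kp (rcons s e) = lon kp s ++ kpow kp e.
Proof. by move=> oe; rewrite -cats1 lon_cat /lon /= oe /= cats0. Qed.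

Section Arcs.
Variable D : gd m.
Hypothesis wD : wf D.

Lemma over_find j (p q : seq ep) e : D j = p ++ e :: q -> ov e ->
  find (is_over_of (lab e)) (D j) = size p /\
  forall j', has (is_over_of (lab e)) (D j') -> j' = j.
Proof.
move=> hj oe; have [/(_ (lab e)) [_ c1] _] := wD.
have he : is_over_of (lab e) e by rewrite /is_over_of eqxx oe.
have {}c1 : (\sum_(i < m) count (is_over_of (lab e)) (D i) <= 1)%N.
  apply: leq_trans c1; apply/eq_leq/eq_bigr => i _; apply: eq_count => x.
  by rewrite /is_over_of eqb_id.
split=> [|j'].
  have {}c1 := leq_trans (sum_count1 D _ j) c1; move: c1.
  rewrite hj count_cat /= he find_cat /= he addn0 => c1.
  by case: ifP => // /negPn; rewrite has_count; lia.
rewrite has_count => h; apply/eqP/negPn/negP => ne.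
move: c1; rewrite (bigD1 j') //= (bigD1 j) 1?eq_sym //=.
by rewrite hj count_cat /= he; lia.
Qed.

Lemma over_arc_at i0 j (p q : seq ep) e : D j = p ++ e :: q -> ov e ->
  over_arc D i0 (lab e) = (j, count (fun e => ~~ ov e) p).
Proof.
move=> hj oe; rewrite /over_arc; have [hf hu] := over_find hj oe.
case: pickP => [j' /hu -> |/(_ j)]; first by rewrite hf hj take_size_cat.
by rewrite hj has_cat /= /is_over_of eqxx oe orbT.
Qed.

Lemma under_over i e : e \in D i -> ~~ ov e -> exists j p q e',
  [/\ D j = p ++ e' :: q, ov e' & lab e' = lab e].
Proof.
move=> ei oe; have [/(_ (lab e)) [c1 _] _] := wD.
have : (0 < cnt D (lab e) false)%N.
  apply: leq_trans (sum_count1 D _ i); rewrite -has_count; apply/hasP; exists e => //.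
  by rewrite eqxx (negbTE oe).
rewrite -c1 lt0n /cnt sum_nat_eq0 => /forallPn[j] /=; rewrite -lt0n -has_count.
case/hasP=> e' /mem_split[p [q hj]] /andP[/eqP el /eqP oe'].
by exists j, p, q, e'.
Qed.

(** Milnor's [k]-th approximation to the colour of the over-arc at crossing [l]. *)
Definition kap (k l : nat) : word m :=
  if [pick j | has (is_over_of l) (D j)] is Some j then
    arcw D k j (count (fun e => ~~ ov e) (take (find (is_over_of l) (D j)) (D j)))
  else [::].

Lemma kap_at k j (p q : seq ep) e : D j = p ++ e :: q -> ov e ->
  kap k (lab e) = arcw D k j (count (fun e => ~~ ov e) p).
Proof.
move=> hj oe; have := over_arc_at j hj oe; rewrite /over_arc /kap.
by case: pickP => [j' _ [-> ->]|/(_ j)] //; rewrite hj has_cat /= /is_over_of eqxx oe orbT.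
Qed.

Lemma uletter_kap k i e : e \in D i -> ~~ ov e -> uletter D i (arcw D k) e = kpow (kap k) e.
Proof.
move=> ei oe; have [j [p [q [e' [hj oe' el]]]]] := under_over ei oe.
by rewrite /uletter /kpow -el (over_arc_at _ hj oe') (kap_at _ hj oe').
Qed.

Lemma lon_kap k i (p q : seq ep) : D i = p ++ q ->
  flatten [seq uletter D i (arcw D k) e | e <- [seq e <- p | ~~ ov e]] = lon (kap k) p.
Proof.
move=> hi; rewrite /lon; congr flatten; apply/eq_in_map => e; rewrite mem_filter => /andP[oe ep].
by rewrite uletter_kap // hi mem_cat ep.
Qed.

Lemma kapS_at k j (p q : seq ep) e : D j = p ++ e :: q -> ov e ->
  kap k.+1 (lab e) = cj j (lon (kap k) p).
Proof.
move=> hj oe; rewrite (kap_at _ hj oe) /= -(lon_kap k hj) /cj.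
have -> // : take (count (fun e => ~~ ov e) p) (unders D j) = [seq e <- p | ~~ ov e].
by rewrite /unders hj filter_cat take_size_cat // size_filter.
Qed.

Lemma kap0_at j (p q : seq ep) e : D j = p ++ e :: q -> ov e -> kap 0 (lab e) = [:: (j, true)].
Proof. by move=> hj oe; rewrite (kap_at _ hj oe). Qed.

Definition oveq (E : word m -> word m -> Prop) (k1 k2 : nat -> word m) :=
  forall j (p q : seq ep) e, D j = p ++ e :: q -> ov e -> E (k1 (lab e)) (k2 (lab e)).

Lemma lon_congr (E : wcongr 'I_m) k1 k2 i (p q : seq ep) : oveq E k1 k2 -> D i = p ++ q ->
  E (lon k1 p) (lon k2 p).
Proof.
move=> h; elim/last_ind: p q => [|p e IH] q hi; first exact: wc_refl.
rewrite cat_rcons in hi; have {}IH := IH _ hi.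
have [oe|oe] := boolP (ov e).
  by rewrite -cats1 !lon_cat /lon /= oe /= !cats0.
rewrite !lon_rcons //; apply: wc_cat => //.
have [|j [p' [q' [e' [hj oe' el]]]]] := under_over (i := i) (e := e) _ oe.
  by rewrite hi mem_cat mem_head orbT.
by rewrite /kpow -el; case: (sg e); [|apply: wc_ginv]; exact: h hj oe'.
Qed.

(** The first two approximations share their linear part, and every further iteration is a
    conjugation, which gains a degree by [eqd_cj]. *)
Lemma kap_stable k : oveq (dcongr 'I_m 0 k.+1) (kap k) (kap k.+1).
Proof.
elim: k => [|k IH] j p q e hj oe /=.
  rewrite (kap0_at hj oe) (kapS_at _ hj oe) -[[:: _]]/(cj j [::]).
  by apply: eqd_cj => J _; rewrite leqn0 size_eq0 => /eqP ->; rewrite !nc_w0.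
rewrite !(kapS_at _ hj oe); apply: eqd_cj.
exact: (lon_congr (E := dcongr 'I_m 0 k.+1) IH hj).
Qed.

Section Valid.
Variable N : nat.
Let G := wquot (mcongr 'I_m N).
Definition mgen (i : 'I_m) : G := wpi _ [:: (i, true)].

Lemma wpi_cj i V : wpi (mcongr 'I_m N) (cj i V) = (mgen i ^ wpi _ V)%g.
Proof. by rewrite /cj wpi_cat wpi_ginv wpi_cons conjgE. Qed.

Lemma gend_lon (kp : nat -> word m) i s V :
  gend (fun l => wpi (mcongr 'I_m N) (kp l)) (wpi _ (cj i V)) s = wpi _ (cj i (V ++ lon kp s)).
Proof.
elim: s V => [|e s IH] V; first by rewrite cats0.
rewrite -cat1s lon_cat /= /lon /=; case: (ov e) => //=; rewrite cats0 catA -IH.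
congr gend; rewrite !wpi_cj -conjgM wpi_cat /kpow /spow; congr (_ ^ (_ * _))%g.
by case: (sg e); rewrite ?wpi_ginv.
Qed.

Lemma gok_lon (kp : nat -> word m) i s V :
  gok (fun l => wpi (mcongr 'I_m N) (kp l)) (wpi _ (cj i V)) s <->
  (forall (p q : seq ep) e, s = p ++ e :: q -> ov e ->
     eqm N (kp (lab e)) (cj i (V ++ lon kp p))).
Proof.
split=> [+ p q e es oe|h].
  rewrite es gok_cat gend_lon /= oe => -[_ [h _]].
  by apply/(@wpiP _ (mcongr 'I_m N)).
suff H p q : s = p ++ q -> gok (fun l => wpi (mcongr 'I_m N) (kp l)) (wpi _ (cj i (V ++ lon kp p))) q.
  by have := H [::] s erefl; rewrite cats0.
elim: q p => //= e q IH p es; have := IH (rcons p e); rewrite cat_rcons => /(_ es).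
case: ifP => oe; first by rewrite -cats1 lon_cat /lon /= oe cats0; split=> //; apply/wpiP/(h _ _ _ es).
rewrite lon_rcons ?oe // catA.
suff -> : wpi (mcongr 'I_m N) (cj i ((V ++ lon kp p) ++ kpow kp e)) =
  (wpi (mcongr 'I_m N) (cj i (V ++ lon kp p)) ^ spow (sg e) (wpi (mcongr 'I_m N) (kp (lab e))))%g by [].
rewrite !wpi_cj -conjgM wpi_cat /kpow /spow; congr (_ ^ (_ * _))%g.
by case: (sg e); rewrite ?wpi_ginv.
Qed.

Lemma colors_exist : exists c, colors mgen c D.
Proof.
exists (fun l => wpi _ (kap m l)) => i; rewrite -[mgen i]/(wpi _ (cj i [::])).
apply/gok_lon => p q e hi oe; rewrite cat0s -(kapS_at _ hi oe).
(* A non-repeated monomial has at most [m] letters, so the [m]-th approximation is already exact. *)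
apply: eqm0W => J uJ; apply: (kap_stable hi oe) => //.
by apply: (leq_trans _ (leqnSn m)); have := uniq_leq_size uJ (fun x _ => mem_enum _ x); rewrite size_enum_ord.
Qed.

(** The conditions on a colouring are the fixed-point equations of the iteration, so all colourings
    agree with it degree by degree. *)
Lemma kap_valid c : colors mgen c D ->
  forall k, oveq (dcongr 'I_m N k.+1) (kap k) (fun l => repr (c l)).
Proof.
move=> cD; have hc l : c l = wpi _ (repr (c l)) by rewrite /wpi reprK.
have ok i : gok (fun l => wpi (mcongr 'I_m N) (repr (c l))) (wpi _ (cj i [::])) (D i).
  have := cD i; rewrite -[mgen i]/(wpi _ (cj i [::])); congr gok.
  by apply: funext.
elim=> [|k IH] j p q e hj oe /=.
  apply: (@eqd_trans _ _ _ _ (cj j (lon (fun l => repr (c l)) p))); last first.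
    by apply/eqd_sym/eqm_eqd; have /gok_lon/(_ _ _ _ hj oe) := ok j.
  rewrite (kap0_at hj oe) -[[:: _]]/(cj j [::]); apply: eqd_cj => J _.
  by rewrite leqn0 size_eq0 => /eqP ->; rewrite !nc_w0.
apply: (@eqd_trans _ _ _ _ (cj j (lon (fun l => repr (c l)) p))); last first.
  by apply/eqd_sym/eqm_eqd; have /gok_lon/(_ _ _ _ hj oe) := ok j.
rewrite (kapS_at _ hj oe); apply: eqd_cj.
exact: (lon_congr (E := dcongr 'I_m N k.+1) IH hj).
Qed.

(** The power of the [i]-th meridian that normalizes the longitude is invisible on monomials without
    [i]. *)
Lemma mu_lon J i q : uniq (rcons J i) -> q = (size J).+1 ->
  mu D (rcons J i) = nc (lon (kap q) (D i)) J.
Proof.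
rewrite rcons_uniq => /andP[iJ uJ] ->; rewrite /mu rev_rcons size_rcons revK mcoef_nc //.
rewrite /lambda /unders (lon_kap _ (q := [::])) ?cats0 //.
rewrite -(nc_filter _ iJ) filter_cat -[in RHS](nc_filter _ iJ).
suff -> : [seq x <- wpow i (- self_exp D i) | x.1 != i] = [::] by [].
by case: (- _) => k /=; rewrite ?eqxx /=; elim: k => //= k ->; rewrite eqxx.
Qed.

(* The final colour of strand [i] is [X_i] conjugated by the longitude, and its
   coefficient at [i :: J] is the coefficient of the longitude at [J]. *)
Lemma mu_gend c V J i : colors mgen c D -> uniq (rcons J i) ->
  gend c (mgen i) (D i) = wpi _ (cj i V) ->
  (mu D (rcons J i) = nc V J %[mod N%:Z])%Z.
Proof.
move=> cD uJ hV; rewrite (mu_lon uJ erefl).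
have uJ' : uniq (i :: J) by move: uJ; rewrite rcons_uniq.
have uJ2 : uniq J by case/andP: uJ'.
have := lon_congr (E := dcongr 'I_m N (size J).+2) (kap_valid cD (k := _)) (esym (cats0 (D i))).
move=> /= /(_ J uJ2 (leqW (leqnSn _))) ->.
rewrite -(nc_cj V uJ') -(nc_cj (lon _ _) uJ').
have hc : c = (fun l => wpi (mcongr 'I_m N) (repr (c l))).
  by apply: funext => l; rewrite /wpi reprK.
have : wpi (mcongr 'I_m N) (cj i (lon (fun l => repr (c l)) (D i))) = wpi _ (cj i V).
  by rewrite -hV -(cat0s (lon _ _)) -gend_lon -hc.
by move/wpiP => /=; apply.
Qed.
End Valid.
End Arcs.

(** The common terminal colour is the conjugate of the generator by one word [V], and both
    invariants are read from this [V]. *)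
Lemma mu_cstep N (D D' : gd m) I : wf D -> wf D' -> cstep (mgen N) D D' -> uniq I ->
  (mu D I = mu D' I %[mod N%:Z])%Z.
Proof.
move=> wD wD' st uI; case/lastP: I uI => // J i uI.
have [c cD] := colors_exist wD N; have [c' cD' e] := st c cD.
have [g hg] : conjcl (mgen N) i (gend c (mgen N i) (D i)).
  exact/conjcl_gend/conjcl_gen.
have [V hV] := wpi_surj g; rewrite hV -wpi_cj in hg.
by rewrite (mu_gend wD cD uI hg) (mu_gend wD' cD' uI (etrans (esym (e i)) hg)).
Qed.

End MuColoring.

(** * Invariance of the coefficients modulo n and of the linking differences *)

Section Forward.
Variable m : nat.
Implicit Types (D : gd m) (J : seq 'I_m).
Local Open Scope ring_scope.

Lemma reduced_mgen N : reduced (@mgen m N).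
Proof. exact: reduced_magnus. Qed.

Lemma mgenX N j : (mgen N j ^+ N = 1 :> wquot (mcongr 'I_m N))%g.
Proof.
have h k : (mgen N j ^+ k = wpi (mcongr 'I_m N) (nseq k (j, true)))%g.
  by elim: k => // k IH; rewrite expgS IH -[nseq k.+1 _]/([:: (j, true)] ++ nseq k _) wpi_cat.
by rewrite h; apply/wpiP/eqm_nseq.
Qed.

Lemma local_move_wf nh C P D D' : @local_move m nh C P D D' -> wf D /\ wf D'.
Proof. by case=> ? []. Qed.

(** The modulus is arbitrary: [n] serves condition (i), and 0 gives the equality of integers behind
    condition (ii). *)
Lemma mu_welded_sv N D D' I : uniq I ->
  welded_step D D' \/ local_move 2 (@same_comp m) sv_pat D D' ->
  (mu D I = mu D' I %[mod N%:Z])%Z.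
Proof.
move=> uI [[h|[h|[h|[h|h]]]]|h].
- have [w w'] := local_move_wf h; apply/esym/(mu_cstep w' w) => //; exact: cstep_R1 h.
- have [w w'] := local_move_wf h; apply/esym/(mu_cstep w' w) => //; exact: cstep_R2 h.
- have [w w'] := local_move_wf h; apply: (mu_cstep w w') => //; exact: cstep_R3 h.
- have [w w'] := local_move_wf h; apply: (mu_cstep w w') => //; exact: cstep_OC h.
- have [w [w' _]] := h; apply/esym/(mu_cstep w' w) => //; exact: cstep_relabel h.
- have [w w'] := local_move_wf h; apply/esym/(mu_cstep w' w) => //.
  apply: cstep_sv h; exact: reduced_mgen.
Qed.

Lemma mu_step_mod n D D' I : uniq I -> step_2n_sv n D D' ->
  (mu D I = mu D' I %[mod n%:Z])%Z.
Proof.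
move=> uI [h|[h|h]]; try by apply: mu_welded_sv => //; [left + right].
have [w w'] := local_move_wf h; apply/esym/(mu_cstep w' w) => //.
apply: cstep_twist h; [exact: reduced_mgen | exact: mgenX].
Qed.

(** A partial linking number. The map [c] names the over-strand of each crossing, so that pieces of
    a strand can be counted without reference to a diagram. *)
Definition lkc (c : nat -> 'I_m) (s : seq ep) (i : 'I_m) : int :=
  \sum_(e <- s | ~~ ov e && (c (lab e) == i)) sgi (sg e).

Definition comp_of (c : nat -> 'I_m) D := forall j e, e \in D j -> ov e -> c (lab e) = j.

Lemma nc_cat1 (u v : word m) i : nc (u ++ v) [:: i] = nc u [:: i] + nc v [:: i].
Proof. by rewrite nc_cat !big_ord_recl big_ord0 /= !nc_w0 mul1r mulr1 addr0 addrC. Qed.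

Lemma nc_ginv1 (u : word m) i : nc (ginv u) [:: i] = - nc u [:: i].
Proof. by apply/eqP; rewrite -addr_eq0 -nc_cat1 nc_catVl. Qed.

Lemma nc_arcw1 D k j p i : nc (arcw D k j p) [:: i] = (j == i)%:R.
Proof.
case: k => [|k]; first by rewrite /= add0r eq_sym; case: eqP.
rewrite /= -cat1s !nc_cat1 nc_ginv1 addrCA addNr addr0.
by rewrite /= add0r eq_sym; case: eqP.
Qed.

Lemma comp_of_ex D (i0 : 'I_m) : wf D -> exists c, comp_of c D.
Proof.
move=> wD; exists (fun l => (over_arc D i0 l).1) => j e /mem_split[p [q hj]] oe.
by rewrite (over_arc_at wD i0 hj oe).
Qed.

Lemma mu_lk D c i j : wf D -> comp_of c D -> i != j -> mu D [:: i; j] = lkc c (D j) i.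
Proof.
move=> wD hc ij; rewrite -[[:: i; j]]/(rcons [:: i] j) (mu_lon wD _ erefl); last first.
  by rewrite /= inE ij.
move: (kap D _) (kap_at wD (size [:: i]).+1) => kp hkp.
suff H s : {subset s <= D j} -> nc (lon kp s) [:: i] = lkc c s i by exact: H.
rewrite /lkc; elim: s => [|e s IH] sub; first by rewrite big_nil.
rewrite big_cons -cat1s lon_cat nc_cat1 IH => [|x xs]; last by apply: sub; rewrite inE xs orbT.
rewrite /lon /=; case oe: (ov e) => /=; first by rewrite add0r.
have [|j' [p [q [e' [hj' oe' el]]]]] := under_over wD (i := j) (e := e) _ (negbT oe).
  by apply: sub; rewrite mem_head.
have -> : c (lab e) = j' by rewrite -el; apply: hc; rewrite // hj' mem_cat mem_head orbT.
rewrite cats0 /kpow -el (hkp _ _ _ _ hj' oe').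
case: (sg e); rewrite ?nc_ginv1 nc_arcw1 /sgi; case: eqP => _ //=; by rewrite ?oppr0 add0r.
Qed.

Lemma lkc_cat c s t i : lkc c (s ++ t) i = lkc c s i + lkc c t i.
Proof. by rewrite /lkc big_cat. Qed.

Lemma lkc_fill (H : hgd m) f nh c i j : holes_ok H nh ->
  lkc c (fill H f j) i = lkc c (pmap (fun x => if x is inl e then Some e else None) (H j)) i +
  \sum_(k < nh) (count (pred1 (inr (nat_of_ord k) : ep + nat)) (H j))%:R * lkc c (f k) i.
Proof.
move=> ok; have : forall k, inr k \in H j -> (k < nh)%N by move=> k; apply: hole_lt.
rewrite /fill; elim: (H j) => [|y s IH] hk.
  by rewrite /= big1 ?addr0 // => k _; rewrite mul0r.
have hk' k : inr k \in s -> (k < nh)%N by move=> ks; apply: hk; rewrite inE ks orbT.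
rewrite /= lkc_cat {}IH //; case: y hk => [e|k] hk /=.
  rewrite -[e :: pmap _ _]/([:: e] ++ pmap _ _) lkc_cat -addrA; congr (_ + (_ + _)).
have lt := hk k (mem_head _ _).
rewrite addrCA; congr (_ + _).
rewrite [in RHS](bigD1 (Ordinal lt)) //= eqxx natrD mulrDl mul1r -addrA; congr (_ + _).
rewrite (bigD1 (Ordinal lt)) //=; congr (_ + _); apply: eq_bigr => l ne.
rewrite (_ : _ == _ = false) //; apply/eqP => -[e]; case/negP: ne; apply/eqP/val_inj.
by rewrite /= e.
Qed.

Lemma lkc_const c s i t j : (forall e, e \in s -> ~~ ov e -> sg e = t /\ c (lab e) = j) ->
  lkc c s i = (j == i)%:R * (sgi t * (count (fun e => ~~ ov e) s)%:R).
Proof.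
rewrite /lkc; elim: s => [|e s IH] h; first by rewrite big_nil !mulr0.
rewrite big_cons IH => [|x xs]; last by apply: h; rewrite inE xs orbT.
rewrite /=; case oe: (ov e) => //=.
have [-> ->] := h e (mem_head _ _) (negbT oe).
by case: eqP => _; rewrite /= ?mul0r // !mul1r natrD mulrDr mulr1.
Qed.

Lemma count_hole (H : hgd m) nh i j k : holes_ok H nh -> inr k \in H i ->
  count (pred1 (inr k : ep + nat)) (H j) = (j == i).
Proof.
move=> ok hk; have [-> | ne] := eqVneq j i; last first.
  apply/eqP; rewrite -leqn0 leqNgt -has_count has_pred1; apply/negP => h.
  by rewrite (hole_uniq ok hk h) eqxx in ne.
have := ok k; rewrite (hole_lt ok hk) (bigD1 i) //= big1 ?addn0 // => l ne.
apply/eqP; rewrite -leqn0 leqNgt -has_count has_pred1; apply/negP => h.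
by rewrite (hole_uniq ok hk h) eqxx in ne.
Qed.

(** Each of the two pieces has [n] undercrossings of a common sign, so [t] is the same for both
    orders of the pair. If the pieces lie on one strand, both corrections vanish because
    [i != j]. *)
Lemma lk_twist n D D' : local_move 2 (@no_cond m) (twist_pat n) D D' ->
  exists i0 i1 (t : int), forall i j, i != j ->
   mu D' [:: i; j] = mu D [:: i; j] + ((j == i0) && (i == i1))%:R * t + ((j == i1) && (i == i0))%:R * t.
Proof.
move=> [wD [wD' [H [f [f' [ok _ [f0 [f1 [ls [p [s [par [sz [f'0 f'1']]]]]]]] hD hD']]]]]].
pose t1 := twist1 ls p s; pose t2 := twist2 ls p s.
have m1 e : e \in f' 1%N = (e \in t2) by rewrite f'1'; case: (par); rewrite ?mem_rev.
have c1 P : count P (f' 1%N) = count P t2 by rewrite f'1'; case: (par); rewrite ?count_rev.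
have t12 e : e \in t1 -> (lab e, ~~ ov e, sg e) \in t2.
  by case/mapP=> k hk ->; apply/mapP; exists k.
have t21 e : e \in t2 -> (lab e, ~~ ov e, sg e) \in t1.
  by case/mapP=> k hk ->; apply/mapP; exists k => //; rewrite /ov /= negbK.
have n1 : count (fun e => ~~ ov e) t1 = n by rewrite count_map sz; exact: count_twist.
have n2 : count (fun e => ~~ ov e) t2 = n.
  rewrite count_map sz -[RHS](count_twist n (~~ p)); apply: eq_count => k.
  by rewrite /= /ov /= addbN.
have [i0 h0] := hole_ex ok (isT : (0 < 2)%N).
have [i1 h1] := hole_ex ok (isT : (1 < 2)%N).
have sub i k e : inr k \in H i -> e \in f' k -> e \in D' i.
  rewrite hD' /fill => hk ek; apply/flattenP; exists (f' k) => //.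
  by apply/mapP; exists (inr k).
(* A component map of the larger diagram [D'] also serves [D], whose crossings all persist. *)
have [c hc] := comp_of_ex i0 wD'.
have hcD : comp_of c D.
  move=> j e; rewrite hD => /flattenP[s' /mapP[[e'|k] hk ->]].
    rewrite inE => /eqP -> oe; apply: hc => //; rewrite hD'; apply/flattenP; exists [:: e'].
      by apply/mapP; exists (inl e').
    by rewrite mem_head.
  by have := hole_lt ok hk; case: k hk => [|[|//]] hk _; rewrite ?f0 ?f1.
exists i0, i1, (sgi s * n%:R) => i j ij; rewrite (mu_lk wD' hc ij) (mu_lk wD hcD ij).
rewrite hD hD' !(lkc_fill _ _ _ _ ok) -addrA -addrA; congr (_ + _).
rewrite !big_ord_recl !big_ord0 /= f0 f1 !(count_hole j ok h0) !(count_hole j ok h1).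
rewrite [lkc c [::] i]big_nil !mulr0 !add0r addr0.
rewrite (@lkc_const c (f' 0%N) i s i1); last first.
  move=> e; rewrite f'0 => et oe; split; first by case/mapP: et => k _ ->.
  by rewrite -[lab e]/(lab (lab e, ~~ ov e, sg e)); apply: hc => //; apply: (sub _ 1%N) => //; rewrite m1 t12.
rewrite (@lkc_const c (f' (bump 0 0)) i s i0); last first.
  move=> e; rewrite m1 => et oe; split; first by case/mapP: et => k _ ->.
  by rewrite -[lab e]/(lab (lab e, ~~ ov e, sg e)); apply: hc => //; apply: (sub _ 0%N) => //; rewrite f'0 t21.
rewrite c1 f'0 n1 n2 ![_ == i]eq_sym !mulrA -!natrM !mulnb; congr (_ + _); by rewrite mulrA.
Qed.

Lemma lk_step n D D' (i j : 'I_m) : (i < j)%N -> step_2n_sv n D D' ->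
  mu D [:: i; j] - mu D [:: j; i] = mu D' [:: i; j] - mu D' [:: j; i].
Proof.
move=> lt; have ij : i != j by rewrite -val_eqE neq_ltn lt.
have ji : j != i by rewrite eq_sym.
have u1 : uniq [:: i; j] by rewrite /= inE ij.
have u2 : uniq [:: j; i] by rewrite /= inE ji.
have ex I : uniq I -> welded_step D D' \/ local_move 2 (@same_comp m) sv_pat D D' -> mu D I = mu D' I.
  by move=> uI h; have := mu_welded_sv 0 uI h; rewrite !modz0.
case=> [h|[h|h]]; try by rewrite !ex //; [left + right | left + right].
have [i0 [i1 [t ht]]] := lk_twist h; rewrite !ht //.
by rewrite [(j == i0) && _]andbC [(j == i1) && _]andbC; ring.
Qed.

Theorem forward n D D' : equiv_2n_sv n D D' ->
  (forall I, uniq I -> (mu D I = mu D' I %[mod n%:Z])%Z) /\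
  (forall i j : 'I_m, (i < j)%N ->
      mu D [:: i; j] - mu D [:: j; i] = mu D' [:: i; j] - mu D' [:: j; i]).
Proof.
elim=> {D D'} [D D' st|D|D D' _ [h1 h2]|D1 D2 D3 _ [h1 h2] _ [h3 h4]]; split=> //.
- by move=> I uI; apply: mu_step_mod st.
- by move=> i j lt; apply: lk_step st.
- by move=> I uI; rewrite h1.
- by move=> i j lt; rewrite h2.
- by move=> I uI; rewrite h1 ?h3.
- by move=> i j lt; rewrite h2 ?h4.
Qed.
End Forward.

(** * Diagrams presented by atoms *)

Section Substitution.
Variable m : nat.
Implicit Types (C : 'I_m -> seq nat) (D : gd m).

Definition atoms C : seq nat := flatten [seq C i | i <- enum 'I_m].
Definition sub C (sg : nat -> seq ep) : gd m := fun i => flatten [seq sg z | z <- C i].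

Lemma mem_atoms C z : reflect (exists i, z \in C i) (z \in atoms C).
Proof.
apply: (iffP flattenP) => [[s /mapP[i _ ->] zs]|[i zi]]; first by exists i.
by exists (C i) => //; apply/mapP; exists i; rewrite ?mem_enum.
Qed.

Lemma mem_atomsW C z i : z \in C i -> z \in atoms C.
Proof. by move=> h; apply/mem_atoms; exists i. Qed.

Lemma sum_atoms C (F : nat -> nat) :
  \sum_(z <- atoms C) F z = \sum_(i < m) \sum_(z <- C i) F z.
Proof. by rewrite /atoms big_flatten big_map big_enum. Qed.

Lemma count_atoms C z : uniq (atoms C) -> \sum_(i < m) count_mem z (C i) = (z \in atoms C).
Proof.
move=> u; rewrite -count_uniq_mem // -sum1_count /atoms big_flatten big_map big_enum /=.
by apply: eq_bigr => i _; rewrite sum1_count.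
Qed.

Lemma atoms_uniq_strand C i : uniq (atoms C) -> uniq (C i).
Proof.
move=> u; have sz z : count_mem z (C i) <= 1.
  have := count_atoms z u; rewrite (bigD1 i) //= => e.
  by apply: leq_trans (leq_b1 (z \in atoms C)); rewrite -e leq_addr.
elim: (C i) sz => //= x s IH sz; rewrite IH ?andbT => [|z].
  by rewrite -has_pred1 has_count -leqNgt; have := sz x; rewrite eqxx add1n ltnS.
by apply: leq_trans (sz z); rewrite leq_addl.
Qed.

Lemma atoms_strand_eq C i j z : uniq (atoms C) -> z \in C i -> z \in C j -> i = j.
Proof.
move=> u zi zj; apply/eqP/negPn/negP => ne.
have := count_atoms z u; rewrite (bigD1 i) //= (bigD1 j) 1?eq_sym //=.
move: zi zj; rewrite -!has_pred1 !has_count.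
move: (count _ _) (count _ _) (\sum_(_ < m | _) _) => p q r; have := leq_b1 (z \in atoms C).
move: (nat_of_bool _) => b; lia.
Qed.

(** Converts a change of the contents of finitely many atoms into a [local_move]: hole [k] lies in
    the [k]-th atom of [zs], between the unchanged pieces [u k] and [v k]. *)
Lemma sub_local_move C (zs : seq nat) (u v f f' : nat -> seq ep) (s s' : nat -> seq ep)
  (Hcond : hgd m -> Prop) (P : (nat -> seq ep) -> (nat -> seq ep) -> Prop) :
  uniq (atoms C) -> uniq zs -> {subset zs <= atoms C} ->
  (forall z, z \in atoms C -> z \notin zs -> s z = s' z) ->
  (forall k, k < size zs -> s (nth 0 zs k) = u k ++ f k ++ v k) ->
  (forall k, k < size zs -> s' (nth 0 zs k) = u k ++ f' k ++ v k) ->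
  (forall H : hgd m, (forall k i, k < size zs -> nth 0 zs k \in C i -> (inr k : ep + nat) \in H i) -> Hcond H) ->
  P f f' -> wf (sub C s) -> wf (sub C s') ->
  local_move (size zs) Hcond P (sub C s) (sub C s').
Proof.
move=> uC uz sz ss' hs hs' hc Pff wD wD'; split=> //; split=> //.
pose g z : seq (ep + nat) := if z \in zs then
   let k := index z zs in map inl (u k) ++ inr k :: map inl (v k) else map inl (s z).
pose H : hgd m := fun i => flatten [seq g z | z <- C i].
have cg k z : count (pred1 (inr k : ep + nat)) (g z) = (z \in zs) && (k == index z zs).
  have c0 (t : seq ep) : count (pred1 (inr k : ep + nat)) (map inl t) = 0.
    by rewrite count_map; apply/eqP; rewrite -leqn0 leqNgt -has_count; apply/hasPn.
  rewrite /g; case: (z \in zs) => //=; rewrite count_cat /= !c0 addn0 add0n eq_sym.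
  by [].
have fillg h z : (forall k, k < size zs -> s' (nth 0 zs k) = u k ++ f' k ++ v k) ->
  flatten [seq match x with inl e => [:: e] | inr k => h k end | x <- g z] =
  if z \in zs then u (index z zs) ++ h (index z zs) ++ v (index z zs) else s z.
  have fl (t : seq ep) : flatten [seq match x with inl e => [:: e] | inr k => h k end | x <- map inl t] = t.
    by rewrite -map_comp; elim: t => //= x t ->.
  by move=> _; rewrite /g; case: ifP => _; rewrite ?fl // map_cat flatten_cat /= !fl.
have fillH h i : fill H h i = flatten [seq flatten [seq match x with inl e => [:: e] | inr k => h k end | x <- g z] | z <- C i].
  rewrite /fill /H map_flatten; elim: (C i) => //= z t IH; rewrite flatten_cat IH.
  by [].
exists H, f, f'; split=> //.
- move=> k; transitivity (\sum_(z <- atoms C) count (pred1 (inr k : ep + nat)) (g z)).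
    by rewrite sum_atoms; apply: eq_bigr => i _; rewrite /H count_flatten sumnE !big_map.
  case: (ltnP k (size zs)) => hk; last first.
    rewrite big1 // => z _; rewrite cg; case: (boolP (z \in zs)) => //= zz.
    by rewrite -index_mem in zz; case: eqP => // ek; move: hk; rewrite ek leqNgt zz.
  rewrite (bigD1_seq (nth 0 zs k)) //=; last by apply/sz/mem_nth.
  rewrite cg mem_nth // index_uniq // eqxx big1 // => z nz; rewrite cg.
  case: (boolP (z \in zs)) => //= zz; case: eqP => // ek; case/negP: nz; apply/eqP.
  by rewrite ek nth_index.
- apply: hc => k i hk ki; apply/flattenP; exists (g (nth 0 zs k)); first exact: map_f.
  by rewrite /g mem_nth // index_uniq // mem_cat mem_head orbT.
- move=> i; rewrite fillH /sub; congr flatten; apply/eq_in_map => z zC.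
  rewrite fillg //; case: ifP => // zz; rewrite -[in LHS](nth_index 0 zz) hs ?index_mem //.
- move=> i; rewrite fillH /sub; congr flatten; apply/eq_in_map => z zC.
  rewrite fillg //; case: ifP => [zz|/negbT zz]; last by rewrite -ss' ?(mem_atomsW zC).
  by rewrite -[in LHS](nth_index 0 zz) hs' ?index_mem.
Qed.

Lemma wf_perm D D' : (forall i, perm_eq (D i) (D' i)) -> wf D -> wf D'.
Proof.
move=> h [c s]; have ce l b : cnt D' l b = cnt D l b.
  by apply: eq_bigr => i _; apply/esym/permP/h.
split=> [l|i j e e' ei ej]; first by rewrite !ce.
by apply: (s i j); rewrite (perm_mem (h _)).
Qed.

End Substitution.

(** Reduces reorderings of overcrossings to adjacent transpositions, which are OC moves. *)
Lemma perm_swap_ind (T : eqType) (R : seq T -> seq T -> Prop) :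
  (forall s, R s s) -> (forall s t r, R s t -> R t r -> R s r) ->
  (forall u a b v, R (u ++ a :: b :: v) (u ++ b :: a :: v)) ->
  forall s t, perm_eq s t -> R s t.
Proof.
move=> rr rt rs s t p.
have bring (x : T) v w : forall u, R (w ++ x :: u ++ v) (w ++ u ++ x :: v).
  move=> u; elim: u w => [|y u IH] w; first exact: rr.
  apply: rt (rs w x y (u ++ v)) _.
  by have := IH (rcons w y); rewrite !cat_rcons.
suff H w : R (w ++ s) (w ++ t) by exact: (H [::]).
elim: s t p w => [|x s IH] t p w.
  by move: p; rewrite perm_sym => /perm_nilP ->.
have /mem_split[t1 [t2 et]] : x \in t by rewrite -(perm_mem p) mem_head.
apply: (@rt _ (w ++ x :: t1 ++ t2)); last by rewrite et; exact: bring.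
have := IH (t1 ++ t2) _ (rcons w x); rewrite !cat_rcons; apply.
by move: p; rewrite et -[x :: t2]cat1s perm_sym perm_catCA /= perm_cons perm_sym.
Qed.

(* A presentation [(B, W)] cuts strand [i] into the atoms [B i]. Atom [z] carries
   first the undercrossings listed by [W z], where [(x, s)] stands for a crossing
   of sign [s] below atom [x], and then all its overcrossings, in an order that
   is irrelevant by OC. An [lhead] is such an undercrossing with its label. *)
Definition lhead := (nat * (nat * bool))%type.
Definition hdp (h : lhead) : ep := (h.1, false, h.2.2).
Definition tlp (h : lhead) : ep := (h.1, true, h.2.2).
Definition tfil (x : nat) (L : seq lhead) : seq ep := [seq tlp h | h <- L & h.2.1 == x].

Lemma tfil_cat x L L' : tfil x (L ++ L') = tfil x L ++ tfil x L'.
Proof. by rewrite /tfil filter_cat map_cat. Qed.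

Lemma perm_tfil x L L' : perm_eq L L' -> perm_eq (tfil x L) (tfil x L').
Proof. by move=> p; apply/perm_map/perm_filter. Qed.

(** * Gauss diagrams realizing a presentation *)

Section Realize.
Variables (m n : nat).
Implicit Types (B : 'I_m -> seq nat) (W : nat -> seq (nat * bool)) (D : gd m)
  (om : nat -> seq lhead) (tau : nat -> seq ep).

Definition eqv D D' := @equiv_2n_sv m n D D'.
Lemma eqv_refl D : eqv D D. Proof. exact: rst_refl. Qed.
Lemma eqv_sym D D' : eqv D D' -> eqv D' D. Proof. exact: rst_sym. Qed.
Lemma eqv_trans D D' D'' : eqv D D' -> eqv D' D'' -> eqv D D''. Proof. exact: rst_trans. Qed.
Lemma eqv_step D D' : step_2n_sv n D D' -> eqv D D'. Proof. exact: rst_step. Qed.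

(** An atom is split into an even half for its undercrossings and an odd half for its overcrossings,
    so that a hole can be placed in either. *)
Definition dbl B : 'I_m -> seq nat := fun i => flatten [seq [:: z.*2; z.*2.+1] | z <- B i].
Definition sig om tau z : seq ep := if odd z then tau z./2 else map hdp (om z./2).
Definition realize B om tau : gd m := sub (dbl B) (sig om tau).
Definition allh B om : seq lhead := flatten [seq om z | z <- atoms B].

Lemma realizeE B om tau i : realize B om tau i = flatten [seq map hdp (om z) ++ tau z | z <- B i].
Proof.
rewrite /realize /sub /dbl map_flatten; elim: (B i) => //= z s IH.
by rewrite {1 2}/sig !oddS odd_double /= uphalf_double doubleK IH catA.
Qed.

Lemma atoms_dbl B : atoms (dbl B) = flatten [seq [:: z.*2; z.*2.+1] | z <- atoms B].
Proof.
rewrite /atoms /dbl; elim: (enum _) => //= i s ->.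
by rewrite map_cat flatten_cat.
Qed.

Lemma mem_dbl z (s : seq nat) : (z \in flatten [seq [:: z.*2; z.*2.+1] | z <- s]) = (z./2 \in s).
Proof.
elim: s => //= x s IH; rewrite !inE IH orbA; congr (_ || _).
rewrite -{1 2}(odd_double_half z); case: (odd z) => /=; rewrite ?add1n ?add0n ?eqSS.
  by rewrite (inj_eq double_inj) (_ : _ == x.*2 = false) //; apply/eqP => /(congr1 odd); rewrite /= !odd_double.
by rewrite (inj_eq double_inj) orbC (_ : _ == x.*2.+1 = false) //; apply/eqP => /(congr1 odd); rewrite /= !odd_double.
Qed.

Lemma mem_atoms_dbl B z : (z \in atoms (dbl B)) = (z./2 \in atoms B).
Proof. by rewrite atoms_dbl mem_dbl. Qed.

Lemma uniq_dbl B : uniq (atoms B) -> uniq (atoms (dbl B)).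
Proof.
rewrite atoms_dbl; elim: (atoms B) => //= x s IH /andP[xs /IH ->].
rewrite inE !mem_dbl /= ?uphalf_double ?doubleK (negbTE xs) andbT orbF.
by rewrite neq_ltn ltnSn.
Qed.

Definition good B W := uniq (atoms B) /\
  {in atoms B, forall z, all (fun h => h.1 \in atoms B) (W z)}.

(** [om] only adds labels to the undercrossings prescribed by [W]; these determine the overcrossings
    up to their order. *)
Definition rzl B W om tau :=
  [/\ {in atoms B, forall z, map snd (om z) = W z},
      uniq (map fst (allh B om)) &
      {in atoms B, forall x, perm_eq (tau x) (tfil x (allh B om))}].

Definition rz B W D := exists om tau, rzl B W om tau /\ D = realize B om tau.

Lemma allh_mem B om h : reflect (exists2 z, z \in atoms B & h \in om z) (h \in allh B om).
Proof.
apply: (iffP flattenP) => [[s /mapP[z zB ->] hs]|[z zB hz]]; first by exists z.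
by exists (om z) => //; apply: map_f.
Qed.

Lemma rzl_ref B W om tau h : good B W -> rzl B W om tau -> h \in allh B om -> h.2.1 \in atoms B.
Proof.
move=> [_ g] [e _ _] /allh_mem[z zB hz]; have /allP := g z zB; apply.
by rewrite -e //; apply: map_f.
Qed.

Lemma uniq_tfil x L : uniq (map fst L) -> uniq (tfil x L).
Proof.
move=> u; rewrite /tfil map_inj_in_uniq ?filter_uniq //; first exact: map_uniq u.
move=> h h'; rewrite !mem_filter => /andP[/eqP e1 hL] /andP[/eqP e2 hL'] [e3 e4].
by case: h h' e1 e2 e3 e4 {hL hL'} => [a [b c]] [a' [b' c']] /= -> -> -> ->.
Qed.

Lemma fst_inj_in (L : seq lhead) : uniq (map fst L) -> {in L &, injective (@fst nat (nat * bool))}.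
Proof.
elim: L => //= h L IH /andP[hL /IH {}IH] x y; rewrite !inE => /orP[/eqP ->|xL] /orP[/eqP ->|yL] //.
- by move=> e; case/negP: hL; rewrite e map_f.
- by move=> e; case/negP: hL; rewrite -e map_f.
- exact: IH.
Qed.

Lemma tau_over B W om tau x e : rzl B W om tau -> x \in atoms B -> e \in tau x ->
  exists2 h, h \in allh B om & e = tlp h /\ h.2.1 = x.
Proof.
move=> [_ _ p] xB; rewrite (perm_mem (p x xB)) => /mapP[h]; rewrite mem_filter => /andP[/eqP hx hL] ->.
by exists h.
Qed.

Lemma rzl_wf B W om tau : good B W -> rzl B W om tau -> wf (realize B om tau).
Proof.
move=> g r; have [u ga] := g; have [e1 e2 e3] := r.
have cE b l : cnt (realize B om tau) l b = \sum_(z <- atoms B) (count (isep l b) (map hdp (om z)) + count (isep l b) (tau z)).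
  rewrite sum_atoms; apply: eq_bigr => i _; rewrite realizeE count_flatten sumnE !big_map.
  by apply: eq_bigr => z _; rewrite count_cat.
have ch l z : count (isep l false) (map hdp (om z)) = count (fun h => h.1 == l) (om z).
  by rewrite count_map; apply: eq_count => h; rewrite /= /isep /= andbT.
have ch' l z : count (isep l true) (map hdp (om z)) = 0.
  by rewrite count_map (eq_count (a2 := pred0)) ?count_pred0 // => h; rewrite /= /isep andbF.
have ct l z : z \in atoms B -> count (isep l false) (tau z) = 0.
  move=> zB; apply/eqP; rewrite -leqn0 leqNgt -has_count; apply/hasPn => e /(tau_over r zB)[h _ [-> _]].
  by rewrite /isep andbF.
have ct' l z : z \in atoms B -> count (isep l true) (tau z) = count (fun h => (h.1 == l) && (h.2.1 == z)) (allh B om).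
  move=> zB; rewrite (permP (e3 z zB)) /tfil count_map count_filter; apply: eq_count => h.
  by rewrite /= /isep /= andbT.
have cF l : cnt (realize B om tau) l false = count (fun h => h.1 == l) (allh B om).
  rewrite cE /allh count_flatten sumnE !big_map; apply: eq_big_seq => z zB.
  by rewrite ch ct // addn0.
have cT l : cnt (realize B om tau) l true = count (fun h => h.1 == l) (allh B om).
  rewrite cE (eq_big_seq (fun z => count (fun h => (h.1 == l) && (h.2.1 == z)) (allh B om))); last first.
    by move=> z zB; rewrite ch' ct'.
  have refs := rzl_ref g r; elim: (allh B om) refs => [|h L IH] refs; first by rewrite big1.
  rewrite big_split /= IH => [|h' h'L]; last by apply: refs; rewrite inE h'L orbT.
  congr (_ + _); case: (h.1 == l) => /=; last by rewrite big1.
  rewrite (bigD1_seq h.2.1) //=; last by apply: refs; rewrite mem_head.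
  by rewrite eqxx big1 // => z nz; rewrite eq_sym (negbTE nz).
have cU l : count (fun h => h.1 == l) (allh B om) <= 1.
  by rewrite -(count_map fst (pred1 l)) count_uniq_mem // leq_b1.
split=> [l|i j e e']; first by rewrite cT cF.
have sgn k x : x \in realize B om tau k -> exists2 h, h \in allh B om & lab x = h.1 /\ sg x = h.2.2.
  rewrite realizeE => /flattenP[s /mapP[z zk ->]]; rewrite mem_cat => /orP[/mapP[h hz ->]|].
    by exists h => //; apply/allh_mem; exists z => //; apply: mem_atomsW zk.
  by move=> /(tau_over r (mem_atomsW zk))[h hL [-> _]]; exists h.
move=> /sgn[h hL [-> ->]] /sgn[h' hL' [-> ->]] ee.
by rewrite (fst_inj_in e2 hL hL' ee).
Qed.

Definition upd (A : Type) (W : nat -> A) (z : nat) (w : A) : nat -> A := fun v => if v == z then w else W v.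

Lemma sub_perm_eqv (C : 'I_m -> seq nat) s s' : uniq (atoms C) -> wf (sub C s) ->
  {in atoms C, forall z, s z = s' z \/ (all ov (s z) /\ perm_eq (s z) (s' z))} ->
  eqv (sub C s) (sub C s').
Proof.
move=> uC.
have sp t t' : {in atoms C, forall z, perm_eq (t z) (t' z)} -> wf (sub C t) -> wf (sub C t').
  move=> h; apply: wf_perm => i; rewrite /sub; have : {subset C i <= atoms C}.
    by move=> z; apply: mem_atomsW.
  elim: (C i) => //= z r IH sb; apply: perm_cat; first by apply/h/sb; rewrite mem_head.
  by apply: IH => x xr; apply: sb; rewrite inE xr orbT.
have one z t r : z \in atoms C -> all ov (t z) -> perm_eq (t z) r -> wf (sub C t) ->
    eqv (sub C t) (sub C (upd t z r)).
  move=> zC al pr wt.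
  have -> : sub C t = sub C (upd t z (t z)).
    by apply: funext => i; rewrite /sub; congr flatten; apply: eq_map => v; rewrite /upd; case: eqP => // ->.
  have : wf (sub C (upd t z (t z))).
    by apply: sp wt => v _; rewrite /upd; case: eqP => // ->.
  move=> wz; have [_ H] : perm_eq (t z) r /\ (all ov (t z) -> wf (sub C (upd t z (t z))) ->
     eqv (sub C (upd t z (t z))) (sub C (upd t z r))); last exact: H.
  apply: (perm_swap_ind (R := fun a b => perm_eq a b /\ (all ov a -> wf (sub C (upd t z a)) ->
     eqv (sub C (upd t z a)) (sub C (upd t z b)))) _ _ _ pr) => {r pr al wz}.
  - by move=> a; split=> // *; apply: eqv_refl.
  - move=> a b c [p1 hab] [p2 hbc]; split=> [|al wa]; first exact: perm_trans p1 p2.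
    apply: eqv_trans (hab al wa) _; apply: hbc; first by rewrite -(perm_all _ p1).
    by apply: sp wa => v _; rewrite /upd; case: eqP.
  - move=> u a b v; have p : perm_eq (u ++ a :: b :: v) (u ++ b :: a :: v).
      by rewrite perm_cat2l -cat1s -[b :: a :: v]cat1s -[a :: v]cat1s -[b :: v]cat1s perm_catCA.
    split=> // al wa; apply: eqv_step; left; right; right; right; left.
    have wb : wf (sub C (upd t z (u ++ b :: a :: v))).
      by apply: sp wa => x _; rewrite /upd; case: eqP.
    apply: (@sub_local_move m C [:: z] (fun _ => u) (fun _ => v) (fun _ => [:: a; b]) (fun _ => [:: b; a])) => //.
    + by move=> x; rewrite inE => /eqP ->.
    + by move=> x _; rewrite inE /upd => /negbTE ->.
    + by case=> // _; rewrite /upd eqxx.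
    + by case=> // _; rewrite /upd eqxx.
    + move: al; rewrite all_cat => /and4P[_ oa ob _].
      case: a b oa ob {p wa wb} => [[la ba] sa] [[lb bb] sb]; rewrite /ov /= => -> ->.
      by exists la, lb, sa, sb.
move=> ws h.
pose mix (zs : seq nat) z := if z \in zs then s' z else s z.
have -> : sub C s' = sub C (mix (atoms C)).
  apply: funext => i; rewrite /sub; congr flatten; apply/eq_in_map => z zC.
  by rewrite /mix (mem_atomsW zC).
suff H zs : {subset zs <= atoms C} -> eqv (sub C s) (sub C (mix zs)) by exact: H.
elim: zs => [_|z zs IH sb].
  by rewrite (_ : sub C (mix [::]) = sub C s); first exact: eqv_refl.
have {}IH : eqv (sub C s) (sub C (mix zs)).
  by apply: IH => x xz; apply: sb; rewrite inE xz orbT.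
have zC := sb z (mem_head _ _).
apply: eqv_trans IH _.
have -> : sub C (mix (z :: zs)) = sub C (upd (mix zs) z (s' z)).
  apply: funext => i; rewrite /sub; congr flatten; apply: eq_map => x.
  by rewrite /mix /upd inE; case: eqP => //= ->.
have pm x : x \in atoms C -> perm_eq (s x) (mix zs x).
  move=> xC; rewrite /mix; case: ifP => // _; by case: (h x xC) => [->|[]].
have wm : wf (sub C (mix zs)) by apply: sp ws => x /pm.
have same : mix zs z = s' z -> eqv (sub C (mix zs)) (sub C (upd (mix zs) z (s' z))).
  move=> e; rewrite (_ : sub C (upd _ _ _) = sub C (mix zs)); first exact: eqv_refl.
  by apply: funext => i; rewrite /sub; congr flatten; apply: eq_map => x; rewrite /upd; case: eqP => // ->.
have [zz|zz] := boolP (z \in zs); first by apply: same; rewrite /mix zz.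
case: (h z zC) => [e|[al pz]]; first by apply: same; rewrite /mix (negbTE zz).
by apply: one => //; rewrite /mix (negbTE zz).
Qed.

End Realize.

(** A relabelling has to be injective on all of [nat]: labels outside [L] are shifted by a bound of
    [L'] and so avoid it. *)
Lemma extend_inj (L L' : seq nat) : uniq L -> uniq L' -> size L = size L' ->
  exists g : nat -> nat, injective g /\ map g L = L'.
Proof.
move=> u u' sz; pose M := (\max_(x <- L') x).+1.
have ltM x : x \in L' -> x < M by move=> xL; rewrite ltnS leq_bigmax_seq.
exists (fun x => if x \in L then nth 0 L' (index x L) else x + M).
have nin x : x \in L -> nth 0 L' (index x L) \in L' by move=> xL; rewrite mem_nth // -sz index_mem.
split=> [x y|].
  have [xL|xL] := boolP (x \in L); have [yL|yL] := boolP (y \in L).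
  - move/eqP; rewrite nth_uniq -?sz ?index_mem // => /eqP e.
    by rewrite -(nth_index 0 xL) e nth_index.
  - by move=> e; have := ltM _ (nin _ xL); rewrite e; lia.
  - by move=> e; have := ltM _ (nin _ yL); rewrite -e; lia.
  - by move/eqP; rewrite eqn_add2r => /eqP.
apply: (@eq_from_nth _ 0); rewrite size_map // => k kL.
by rewrite (nth_map 0) // mem_nth // index_uniq.
Qed.

Section Realize2.
Variables (m n : nat).
Implicit Types (B : 'I_m -> seq nat) (W : nat -> seq (nat * bool)) (D : gd m)
  (om : nat -> seq lhead) (tau : nat -> seq ep).
Notation eqv := (@eqv m n).

Lemma map_allh (A : Type) (f : lhead -> A) B om :
  map f (allh B om) = flatten [seq map f (om z) | z <- atoms B].
Proof. by rewrite /allh; elim: (atoms B) => //= z s <-; rewrite map_cat. Qed.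

Lemma rz_wf B W D : good B W -> rz B W D -> wf D.
Proof. by move=> g [om [tau [r ->]]]; apply: rzl_wf r. Qed.

Lemma rz_exists B W : good B W -> exists D, rz B W D.
Proof.
move=> [u g].
pose om z := [seq (pickle (z, k), nth (0, true) (W z) k) | k <- iota 0 (size (W z))] : seq lhead.
exists (realize B om (fun x => tfil x (allh B om))), om, (fun x => tfil x (allh B om)).
split=> //; split=> // [z zB|].
  by rewrite /om -map_comp -[RHS](mkseq_nth (0, true)).
have -> : map fst (allh B om) =
    map pickle [seq (z, k) | z <- atoms B, k <- iota 0 (size (W z))].
  rewrite /allh; elim: (atoms B) => //= z s IH; rewrite !map_cat IH; congr (_ ++ _).
  by rewrite /om -!map_comp.
rewrite map_inj_uniq; last exact: pcan_inj pickleK.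
by apply: allpairs_uniq_dep => // [z _|[a b] [c d] _ _ /= [-> ->]] //; exact: iota_uniq.
Qed.

Lemma rzl_tau_eqv B W om tau tau' : good B W -> rzl B W om tau -> rzl B W om tau' ->
  eqv (realize B om tau) (realize B om tau').
Proof.
move=> g r r'; apply: sub_perm_eqv; first exact: uniq_dbl g.1.
  exact: rzl_wf r.
move=> z; rewrite mem_atoms_dbl /sig => zB; case: (odd z); last by left.
right; split.
  by apply/allP=> e /(tau_over r zB)[h _ [-> _]].
by case: r r' => _ _ p [_ _ p']; apply: perm_trans (p _ zB) _; rewrite perm_sym p'.
Qed.

(** The undercrossings of two realizations correspond in order, which defines a relabelling; what
    remains is the order of overcrossings within each atom. *)
Lemma rz_uniq B W D D' : good B W -> rz B W D -> rz B W D' -> eqv D D'.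
Proof.
move=> g [om [tau [r ->]]] [om' [tau' [r' ->]]].
have [e1 u1 p1] := r; have [e2 u2 p2] := r'.
have szz z : z \in atoms B -> size (om z) = size (om' z).
  by move=> zB; rewrite -(size_map snd) e1 // -e2 // size_map.
have shp : shape [seq om z | z <- atoms B] = shape [seq om' z | z <- atoms B].
  by rewrite /shape -!map_comp; apply/eq_in_map => z zB /=; apply: szz.
have szs : size (allh B om) = size (allh B om') by rewrite !size_flatten shp.
have szl : size (map fst (allh B om)) = size (map fst (allh B om')) by rewrite !size_map.
have [gg [ginj gL]] := extend_inj u1 u2 szl.
have snds : map snd (allh B om) = map snd (allh B om').
  by rewrite !map_allh; congr flatten; apply/eq_in_map => z zB; rewrite e1 ?e2.
pose rl (h : lhead) : lhead := (gg h.1, h.2).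
have alleq : allh B om' = map rl (allh B om).
  rewrite -[LHS](zip_unzip) -[RHS](zip_unzip) /unzip1 /unzip2 -!map_comp.
  by rewrite -gL snds -map_comp.
have omeq z : z \in atoms B -> om' z = map rl (om z).
  have : [seq om' z | z <- atoms B] = [seq map rl (om z) | z <- atoms B].
    apply: eq_from_flatten_shape; rewrite -?shp.
      by rewrite -/(allh B om') alleq map_allh.
    by rewrite /shape -!map_comp; apply: eq_map => y /=; rewrite size_map.
  by move/eq_in_map; apply.
pose rle (e : ep) : ep := (gg (lab e), ov e, sg e).
pose tau1 x := map rle (tau x).
have rel : realize B om' tau1 = fun i => map rle (realize B om tau i).
  apply: funext => i; rewrite !realizeE map_flatten -map_comp; congr flatten.
  apply/eq_in_map => z zB /=; rewrite (omeq z (mem_atomsW zB)) map_cat -!map_comp.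
  by congr (_ ++ _).
have r1 : rzl B W om' tau1.
  split=> // x xB; rewrite alleq /tau1; apply: perm_trans (perm_map _ (p1 x xB)) _.
  rewrite /tfil filter_map -!map_comp.
  by rewrite (eq_map (g := tlp \o rl)).
apply: eqv_trans (rzl_tau_eqv g r1 r'); apply: eqv_step; left; do 4!right.
split; first exact: rzl_wf r.
split; first exact: rzl_wf r1.
by exists gg; split=> // i; rewrite rel.
Qed.

(** One pair of equivalent realizations is required; by [rz_uniq] all pairs are then equivalent. *)
Definition Meq B W B' W' := [/\ good B W, good B' W' &
  exists D D', [/\ rz B W D, rz B' W' D' & eqv D D']].

Lemma Meq_refl B W : good B W -> Meq B W B W.
Proof. by move=> g; have [D r] := rz_exists g; split=> //; exists D, D; split=> //; apply: eqv_refl. Qed.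

Lemma Meq_sym B W B' W' : Meq B W B' W' -> Meq B' W' B W.
Proof. by case=> g g' [D [D' [r r' e]]]; split=> //; exists D', D; split=> //; apply: eqv_sym. Qed.

Lemma Meq_trans B W B' W' B'' W'' : Meq B W B' W' -> Meq B' W' B'' W'' -> Meq B W B'' W''.
Proof.
case=> g g' [D [D' [r r' e]]] [_ g'' [E [E' [q q' f]]]]; split=> //; exists D, E'; split=> //.
by apply: eqv_trans e _; apply: eqv_trans f; apply: rz_uniq r' q.
Qed.

Lemma Meq_eqv B W B' W' D D' : Meq B W B' W' -> rz B W D -> rz B' W' D' -> eqv D D'.
Proof.
case=> g g' [E [E' [r r' e]]] q q'.
by apply: eqv_trans (rz_uniq g q r) _; apply: eqv_trans e (rz_uniq g' r' q').
Qed.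

Lemma good_ext B W W' : {in atoms B, W =1 W'} -> good B W -> good B W'.
Proof. by move=> e [u g]; split=> // z zB; rewrite -e //; apply: g. Qed.

Lemma rz_ext B W W' D : {in atoms B, W =1 W'} -> rz B W D -> rz B W' D.
Proof.
move=> e [om [tau [[h1 h2 h3] ->]]]; exists om, tau; split=> //; split=> // z zB.
by rewrite h1 // e.
Qed.

Lemma Meq_ext B W W' : {in atoms B, W =1 W'} -> good B W -> Meq B W B W'.
Proof.
move=> e g; have [D r] := rz_exists g; split=> //; first exact: good_ext g.
by exists D, D; split=> //; [apply: rz_ext r | apply: eqv_refl].
Qed.

Lemma Meq_same B W B' W' : good B W -> good B' W' ->
  (exists D, rz B W D /\ rz B' W' D) -> Meq B W B' W'.
Proof. by move=> g g' [D [r r']]; split=> //; exists D, D; split=> //; apply: eqv_refl. Qed.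

Lemma upd_same (A : Type) (W : nat -> A) z w : upd W z w z = w.
Proof. by rewrite /upd eqxx. Qed.
Lemma upd_other (A : Type) (W : nat -> A) z w v : v != z -> upd W z w v = W v.
Proof. by rewrite /upd => /negbTE ->. Qed.
Lemma upd_upd (A : Type) (W : nat -> A) z w w' : upd (upd W z w) z w' = upd W z w'.
Proof. by apply: funext => v; rewrite /upd; case: eqP. Qed.
Lemma upd_id (A : Type) (W : nat -> A) z : upd W z (W z) = W.
Proof. by apply: funext => v; rewrite /upd; case: eqP => // ->. Qed.
Lemma updC (A : Type) (W : nat -> A) z w z' w' : z != z' ->
  upd (upd W z w) z' w' = upd (upd W z' w') z w.
Proof.
by move=> ne; apply: funext => v; rewrite /upd; case: eqP => // ->; rewrite eq_sym (negbTE ne).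
Qed.

Lemma allh_upd B om z s : uniq (atoms B) -> z \in atoms B ->
  perm_eq (allh B (upd om z s)) (s ++ allh B (upd om z [::])).
Proof.
rewrite /allh; elim: (atoms B) => //= x t IH /andP[xt ut]; rewrite inE => /orP[/eqP zx|zt].
  rewrite zx !upd_same /= perm_cat2l.
  rewrite (_ : [seq upd om x s z | z <- t] = [seq upd om x [::] z | z <- t]) //.
  by apply/eq_in_map => v vt; rewrite !upd_other //; apply: contraNneq xt => <-.
have ne : x != z by apply: contraNneq xt => ->.
rewrite !(upd_other _ _ ne) perm_sym perm_catCA perm_cat2l perm_sym; exact: IH.
Qed.

Lemma good_upd B W z w : good B W -> all (fun h => h.1 \in atoms B) w -> good B (upd W z w).
Proof. by move=> [u g] aw; split=> // v vB; rewrite /upd; case: eqP => // _; apply: g. Qed.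

End Realize2.

Definition lbl (M : nat) (w : seq (nat * bool)) : seq lhead := zip (iota M (size w)) w.

Lemma lbl_snd M w : map snd (lbl M w) = w.
Proof. by rewrite -[map snd _]/(unzip2 _) unzip2_zip // size_iota. Qed.

Lemma lbl_fst M w : map fst (lbl M w) = iota M (size w).
Proof. by rewrite -[map fst _]/(unzip1 _) unzip1_zip // size_iota. Qed.

(** * Moves on presentations *)

Section Moves.
Variables (m n : nat).
Implicit Types (B : 'I_m -> seq nat) (W : nat -> seq (nat * bool)) (D : gd m)
  (om : nat -> seq lhead) (tau : nat -> seq ep) (w : seq (nat * bool)).
Notation eqv := (@eqv m n).
Notation Meq := (@Meq m n).

Lemma rzl_intro B W om tau L : {in atoms B, forall z, map snd (om z) = W z} ->
  perm_eq (allh B om) L -> uniq (map fst L) ->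
  {in atoms B, forall x, perm_eq (tau x) (tfil x L)} -> rzl B W om tau.
Proof.
move=> h1 p u h2; split=> // [|x xB]; first by rewrite (perm_uniq (perm_map fst p)).
by apply: perm_trans (h2 x xB) _; apply: perm_tfil; rewrite perm_sym.
Qed.

Lemma sig_even om tau z : sig om tau z.*2 = map hdp (om z).
Proof. by rewrite /sig odd_double doubleK. Qed.
Lemma sig_odd om tau z : sig om tau z.*2.+1 = tau z.
Proof. by rewrite /sig /= odd_double /= uphalf_double. Qed.

Lemma ctx_realize B W z : good B (upd W z [::]) -> z \in atoms B ->
  exists om M, [/\ {in atoms B, forall v, v != z -> map snd (om v) = W v},
    all (fun l => l < M) (map fst (allh B (upd om z [::]))) &
    forall s tau, uniq (map fst s) -> all (fun l => M <= l) (map fst s) ->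
    {in atoms B, forall x, perm_eq (tau x) (tfil x (s ++ allh B (upd om z [::])))} ->
    rzl B (upd W z (map snd s)) (upd om z s) tau].
Proof.
move=> g zB; have [_ [om [tau0 [[h1 h2 h3] _]]]] := rz_exists g.
pose M := (\max_(x <- map fst (allh B (upd om z [::]))) x).+1.
have om0 : om z = [::].
  by have := h1 z zB; rewrite upd_same; case: (om z).
have eom : upd om z [::] = om by rewrite -om0 upd_id.
have ltM : all (fun l => l < M) (map fst (allh B (upd om z [::]))).
  by apply/allP=> l lL; rewrite ltnS leq_bigmax_seq.
exists om, M; split=> // [v vB vz|s tau us sM ht]; first by rewrite h1 // upd_other.
apply: (rzl_intro _ (allh_upd om s g.1 zB)) => //.
  by move=> v vB; rewrite /upd; case: eqP => // /eqP vz; rewrite h1 // upd_other.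
rewrite map_cat cat_uniq us /= {2}eom h2 andbT -all_predC.
apply/allP=> l /(allP ltM) lM; apply/negP => /(allP sM); rewrite leqNgt lM //.
Qed.

(** The common form of R2 and of self-crossing virtualization. The new overcrossings are put first
    on [x], which is legitimate because their order is free. *)
Lemma m_insert B W z x w1 w2 (ts : seq bool) (Hcond : hgd m -> Prop)
    (P : (nat -> seq ep) -> (nat -> seq ep) -> Prop) :
  good B (upd W z (w1 ++ w2)) -> z \in atoms B -> x \in atoms B ->
  (forall (H : hgd m), (forall i, x \in B i -> (inr 0 : ep + nat) \in H i) ->
     (forall i, z \in B i -> (inr 1 : ep + nat) \in H i) -> Hcond H) ->
  (forall D D', local_move 2 Hcond P D D' -> step_2n_sv n D D') ->
  (forall (h : seq lhead), map snd h = [seq (x, t) | t <- ts] ->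
     P (fun _ => [::]) (fun k => if k == 0 then map tlp h else map hdp h)) ->
  Meq B (upd W z (w1 ++ w2)) B (upd W z (w1 ++ [seq (x, t) | t <- ts] ++ w2)).
Proof.
move=> g zB xB hc hst hP.
set w := [seq (x, t) | t <- ts].
have al : all (fun h => h.1 \in atoms B) (w1 ++ w2).
  by have := g.2 z zB; rewrite upd_same.
have g' : good B (upd W z (w1 ++ w ++ w2)).
  rewrite -(upd_upd W z (w1 ++ w2)); apply: good_upd => //.
  move: al; rewrite !all_cat => /andP[-> ->]; rewrite andbT /=.
  by apply/allP=> h /mapP[t _ ->].
have g0 : good B (upd W z [::]) by rewrite -(upd_upd W z (w1 ++ w2)); apply: good_upd.
have [om [M [_ ltM ctx]]] := ctx_realize g0 zB.
set R := allh B _ in ltM ctx.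
pose s1 := lbl M w1; pose s2 := lbl (M + size w1) w2.
pose h := lbl (M + size w1 + size w2) w.
pose tau v := tfil v (s1 ++ s2 ++ R).
pose tau' v := (if v == x then map tlp h else [::]) ++ tau v.
have r : rzl B (upd W z (w1 ++ w2)) (upd om z (s1 ++ s2)) tau.
  have -> : w1 ++ w2 = map snd (s1 ++ s2) by rewrite map_cat !lbl_snd.
  apply: ctx.
  - by rewrite map_cat !lbl_fst -iotaD iota_uniq.
  - by rewrite map_cat !lbl_fst -iotaD; apply/allP=> l; rewrite mem_iota => /andP[].
  - by move=> v _; rewrite /tau -catA.
have hx v : tfil v h = if v == x then map tlp h else [::].
  have : all (fun h : lhead => h.2.1 == x) h.
    rewrite -(all_map snd (fun q => q.1 == x)) lbl_snd; apply/allP=> q /mapP[t _ ->] //=.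
  rewrite /tfil; case: (eqVneq v x) => [->|ne] ah; first by rewrite (all_filterP ah).
  rewrite (_ : filter _ _ = [::]) //; apply/eqP; rewrite -(negbK (_ == _)) -has_filter.
  apply/hasPn => q /(allP ah) /eqP ->; by rewrite eq_sym.
have r' : rzl B (upd W z (w1 ++ w ++ w2)) (upd om z (s1 ++ h ++ s2)) tau'.
  have -> : w1 ++ w ++ w2 = map snd (s1 ++ h ++ s2) by rewrite !map_cat !lbl_snd.
  have pm : perm_eq (map fst (s1 ++ h ++ s2)) (iota M (size w1 + (size w2 + size w))).
    rewrite !map_cat !lbl_fst !iotaD perm_cat2l perm_catC.
    by [].
  apply: ctx.
  - by rewrite (perm_uniq pm) iota_uniq.
  - by rewrite (perm_all _ pm); apply/allP=> l; rewrite mem_iota => /andP[].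
  - move=> v _; by rewrite /tau' -hx /tau !tfil_cat -!catA perm_catCA.
split=> //; exists (realize B (upd om z (s1 ++ s2)) tau), (realize B (upd om z (s1 ++ h ++ s2)) tau').
split; [by exists (upd om z (s1 ++ s2)), tau | by exists (upd om z (s1 ++ h ++ s2)), tau' |].
apply/eqv_step/hst.
apply: (@sub_local_move m (dbl B) [:: x.*2.+1; z.*2]
   (fun k => if k == 0 then [::] else map hdp s1)
   (fun k => if k == 0 then tau x else map hdp s2)
   (fun _ => [::]) (fun k => if k == 0 then map tlp h else map hdp h)).
- exact: uniq_dbl g.1.
- rewrite /= inE andbT; apply/eqP => /(congr1 odd); by rewrite /= !odd_double.
- by move=> v; rewrite !inE mem_atoms_dbl => /orP[] /eqP ->; rewrite /= ?uphalf_double ?doubleK.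
- move=> v _; rewrite !inE negb_or => /andP[n1 n2].
  rewrite -(odd_double_half v) in n1 n2 *; case: (odd v) n1 n2 => /=; rewrite ?add1n ?add0n => n1 n2.
    rewrite !sig_odd /tau'; case: eqP => // e; by rewrite e eqxx in n1.
  by rewrite !sig_even !upd_other //; apply: contraNneq n2 => ->.
- case=> [|[|//]] _ /=; first by rewrite sig_odd.
  by rewrite sig_even upd_same map_cat.
- case=> [|[|//]] _ /=; first by rewrite sig_odd /tau' eqxx.
  by rewrite sig_even upd_same !map_cat.
- move=> H hH; apply: hc => i hi; [apply: (hH 0 i) | apply: (hH 1 i)] => //=; rewrite mem_dbl /=.
    by rewrite uphalf_double.
  by rewrite doubleK.
- by apply: hP; rewrite lbl_snd.
- exact: rzl_wf r.
- exact: rzl_wf r'.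
Qed.

Lemma m_R2 B W z x t w1 w2 : good B (upd W z (w1 ++ w2)) -> z \in atoms B -> x \in atoms B ->
  Meq B (upd W z (w1 ++ w2)) B (upd W z (w1 ++ [:: (x, t); (x, ~~ t)] ++ w2)).
Proof.
move=> g zB xB; apply: (@m_insert _ _ _ _ _ _ [:: t; ~~ t] (@no_cond m) R2_pat) => //.
- by move=> D D' h; left; right; left.
- case=> [|[a [a1 a2]] [|[b [b1 b2]] [|//]]] //= [-> -> -> ->].
  split=> //; split=> //; exists a, b, t; split=> //; by left.
Qed.

Lemma m_sv B W z x t w1 w2 i : good B (upd W z (w1 ++ w2)) -> z \in B i -> x \in B i ->
  Meq B (upd W z (w1 ++ w2)) B (upd W z (w1 ++ [:: (x, t)] ++ w2)).
Proof.
move=> g zi xi; have zB := mem_atomsW zi; have xB := mem_atomsW xi.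
apply: (@m_insert _ _ _ _ _ _ [:: t] (@same_comp m) sv_pat) => //.
- by move=> H h0 h1; exists i; split; [apply: h0 | apply: h1].
- by move=> D D' h; right; left.
- case=> [|[a [a1 a2]] [|//]] //= [-> ->].
  by split=> //; split=> //; exists a, t.
Qed.

End Moves.

Lemma perm_pair (T : eqType) (x y : T) : perm_eq [:: x; y] [:: y; x].
Proof. by rewrite (perm_catC [:: x] [:: y]). Qed.

Section Moves2.
Variables (m n : nat).
Implicit Types (B : 'I_m -> seq nat) (W : nat -> seq (nat * bool)) (D : gd m)
  (om : nat -> seq lhead) (tau : nat -> seq ep) (w : seq (nat * bool)).
Notation eqv := (@eqv m n).
Notation Meq := (@Meq m n).

(** Unlike in [sig], the first half of an atom may contain overcrossings, as the middle strand of R3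
    requires. *)
Definition sg2 (Hd K : nat -> seq ep) z := if odd z then K z./2 else Hd z./2.

Lemma sub_sg2 B Hd K i : sub (dbl B) (sg2 Hd K) i = flatten [seq Hd z ++ K z | z <- B i].
Proof.
rewrite /sub /dbl map_flatten; elim: (B i) => //= z s IH.
by rewrite {1 2}/sg2 !oddS odd_double /= uphalf_double doubleK IH catA.
Qed.

Lemma sg2_even Hd K z : sg2 Hd K z.*2 = Hd z.
Proof. by rewrite /sg2 odd_double doubleK. Qed.
Lemma sg2_odd Hd K z : sg2 Hd K z.*2.+1 = K z.
Proof. by rewrite /sg2 /= odd_double /= uphalf_double. Qed.

(** Of two adjacent atoms the diagram sees only the concatenation, so content may cross the cut
    between them. *)
Lemma flatten_slide B j pre post x y (F F' : nat -> seq ep) : uniq (atoms B) ->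
  B j = pre ++ x :: y :: post -> (forall v, v != x -> v != y -> F v = F' v) ->
  F x ++ F y = F' x ++ F' y ->
  forall i, flatten [seq F z | z <- B i] = flatten [seq F' z | z <- B i].
Proof.
move=> u hj hF hxy i; have uj := atoms_uniq_strand j u.
have [-> | ne] := eqVneq i j; last first.
  congr flatten; apply/eq_in_map => v vi; apply: hF; apply: contraNneq ne => ev.
    by apply/eqP/(atoms_strand_eq u vi); rewrite ev hj mem_cat mem_head orbT.
  by apply/eqP/(atoms_strand_eq u vi); rewrite ev hj mem_cat !inE eqxx !orbT.
move: uj; rewrite hj cat_uniq /= !negb_or ?inE ?negb_or.
move=> /and5P[_ /and3P[xp yp hp] /andP[xy xq] yq _].
have hp' v : v \in pre -> F v = F' v.
  by move=> vp; apply: hF; [apply: contraNneq xp | apply: contraNneq yp] => <-.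
have hq' v : v \in post -> F v = F' v.
  by move=> vp; apply: hF; [apply: contraNneq xq | apply: contraNneq yq] => <-.
rewrite !map_cat !flatten_cat /= [F x ++ _]catA hxy -catA.
have -> : map F pre = map F' pre by apply/eq_in_map.
by have -> : map F post = map F' post by apply/eq_in_map.
Qed.

Lemma good_upd_refs B W z w : good B (upd W z w) -> z \in atoms B -> all (fun h => h.1 \in atoms B) w.
Proof. by move=> g /(g.2 z); rewrite upd_same. Qed.

Lemma good_upd2 B W z w w' : good B (upd W z w) -> all (fun h => h.1 \in atoms B) w' -> good B (upd W z w').
Proof. by move=> g a; rewrite -(upd_upd W z w); apply: good_upd. Qed.

Lemma adj_mem B j pre post (x y : nat) : B j = pre ++ x :: y :: post -> x \in B j /\ y \in B j.
Proof. by move=> ->; rewrite !mem_cat !inE !eqxx !orbT. Qed.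

Lemma adj_neq B j pre post (x y : nat) : uniq (atoms B) -> B j = pre ++ x :: y :: post -> x != y.
Proof.
move=> /(atoms_uniq_strand j) + hj; rewrite hj cat_uniq /= ?inE ?negb_or.
by case/and5P=> _ _ /andP[].
Qed.

(** As [y] has no undercrossing, an overcrossing at its beginning is also one at the end of [x]: the
    two presentations share a realization. *)
Lemma m_slide B W z x y t w1 w2 j pre post :
  good B (upd W z (w1 ++ (y, t) :: w2)) -> B j = pre ++ x :: y :: post ->
  W y = [::] -> z \in atoms B -> z != y ->
  Meq B (upd W z (w1 ++ (y, t) :: w2)) B (upd W z (w1 ++ (x, t) :: w2)).
Proof.
move=> g hj Wy zB zy; have [xj yj] := adj_mem hj; have xB := mem_atomsW xj; have yB := mem_atomsW yj.
have xy := adj_neq g.1 hj.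
have al := good_upd_refs g zB.
have g' : good B (upd W z (w1 ++ (x, t) :: w2)).
  by apply: good_upd2 g _; move: al; rewrite !all_cat /= xB yB.
have g0 : good B (upd W z [::]) by apply: good_upd2 g _.
have [om [M [hom ltM ctx]]] := ctx_realize g0 zB.
set R := allh B _ in ltM ctx.
pose s1 := lbl M w1; pose s2 := lbl (M + size w1) w2; pose a := M + size w1 + size w2.
pose rho v := tfil v (s1 ++ s2 ++ R).
pose tau v := (if v == y then [:: (a, true, t)] else [::]) ++ rho v.
pose tau' v := rho v ++ (if v == x then [:: (a, true, t)] else [::]).
have lab_ok r : uniq (map fst (s1 ++ (a, (r, t)) :: s2)) && all (fun l => M <= l) (map fst (s1 ++ (a, (r, t)) :: s2)).
  have pm : perm_eq (map fst (s1 ++ (a, (r, t)) :: s2)) (iota M (size w1 + size w2 + 1)).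
    rewrite map_cat /= !lbl_fst !iotaD -!catA perm_cat2l -cat1s perm_catC.
    by rewrite /a addnA.
  rewrite (perm_uniq pm) iota_uniq (perm_all _ pm); apply/allP=> l; by rewrite mem_iota => /andP[].
have snd_ok r : map snd (s1 ++ (a, (r, t)) :: s2) = w1 ++ (r, t) :: w2.
  by rewrite map_cat /= !lbl_snd.
have pt r v : perm_eq (tfil v ((s1 ++ (a, (r, t)) :: s2) ++ R)) ((if v == r then [:: (a, true, t)] else [::]) ++ rho v).
  rewrite /rho -catA /= -cat1s !tfil_cat perm_catCA perm_cat2r.
  by rewrite /tfil /= [r == v]eq_sym; case: eqP.
have r1 : rzl B (upd W z (w1 ++ (y, t) :: w2)) (upd om z (s1 ++ (a, (y, t)) :: s2)) tau.
  rewrite -(snd_ok y); have /andP[u1 u2] := lab_ok y; apply: ctx => // v _.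
  by rewrite perm_sym; apply: pt.
have r2 : rzl B (upd W z (w1 ++ (x, t) :: w2)) (upd om z (s1 ++ (a, (x, t)) :: s2)) tau'.
  rewrite -(snd_ok x); have /andP[u1 u2] := lab_ok x; apply: ctx => // v _.
  by rewrite perm_sym; apply: perm_trans (pt x v) _; rewrite perm_catC.
apply: Meq_same => //; eexists; split; first by exists (upd om z (s1 ++ (a, (y, t)) :: s2)), tau.
exists (upd om z (s1 ++ (a, (x, t)) :: s2)), tau'; split=> //.
have omy : om y = [::].
  by have := hom y yB; rewrite eq_sym zy Wy => /(_ isT); case: (om y).
apply: funext => i; rewrite !realizeE; apply: (flatten_slide g.1 hj).
  move=> v vx vy; rewrite /tau /tau' (negbTE vx) (negbTE vy) cats0; congr (_ ++ _).
  by rewrite /upd; case: eqP => // _; rewrite !map_cat.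
rewrite /tau /tau' !eqxx (negbTE xy) eq_sym (negbTE xy) cats0 /=.
rewrite ![upd _ _ _ y]upd_other 1?eq_sym // omy /= -!catA; congr (_ ++ _).
by rewrite /upd; case: eqP => // _; rewrite !map_cat.
Qed.

(** The Wirtinger relation for one letter in the form [u y = x u]: strand [z] slides below the
    crossing at which [u] separates the arcs [x] and [y]. *)
Lemma m_R3 B W z x y u e t w1 w2 j pre post :
  good B (upd W z (w1 ++ [:: (u, e); (y, t)] ++ w2)) -> B j = pre ++ x :: y :: post ->
  W y = [:: (u, e)] -> z \in atoms B -> z != y ->
  Meq B (upd W z (w1 ++ [:: (u, e); (y, t)] ++ w2)) B (upd W z (w1 ++ [:: (x, t); (u, e)] ++ w2)).
Proof.
move=> g hj Wy zB zy; have [xj yj] := adj_mem hj; have xB := mem_atomsW xj; have yB := mem_atomsW yj.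
have xy := adj_neq g.1 hj.
have al := good_upd_refs g zB.
have uB : u \in atoms B by move: al; rewrite all_cat => /and3P[].
have g' : good B (upd W z (w1 ++ [:: (x, t); (u, e)] ++ w2)).
  by apply: good_upd2 g _; move: al; rewrite !all_cat /= xB yB uB.
have g0 : good B (upd W z [::]) by apply: good_upd2 g _.
have [om [M [hom ltM ctx]]] := ctx_realize g0 zB.
have [c omy] : exists c, om y = [:: (c, (u, e))].
  have := hom y yB; rewrite eq_sym zy Wy => /(_ isT); case: (om y) => [|[c q] [|//]] //= [->].
  by exists c.
set R := allh B _ in ltM ctx.
pose R' := allh B (upd (upd om z [::]) y [::]).
have pR : perm_eq R ((c, (u, e)) :: R').
  have := allh_upd (upd om z [::]) [:: (c, (u, e))] g.1 yB.
  by rewrite -omy -[om y in X in perm_eq X](@upd_other _ om z [::]) 1?eq_sym // upd_id omy.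
pose s1 := lbl M w1; pose s2 := lbl (M + size w1) w2.
pose b := M + size w1 + size w2; pose a := b.+1.
pose s := s1 ++ [:: (b, (u, e)); (a, (y, t))] ++ s2.
pose s' := s1 ++ [:: (a, (x, t)); (b, (u, e))] ++ s2.
(* The order of the two crossings on the top strand is free by OC; [X] selects the one that meets
   the sign condition of R3. *)
pose X := (e == t).
pose rho v := tfil v (s1 ++ s2 ++ R').
pose K (Y : bool) v := (if v == u then ord2 Y (c, true, e) (b, true, e) else [::]) ++ rho v.
pose tau v := (if v == y then [:: (a, true, t)] else [::]) ++ K X v.
pose tau' v := K (~~ X) v ++ (if v == x then [:: (a, true, t)] else [::]).
have labs (q : seq lhead) : perm_eq (map fst q) [:: b; a] ->
    uniq (map fst (s1 ++ q ++ s2)) && all (fun l => M <= l) (map fst (s1 ++ q ++ s2)).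
  move=> pq; have pm : perm_eq (map fst (s1 ++ q ++ s2)) (iota M (size w1 + size w2 + 2)).
    rewrite !map_cat !lbl_fst !iotaD -!catA perm_cat2l perm_catC perm_cat2l addnA.
    exact: pq.
  rewrite (perm_uniq pm) iota_uniq (perm_all _ pm); apply/allP=> l; by rewrite mem_iota => /andP[].
have pK Y v : perm_eq (K Y v) (tfil v [:: (c, (u, e)); (b, (u, e))] ++ rho v).
  rewrite /K perm_cat2r /tfil /= [u == v]eq_sym; case: eqP => // _; case: Y => //.
  exact: perm_pair.
have pt (q : seq lhead) v : perm_eq (tfil v ((s1 ++ q ++ s2) ++ R)) (tfil v (q ++ [:: (c, (u, e))]) ++ rho v).
  apply: (@perm_trans _ (tfil v ((s1 ++ q ++ s2) ++ (c, (u, e)) :: R'))).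
    by apply: perm_tfil; rewrite perm_cat2l.
  rewrite /rho -tfil_cat; apply: perm_tfil; rewrite -[(c, _) :: R']cat1s -!catA perm_catCA perm_cat2l.
  by rewrite perm_sym perm_catCA perm_cat2l perm_catCA.
have r1 : rzl B (upd W z (w1 ++ [:: (u, e); (y, t)] ++ w2)) (upd om z s) tau.
  have -> : w1 ++ [:: (u, e); (y, t)] ++ w2 = map snd s by rewrite /s !map_cat !lbl_snd.
  have /andP[u1 u2] := labs [:: (b, (u, e)); (a, (y, t))] (perm_refl _).
  apply: ctx => // v _; rewrite perm_sym; apply: perm_trans (pt _ v) _; rewrite perm_sym /tau.
  apply: perm_trans (perm_cat (perm_refl _) (pK X v)) _; rewrite catA perm_cat2r.
  have -> : (if v == y then [:: (a, true, t)] else [::]) = tfil v [:: (a, (y, t))].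
    by rewrite /tfil /= [y == v]eq_sym; case: eqP.
  rewrite -tfil_cat; apply: perm_tfil.
  by rewrite (perm_catC [:: (a, (y, t)); (c, (u, e))] [:: (b, (u, e))]).
have r2 : rzl B (upd W z (w1 ++ [:: (x, t); (u, e)] ++ w2)) (upd om z s') tau'.
  have -> : w1 ++ [:: (x, t); (u, e)] ++ w2 = map snd s' by rewrite /s' !map_cat !lbl_snd.
  have /andP[u1 u2] := labs [:: (a, (x, t)); (b, (u, e))] (perm_pair a b).
  apply: ctx => // v _; rewrite perm_sym; apply: perm_trans (pt _ v) _; rewrite perm_sym /tau'.
  apply: perm_trans (perm_cat (pK (~~ X) v) (perm_refl _)) _; rewrite perm_catC catA perm_cat2r.
  have -> : (if v == x then [:: (a, true, t)] else [::]) = tfil v [:: (a, (x, t))].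
    by rewrite /tfil /= [x == v]eq_sym; case: eqP.
  rewrite -tfil_cat; apply: perm_tfil; rewrite perm_cons; exact: perm_pair.
(* The overcrossing [a] joins the undercrossing [c] of [y], and together they fill the hole of the
   middle strand. After the move [a] ends the atom [x], which places it directly before [c]. *)
pose Hd v := if v == y then [:: (c, false, e); (a, true, t)] else map hdp (upd om z s v).
pose Hd' v := if v == y then [:: (a, true, t); (c, false, e)] else map hdp (upd om z s' v).
have omy' q : upd om z q y = [:: (c, (u, e))] by rewrite upd_other 1?eq_sym.
have e1 : realize B (upd om z s) tau = sub (dbl B) (sg2 Hd (K X)).
  apply: funext => i; rewrite realizeE sub_sg2; congr flatten; apply: eq_map => v.
  by rewrite /tau /Hd; case: eqP => // ->; rewrite omy'.
have e2 : realize B (upd om z s') tau' = sub (dbl B) (sg2 Hd' (K (~~ X))).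
  apply: funext => i; rewrite realizeE sub_sg2; apply: (flatten_slide g.1 hj).
    by move=> v vx vy; rewrite /tau' /Hd' (negbTE vx) (negbTE vy) cats0.
  by rewrite /tau' /Hd' !eqxx (negbTE xy) eq_sym (negbTE xy) cats0 omy' -!catA.
split=> //; exists (realize B (upd om z s) tau), (realize B (upd om z s') tau'); split.
- by exists (upd om z s), tau.
- by exists (upd om z s'), tau'.
apply/eqv_step; left; right; right; left; have := rzl_wf g r1; have := rzl_wf g' r2.
rewrite e1 e2 => wf2 wf1.
apply: (@sub_local_move m (dbl B) [:: u.*2.+1; y.*2; z.*2]
   (fun k => if k == 2 then map hdp s1 else [::])
   (fun k => if k == 0 then rho u else if k == 1 then [::] else map hdp s2)
   (fun k => if k == 0 then ord2 X (c, true, e) (b, true, e) else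
             if k == 1 then [:: (c, false, e); (a, true, t)] else [:: (b, false, e); (a, false, t)])
   (fun k => if k == 0 then ord2 (~~ X) (c, true, e) (b, true, e) else
             if k == 1 then [:: (a, true, t); (c, false, e)] else [:: (a, false, t); (b, false, e)])) => //.
- exact: uniq_dbl g.1.
- have od p q : p.*2.+1 == q.*2 = false by apply/eqP => /(congr1 odd); rewrite /= !odd_double.
  by rewrite /= !inE !od /= (inj_eq double_inj) eq_sym zy.
- by move=> v; rewrite !inE mem_atoms_dbl => /or3P[] /eqP ->; rewrite /= ?uphalf_double ?doubleK.
- move=> v _; rewrite !inE !negb_or => /and3P[n1 n2 n3].
  rewrite -(odd_double_half v) in n1 n2 n3 *; case: (odd v) n1 n2 n3 => /=; rewrite ?add1n ?add0n => n1 n2 n3.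
    rewrite !sg2_odd /K; case: eqP => // ev; by rewrite ev eqxx in n1.
  rewrite !sg2_even /Hd /Hd'; case: eqP => [ev|_]; first by rewrite ev eqxx in n2.
  by rewrite !upd_other //; apply: contraNneq n3 => ->.
- case=> [|[|[|//]]] _ /=; rewrite ?sg2_odd ?sg2_even /K /Hd ?eqxx // ?cats0 //.
  by rewrite (negbTE zy) upd_same /s !map_cat.
- case=> [|[|[|//]]] _ /=; rewrite ?sg2_odd ?sg2_even /K /Hd' ?eqxx // ?cats0 //.
  by rewrite (negbTE zy) upd_same /s' !map_cat.
- exists c, b, a, e, e, t, X, true, true; split=> //.
  + by rewrite /X; case: (e); case: (t).
  + by rewrite !eqxx.
Qed.

End Moves2.

Section Moves3.
Variables (m n : nat).
Implicit Types (B : 'I_m -> seq nat) (W : nat -> seq (nat * bool)) (D : gd m)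
  (om : nat -> seq lhead) (tau : nat -> seq ep) (w : seq (nat * bool)).
Notation eqv := (@eqv m n).
Notation Meq := (@Meq m n).

Definition ins B (j : 'I_m) (pre : seq nat) (y : nat) (post : seq nat) : 'I_m -> seq nat :=
  fun i => if i == j then pre ++ y :: post else B i.

Lemma atoms_ins B j pre y post : B j = pre ++ post ->
  perm_eq (atoms (ins B j pre y post)) (y :: atoms B).
Proof.
move=> hj; apply/permP => P.
have cA C : count P (atoms C) = \sum_(i < m) count P (C i).
  rewrite -sum1_count /atoms big_flatten big_map big_enum /=.
  by apply: eq_bigr => i _; rewrite sum1_count.
rewrite /= !cA (bigD1 j) //= [in RHS](bigD1 j) //= /ins eqxx hj !count_cat /=.
rewrite addnCA -!addnA; congr (_ + (_ + (_ + _))).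
by apply: eq_bigr => i /negbTE ->.
Qed.

Lemma m_ins B W j pre y post : good B W -> B j = pre ++ post -> y \notin atoms B ->
  Meq B W (ins B j pre y post) (upd W y [::]).
Proof.
move=> g hj yB; have pa := atoms_ins y hj.
have g' : good (ins B j pre y post) (upd W y [::]).
  split=> [|z]; first by rewrite (perm_uniq pa) /= yB g.1.
  rewrite (perm_mem pa) inE /upd; case: eqP => //= _ zB.
  apply/allP=> h hz; rewrite (perm_mem pa) inE; apply/orP; right.
  by have /allP := g.2 z zB; apply.
have [_ [om [tau [[h1 h2 h3] _]]]] := rz_exists g.
apply: Meq_same => //; exists (realize B om tau); split; first by exists om, tau.
have pl : perm_eq (allh (ins B j pre y post) (upd om y [::])) (allh B om).
  apply: perm_trans (perm_flatten (perm_map _ pa)) _; rewrite /= upd_same /=.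
  rewrite (_ : map _ _ = [seq om z | z <- atoms B]) //.
  by apply/eq_in_map => z zB; rewrite upd_other //; apply: contraNneq yB => <-.
exists (upd om y [::]), (upd tau y [::]); split.
  apply: (rzl_intro _ pl h2) => z; rewrite (perm_mem pa) inE /upd.
    by case: eqP => //= _ zB; apply: h1.
  case: eqP => /= [-> _|_ zB]; last exact: h3.
  rewrite (_ : tfil _ _ = [::]) //; apply/eqP; rewrite -size_eq0 size_map size_filter -leqn0 leqNgt -has_count.
    apply/hasPn => h hL; apply: contraNneq yB => <-.
    by apply: (rzl_ref g (tau := tau) _ hL).
apply: funext => i; rewrite !realizeE /ins.
have F s : y \notin s -> [seq [seq hdp i | i <- om z] ++ tau z | z <- s] =
    [seq [seq hdp i | i <- upd om y [::] z] ++ upd tau y [::] z | z <- s].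
  move=> ys; apply/eq_in_map => z zs.
  have zy : z != y by apply: contraNneq ys => <-.
  by rewrite !upd_other.
have [-> | ne] := eqVneq i j; last by rewrite F //; apply: contra yB; apply: mem_atomsW.
have : y \notin B j by apply: contra yB; apply: mem_atomsW.
rewrite hj mem_cat negb_or => /andP[yp yq].
by rewrite !map_cat !flatten_cat /= !upd_same /= !F.
Qed.

Definition unref B W (x : nat) := {in atoms B, forall z, all (fun h => h.1 != x) (W z)}.

(** Nothing refers to [x], so it carries no overcrossing; its last undercrossings are adjacent to
    those of [y], and the cut can move across them. *)
Lemma m_shift B W j pre post x y p q r : B j = pre ++ x :: y :: post ->
  good B (upd (upd W x (p ++ q)) y r) -> unref B (upd (upd W x (p ++ q)) y r) x ->
  Meq B (upd (upd W x (p ++ q)) y r) B (upd (upd W x p) y (q ++ r)).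
Proof.
move=> hj g ur; have [xj yj] := adj_mem hj; have xB := mem_atomsW xj; have yB := mem_atomsW yj.
have xy := adj_neq g.1 hj.
have [_ [om [tau [r1 _]]]] := rz_exists g; have [h1 h2 h3] := r1.
have ax : all (fun h => h.1 \in atoms B) (p ++ q).
  by have := g.2 x xB; rewrite upd_other // upd_same.
have ay : all (fun h => h.1 \in atoms B) r by have := g.2 y yB; rewrite upd_same.
have g' : good B (upd (upd W x p) y (q ++ r)).
  move: ax; rewrite all_cat => /andP[ap aq].
  split=> [|v vB]; first exact: g.1.
  have := g.2 v vB; rewrite /upd; case: eqP => // _; first by rewrite all_cat aq ay.
  by case: eqP.
have [ox1 [ox2 [omx o1 o2]]] : exists ox1 ox2, [/\ om x = ox1 ++ ox2, map snd ox1 = p & map snd ox2 = q].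
  have := h1 x xB; rewrite upd_other // upd_same => e.
  exists (take (size p) (om x)), (drop (size p) (om x)); rewrite cat_take_drop map_take map_drop e.
  by rewrite take_size_cat // drop_size_cat.
pose om' := upd (upd om x ox1) y (ox2 ++ om y).
have pall : perm_eq (allh B om') (allh B om).
  pose om0 := upd (upd om x [::]) y [::].
  have gen a b : perm_eq (allh B (upd (upd om x a) y b)) (b ++ a ++ allh B om0).
    apply: perm_trans (allh_upd _ _ g.1 yB) _; rewrite perm_cat2l updC //.
    apply: perm_trans (allh_upd _ _ g.1 xB) _; rewrite perm_cat2l /om0.
    by rewrite [upd (upd om x _) _ _]updC.
  have omE : upd (upd om x (ox1 ++ ox2)) y (om y) = om by rewrite -omx upd_id upd_id.
  have pom := gen (ox1 ++ ox2) (om y); rewrite omE in pom.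
  apply: perm_trans (gen _ _) _; rewrite perm_sym; apply: perm_trans pom _.
  rewrite -!catA; apply/permP => P; rewrite !count_cat; lia.
have tx : tau x = [::].
  apply/perm_nilP; apply: perm_trans (h3 x xB) _.
  rewrite (_ : tfil _ _ = [::]) //; apply/eqP; rewrite -size_eq0 size_map size_filter -leqn0 leqNgt -has_count.
  apply/hasPn => h /allh_mem[z zB hz]; have /allP := ur z zB; apply.
  by rewrite -h1 //; apply: map_f.
apply: Meq_same => //; exists (realize B om tau); split; first by exists om, tau.
exists om', tau; split.
  apply: (rzl_intro _ pall h2 h3) => v vB; rewrite /om' /upd; case: eqP => [_|vy].
    by rewrite map_cat o2 h1 // upd_same.
  case: eqP => // vx; rewrite h1 // /upd; do 2!case: eqP => //.
apply: funext => i; rewrite !realizeE; apply: (flatten_slide g.1 hj) => [v vx vy|].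
  by rewrite /om' !upd_other.
rewrite /om' upd_same upd_other // upd_same omx tx !map_cat /= !cats0 !catA.
by [].
Qed.

Definition fresh B := (\max_(z <- atoms B) z).+1.
Lemma fresh_notin B : fresh B \notin atoms B.
Proof.
apply/negP => h; suff : fresh B <= \max_(z <- atoms B) z by rewrite ltnn.
exact: (@leq_bigmax_seq _ _ xpredT id).
Qed.

Lemma Meq_funext B W B' W' W1 W1' : Meq B W B' W' -> W =1 W1 -> W' =1 W1' -> Meq B W1 B' W1'.
Proof. by move=> h /funext <- /funext <-. Qed.

(* A single undercrossing [y] is passed by a reference: R2 followed by R3. *)
Lemma m_pass1 B W z x y u e t w1 w2 j pre post :
  good B (upd W z (w1 ++ (y, t) :: w2)) -> u \in atoms B -> B j = pre ++ x :: y :: post ->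
  W y = [:: (u, e)] -> z \in atoms B -> z != y ->
  Meq B (upd W z (w1 ++ (y, t) :: w2)) B (upd W z (w1 ++ [:: (u, ~~ e); (x, t); (u, e)] ++ w2)).
Proof.
move=> g uB hj Wy zB zy.
apply: Meq_trans (m_R2 n (~~ e) g zB uB) _; rewrite negbK.
have := @m_R3 m n B W z x y u e t (rcons w1 (u, ~~ e)) w2 j pre post.
rewrite !cat_rcons /=; apply=> //.
by apply: (good_upd2 g); have := good_upd_refs g zB; rewrite !all_cat /= uB.
Qed.

Lemma good_word B W z : good B W -> z \in atoms B -> forall h, h \in W z -> h.1 \in atoms B.
Proof. by move=> g zB h hz; have /allP := g.2 z zB; apply. Qed.

(** A fresh atom [y1] in front of [y] takes over the first letter of the word. The reference then
    passes the rest of the word by induction, and [y1] by [m_pass1]. *)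
Lemma m_pass V B W z x y t w1 w2 j pre post :
  good B (upd W z (w1 ++ (y, t) :: w2)) -> B j = pre ++ x :: y :: post ->
  W y = V -> z \in atoms B -> z != y ->
  Meq B (upd W z (w1 ++ (y, t) :: w2)) B (upd W z (w1 ++ ginv V ++ (x, t) :: V ++ w2)).
Proof.
elim: V B W w1 w2 j pre post x => [|[u e] V IH] B W w1 w2 j pre post x g hj Wy zB zy.
  exact: m_slide hj Wy zB zy.
have [xj yj] := adj_mem hj; have xB := mem_atomsW xj; have yB := mem_atomsW yj.
pose y1 := fresh B; have y1B : y1 \notin atoms B := fresh_notin B.
have hj' : B j = rcons pre x ++ y :: post by rewrite cat_rcons.
pose B1 := ins B j (rcons pre x) y1 (y :: post).
have pa : perm_eq (atoms B1) (y1 :: atoms B) := atoms_ins y1 hj'.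
have h1 : B1 j = pre ++ x :: y1 :: y :: post by rewrite /B1 /ins eqxx cat_rcons.
have h2 : B1 j = rcons pre x ++ y1 :: y :: post by rewrite cat_rcons.
have sB1 v : v \in atoms B -> v \in atoms B1 by move=> vB; rewrite (perm_mem pa) inE vB orbT.
have zy1 : z != y1 by apply: contraNneq y1B => <-.
have yy1 : y != y1 by apply: contraNneq y1B => <-.
have gW v : v \in atoms B -> v != z -> forall h, h \in W v -> h.1 \in atoms B.
  by move=> vB vz h hv; apply: (good_word g vB); rewrite upd_other.
have uB : u \in atoms B.
  by apply: (gW y yB _ (u, e)); rewrite 1?eq_sym // Wy mem_head.
have VB : all (fun h => h.1 \in atoms B) V.
  by apply/allP=> h hV; apply: (gW y yB); rewrite 1?eq_sym // Wy inE hV orbT.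
have /= := good_upd_refs g zB; rewrite all_cat => /andP[a1 /= /andP[_ a2]].
pose st w (p q : seq (nat * bool)) := upd (upd (upd W z w) y1 p) y q.
have gst w p q : all (fun h => h.1 \in atoms B1) w -> all (fun h => h.1 \in atoms B1) p ->
    all (fun h => h.1 \in atoms B1) q -> good B1 (st w p q).
  move=> aw ap aq; split=> [|v]; first by rewrite (perm_uniq pa) /= y1B g.1.
  rewrite /st /upd; case: eqP => // _; case: eqP => // /eqP vy1; case: eqP => // /eqP vz.
  rewrite (perm_mem pa) inE (negbTE vy1) /= => vB; apply/allP=> h hv; apply: sB1.
  exact: gW hv.
have aB1 w : all (fun h => h.1 \in atoms B) w -> all (fun h => h.1 \in atoms B1) w.
  by apply: sub_all => h; apply: sB1.
have stin w : all (fun h => h.1 \in atoms B) w ->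
    Meq B (upd W z w) B1 (st w [::] ((u, e) :: V)).
  move=> aw; have gw : good B (upd W z w) by exact: (good_upd2 g aw).
  apply: Meq_funext (m_ins gw hj' y1B) _ _ => // v.
  rewrite /st /upd; case: (v =P y) => [->|//]; rewrite (negbTE yy1).
  by rewrite eq_sym (negbTE zy).
have stsh w : all (fun h => h.1 \in atoms B) w ->
    Meq B1 (st w [:: (u, e)] V) B1 (st w [::] ((u, e) :: V)).
  move=> aw; apply: (@m_shift B1 (upd W z w) j (rcons pre x) post y1 y [::] [:: (u, e)] V h2).
    by apply: gst; [exact: aB1 | rewrite /= sB1 | exact: aB1].
  have nr w' : all (fun h => h.1 \in atoms B) w' -> all (fun h => h.1 != y1) w'.
    by apply: sub_all => h hB; apply: contraNneq y1B => <-.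
  move=> v vB1; rewrite /upd; case: eqP => _; first exact: nr.
  case: eqP => [_|/eqP vy1]; first by apply: nr; rewrite /= uB.
  case: eqP => [_|/eqP vz]; first exact: nr.
  apply: nr; apply/allP=> h; apply: gW => //.
  by move: vB1; rewrite (perm_mem pa) inE (negbTE vy1).
have stin' w : all (fun h => h.1 \in atoms B) w -> Meq B (upd W z w) B1 (st w [:: (u, e)] V).
  by move=> aw; apply: Meq_trans (stin w aw) (Meq_sym (stsh w aw)).
have stE w : st w [:: (u, e)] V = upd (upd (upd W y1 [:: (u, e)]) y V) z w.
  apply: funext => v; rewrite /st /upd; have [-> | //] := eqVneq v z.
  by rewrite (negbTE zy) (negbTE zy1).
have aV' : all (fun h => h.1 \in atoms B) (ginv V).
  by rewrite /ginv all_rev all_map.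
have y1B1 : y1 \in atoms B1 by rewrite (perm_mem pa) mem_head.
apply: Meq_trans (stin' _ _) _; first by rewrite all_cat a1 /= yB.
apply: Meq_sym; apply: Meq_trans (stin' _ _) _.
  by rewrite ginv_cons all_cat all_cat all_rcons /= all_cat a1 a2 uB aV' xB VB.
apply: Meq_sym; rewrite !stE.
have g1 : good B1 (upd (upd (upd W y1 [:: (u, e)]) y V) z (w1 ++ (y, t) :: w2)).
  rewrite -stE; apply: gst; [|by rewrite /= sB1|exact: aB1].
  by apply: aB1; rewrite all_cat a1 /= yB.
apply: Meq_trans (IH B1 _ w1 w2 j (rcons pre x) post y1 g1 h2 _ (sB1 _ zB) zy) _.
  by rewrite upd_same.
have := @m_pass1 B1 (upd (upd W y1 [:: (u, e)]) y V) z x y1 u e t (w1 ++ ginv V) (V ++ w2) j pre (y :: post).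
rewrite ginv_cons cat_rcons -!catA /=; apply=> //; last first.
- exact: sB1.
- by rewrite upd_other 1?eq_sym // upd_same.
- exact: sB1.
- rewrite -stE; apply: gst; [|by rewrite /= sB1|exact: aB1].
  by rewrite !all_cat /= all_cat y1B1 (aB1 _ a1) (aB1 _ aV') (aB1 _ VB) (aB1 _ a2).
Qed.

(* Two adjacent undercrossings below the same strand commute: realise the
   exchange by R3 with an auxiliary self-crossing of that strand. *)
Lemma m_swap B W z x y s t w1 w2 j :
  good B (upd W z (w1 ++ [:: (x, s); (y, t)] ++ w2)) -> x \in B j -> y \in B j -> z \in atoms B ->
  Meq B (upd W z (w1 ++ [:: (x, s); (y, t)] ++ w2)) B (upd W z (w1 ++ [:: (y, t); (x, s)] ++ w2)).
Proof.
move=> g xj /mem_split[pre [post hj]] zB.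
have yj : y \in B j by rewrite hj mem_cat mem_head orbT.
have xB := mem_atomsW xj; have yB := mem_atomsW yj.
pose y1 := fresh B; have y1B : y1 \notin atoms B := fresh_notin B.
have hj' : B j = rcons pre y ++ post by rewrite cat_rcons.
pose B1 := ins B j (rcons pre y) y1 post.
have pa : perm_eq (atoms B1) (y1 :: atoms B) := atoms_ins y1 hj'.
have h1 : B1 j = pre ++ y :: y1 :: post by rewrite /B1 /ins eqxx cat_rcons.
have sB1 v : v \in atoms B -> v \in atoms B1 by move=> vB; rewrite (perm_mem pa) inE vB orbT.
have y1B1 : y1 \in atoms B1 by rewrite (perm_mem pa) mem_head.
have zy1 : z != y1 by apply: contraNneq y1B => <-.
have al := good_upd_refs g zB; move: (al); rewrite !all_cat => /and3P[a1 _ a2].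
have aB1 w : all (fun h => h.1 \in atoms B) w -> all (fun h => h.1 \in atoms B1) w.
  by apply: sub_all => h; apply: sB1.
have xj1 : x \in B1 j.
  by move: xj; rewrite /B1 /ins eqxx hj' !mem_cat inE; case/orP=> -> //; rewrite !orbT.
have y1j1 : y1 \in B1 j by rewrite h1 mem_cat !inE eqxx !orbT.
pose st w (p : seq (nat * bool)) := upd (upd W z w) y1 p.
have stE w p : st w p = upd (upd W y1 p) z w by rewrite /st updC.
have gst w p : all (fun h => h.1 \in atoms B1) w -> all (fun h => h.1 \in atoms B1) p -> good B1 (st w p).
  move=> aw ap; split=> [|v]; first by rewrite (perm_uniq pa) /= y1B g.1.
  rewrite /st /upd; case: eqP => // /eqP vy1; case: eqP => // /eqP vz.
  rewrite (perm_mem pa) inE (negbTE vy1) /= => vB; apply: aB1.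
  by have := g.2 v vB; rewrite upd_other.
have stin w : all (fun h => h.1 \in atoms B) w -> Meq B (upd W z w) B1 (st w [::]).
  by move=> aw; exact: (m_ins (good_upd2 g aw) hj' y1B).
have stsv w : all (fun h => h.1 \in atoms B1) w -> Meq B1 (st w [::]) B1 (st w [:: (x, s)]).
  by move=> aw; apply: (@m_sv m n B1 (upd W z w) y1 x s [::] [::] j) => //; apply: gst.
apply: Meq_trans (stin _ al) _.
apply: Meq_sym; apply: Meq_trans (stin _ _) _.
  by rewrite !all_cat a1 a2 /= xB yB.
apply: Meq_trans (stsv _ _) _; first by apply: aB1; rewrite !all_cat a1 a2 /= xB yB.
apply: Meq_sym.
have sl := @m_slide m n B1 (upd W y1 [::]) z y y1 t (rcons w1 (x, s)) w2 j pre post.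
rewrite !cat_rcons -!stE in sl.
apply: Meq_trans (Meq_sym (sl _ h1 _ _ zy1)) _.
- by apply: gst => //; rewrite all_cat /= y1B1 (sB1 _ xB) !aB1.
- by rewrite upd_same.
- exact: sB1.
have a3 : all (fun h => h.1 \in atoms B1) (w1 ++ [:: (x, s), (y1, t) & w2]).
  by rewrite all_cat /= y1B1 (sB1 _ xB) !aB1.
apply: Meq_trans (stsv _ a3) _.
have r3 := @m_R3 m n B1 (upd W y1 [:: (x, s)]) z y y1 x s t w1 w2 j pre post.
rewrite -!stE /= in r3; apply: r3 => //; first by apply: gst => //=; rewrite sB1.
  by rewrite upd_same.
exact: sB1.
Qed.

(** The conjugate is made an actual arc: strand [j] passes under [u] and back by R2 right after [y],
    so that the arc [y1] in between is [y] conjugated by the first letter of [g]. Induction applies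
    to [y1], and the auxiliary crossings are removed again. *)
Lemma m_comm g B W z x y s t w1 w2 j :
  good B (upd W z (w1 ++ (x, s) :: ginv g ++ (y, t) :: g ++ w2)) ->
  x \in B j -> y \in B j -> z \in atoms B ->
  Meq B (upd W z (w1 ++ (x, s) :: ginv g ++ (y, t) :: g ++ w2))
      B (upd W z (w1 ++ ginv g ++ (y, t) :: g ++ (x, s) :: w2)).
Proof.
elim: g B W w1 w2 y => [|[u e] g IH] B W w1 w2 y gd xj yj zB.
  exact: (m_swap gd xj yj zB).
rewrite ginv_cons /= in gd *.
have /mem_split[pre [post hj]] := yj.
have xB := mem_atomsW xj; have yB := mem_atomsW yj.
have al := good_upd_refs gd zB.
have := al; rewrite all_cat /= all_cat all_rcons /= all_cat.
move=> /and4P[a1 _ /andP[uB ag'] /and4P[_ _ ag a2]].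
pose y1 := fresh B; have y1B : y1 \notin atoms B := fresh_notin B.
have hj1 : B j = rcons pre y ++ post by rewrite cat_rcons.
pose B1 := ins B j (rcons pre y) y1 post.
have pa1 : perm_eq (atoms B1) (y1 :: atoms B) := atoms_ins y1 hj1.
have h1 : B1 j = rcons (rcons pre y) y1 ++ post by rewrite /B1 /ins eqxx !cat_rcons.
pose y2 := fresh B1; have y2B : y2 \notin atoms B1 := fresh_notin B1.
pose B2 := ins B1 j (rcons (rcons pre y) y1) y2 post.
have pa2 : perm_eq (atoms B2) (y2 :: atoms B1) := atoms_ins y2 h1.
have h2 : B2 j = pre ++ y :: y1 :: y2 :: post by rewrite /B2 /ins eqxx !cat_rcons.
have h2' : B2 j = rcons pre y ++ y1 :: y2 :: post by rewrite cat_rcons.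
have s1 v : v \in atoms B -> v \in atoms B1 by move=> vB; rewrite (perm_mem pa1) inE vB orbT.
have s2 v : v \in atoms B1 -> v \in atoms B2 by move=> vB; rewrite (perm_mem pa2) inE vB orbT.
have s12 v : v \in atoms B -> v \in atoms B2 by move=> /s1/s2.
have y1B1 : y1 \in atoms B1 by rewrite (perm_mem pa1) mem_head.
have y1B2 := s2 _ y1B1.
have y2B2 : y2 \in atoms B2 by rewrite (perm_mem pa2) mem_head.
have y12 : y1 != y2 by apply: contraNneq y2B => <-.
have zy1 : z != y1 by apply: contraNneq y1B => <-.
have zy2 : z != y2 by apply: contraNneq y2B => <-; apply: s1.
have a2B w : all (fun h => h.1 \in atoms B) w -> all (fun h => h.1 \in atoms B2) w.
  by apply: sub_all => h; apply: s12.
pose st w (p q : seq (nat * bool)) := upd (upd (upd W z w) y1 p) y2 q.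
have stE w p q : st w p q = upd (upd (upd W y1 p) y2 q) z w.
  apply: funext => v; rewrite /st /upd; have [-> | //] := eqVneq v z.
  by rewrite (negbTE zy2) (negbTE zy1).
have gst w p q : all (fun h => h.1 \in atoms B2) w -> all (fun h => h.1 \in atoms B2) p ->
    all (fun h => h.1 \in atoms B2) q -> good B2 (st w p q).
  move=> aw ap aq; split=> [|v].
    by rewrite (perm_uniq pa2) /= y2B (perm_uniq pa1) /= y1B gd.1.
  rewrite /st /upd; case: eqP => // /eqP vy2; case: eqP => // /eqP vy1; case: eqP => // /eqP vz.
  rewrite (perm_mem pa2) inE (negbTE vy2) (perm_mem pa1) inE (negbTE vy1) /= => vB; apply: a2B.
  by have := gd.2 v vB; rewrite upd_other.
have stin w : all (fun h => h.1 \in atoms B) w -> Meq B (upd W z w) B2 (st w [:: (u, e)] [:: (u, ~~ e)]).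
  move=> aw; have i1 : Meq B (upd W z w) B1 (upd (upd W z w) y1 [::]).
    exact: (m_ins (good_upd2 gd aw) hj1 y1B).
  have [_ gi1 _] := i1; apply: (Meq_trans i1).
  apply: Meq_trans (m_ins gi1 h1 y2B) _.
  have gi2 : good B2 (st w [::] [::]) by apply: gst => //; apply: a2B.
  apply: Meq_trans (@m_R2 m n B2 _ y2 u e [::] [::] gi2 y2B2 (s12 _ uB)) _.
  apply: Meq_sym; apply: (@m_shift B2 (upd W z w) j (rcons pre y) post y1 y2 [::] [:: (u, e)] _ h2').
    by apply: gst; [exact: a2B | rewrite /= s12 | rewrite /= s12].
  have nr w' : all (fun h => h.1 \in atoms B) w' -> all (fun h => h.1 != y1) w'.
    by apply: sub_all => h hB; apply: contraNneq y1B => <-.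
  move=> v vB2; rewrite /upd; case: eqP => [_|/eqP vy2]; first by apply: nr; rewrite /= uB.
  case: eqP => [_|/eqP vy1]; first by apply: nr; rewrite /= uB.
  case: eqP => [_|/eqP vz]; first exact: nr.
  apply: nr; have := gd.2 v; rewrite upd_other //; apply.
  by move: vB2; rewrite (perm_mem pa2) inE (negbTE vy2) (perm_mem pa1) inE (negbTE vy1).
have mem2 v : v \in B j -> v \in B2 j.
  rewrite hj1 h2' !mem_cat !inE; case/orP=> -> //; by rewrite !orbT.
have y1j : y1 \in B2 j by rewrite h2 mem_cat !inE eqxx !orbT.
pose W1 := upd (upd W y1 [:: (u, e)]) y2 [:: (u, ~~ e)].
have W1y : W1 y1 = [:: (u, e)] by rewrite /W1 upd_other // upd_same.
have pass w w' : all (fun h => h.1 \in atoms B) w -> all (fun h => h.1 \in atoms B) w' ->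
    Meq B2 (upd W1 z (w ++ (y1, t) :: w')) B2 (upd W1 z (w ++ [:: (u, ~~ e); (y, t); (u, e)] ++ w')).
  move=> aw aw'; apply: (m_pass1 _ _ h2) => //; try exact: s12.
  rewrite -stE; apply: gst; [|by rewrite /= s12|by rewrite /= s12].
  by rewrite all_cat /= y1B2 (a2B _ aw) (a2B _ aw').
apply: (Meq_trans (stin _ al)); apply: Meq_sym.
apply: Meq_trans (stin _ _) _.
  by rewrite all_cat a1 /= all_cat all_rcons /= all_cat uB ag' yB ag /= xB a2.
apply: Meq_sym; rewrite !stE -/W1.
have p1 := pass (w1 ++ (x, s) :: ginv g) (g ++ w2) _ _.
have p2 := pass (w1 ++ ginv g) (g ++ (x, s) :: w2) _ _.
rewrite -!catA /= -?catA /= in p1 p2 *; rewrite !cat_rcons.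
apply: Meq_trans (Meq_sym (p1 _ _)) _.
- by rewrite all_cat a1 /= xB.
- by rewrite all_cat ag a2.
apply: Meq_sym; apply: Meq_trans (Meq_sym (p2 _ _)) _.
- by rewrite all_cat a1 ag'.
- by rewrite all_cat ag /= xB a2.
apply: Meq_sym; apply: IH => //; try exact: mem2.
- rewrite -stE; apply: gst; [|by rewrite /= s12|by rewrite /= s12].
  by rewrite all_cat /= all_cat /= all_cat y1B2 (s12 _ xB) (a2B _ a1) (a2B _ ag') (a2B _ ag) (a2B _ a2).
- exact: s12.
Qed.

End Moves3.

(** * Moving all overcrossings to the initial arcs *)

Section Presentation.
Variables (m n : nat).
Implicit Types (B : 'I_m -> seq nat) (W : nat -> seq (nat * bool)) (S : {set 'I_m}).
Notation Meq := (@Meq m n).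

(* The Wirtinger relations on the strands outside [S], the commutation of all
   conjugates of arcs of one strand, and the triviality of the strands in [S]. *)
Inductive arel B W S : seq (nat * bool) -> seq (nat * bool) -> Prop :=
| ar_pass j pre x y post : j \notin S -> B j = pre ++ x :: y :: post ->
    arel B W S [:: (y, true)] (ginv (W y) ++ (x, true) :: W y)
| ar_comm j x y g : x \in B j -> y \in B j ->
    arel B W S ((x, true) :: ginv g ++ (y, true) :: g) (ginv g ++ (y, true) :: g ++ [:: (x, true)])
| ar_kill j x : j \in S -> x \in B j -> arel B W S [:: (x, true)] [::].

Lemma arel_ext B W W' S u v : (forall j y, j \notin S -> y \in B j -> W y = W' y) ->
  arel B W S u v -> arel B W' S u v.
Proof.
move=> e; case=> [j pre x y post jS hj|j x y g xj yj|j x jS xj].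
- by rewrite (e j y jS (adj_mem hj).2); apply: ar_pass hj.
- exact: ar_comm xj yj.
- exact: ar_kill jS xj.
Qed.

Lemma pcl_sub (T : choiceType) (R R' : seq (T * bool) -> seq (T * bool) -> Prop) u v :
  (forall u v, R u v -> pcl R' u v) -> pcl R u v -> pcl R' u v.
Proof.
move=> h; elim=> {u v} [u|u v _ ?|u v w _ h1 _ h2|p u v q r|p x q].
- exact: pcl_refl.
- exact: pcl_sym.
- exact: pcl_trans h1 h2.
- exact/pcl_ctx/h.
- exact: pcl_cancel.
Qed.

(** A derivation in the presented group may pass through letters that name no atom; these are
    discarded. *)
Definition inB B (w : seq (nat * bool)) := [seq h <- w | h.1 \in atoms B].

Lemma inB_all B w : all (fun h => h.1 \in atoms B) (inB B w).
Proof. exact: filter_all. Qed.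

Lemma inB_id B w : all (fun h => h.1 \in atoms B) w -> inB B w = w.
Proof. by move/all_filterP. Qed.

(** Strand [i] may be killed because its crossings below itself can be virtualized. The Wirtinger
    relations kept concern other strands, which secures the condition [z != y] of [m_pass]. *)
Lemma arel_sound B W z i u v : good B W -> z \in B i ->
  pcl (arel B W [set i]) u v -> forall w1 w2,
  all (fun h => h.1 \in atoms B) w1 -> all (fun h => h.1 \in atoms B) w2 ->
  Meq B (upd W z (w1 ++ inB B u ++ w2)) B (upd W z (w1 ++ inB B v ++ w2)).
Proof.
move=> g zi; have zB := mem_atomsW zi.
have gd w1 u' w2 : all (fun h => h.1 \in atoms B) w1 -> all (fun h => h.1 \in atoms B) w2 ->
   good B (upd W z (w1 ++ inB B u' ++ w2)).
  by move=> a1 a2; apply: good_upd => //; rewrite !all_cat a1 a2 inB_all.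
elim=> {u v} [u|u v _ IH|u v w _ IH1 _ IH2|p u v q r|p x q] w1 w2 a1 a2.
- by apply: Meq_refl; apply: gd.
- by apply: Meq_sym; apply: IH.
- exact: Meq_trans (IH1 _ _ a1 a2) (IH2 _ _ a1 a2).
- rewrite /inB !filter_cat -!/(inB B _) -!catA ![w1 ++ inB B p ++ _]catA.
  have {}a1 : all (fun h => h.1 \in atoms B) (w1 ++ inB B p) by rewrite all_cat a1 inB_all.
  have {}a2 : all (fun h => h.1 \in atoms B) (inB B q ++ w2) by rewrite all_cat a2 inB_all.
  move: (w1 ++ _) (inB B q ++ w2) a1 a2 => {}w1 {}w2 a1 a2.
  case: r => [j pre x y post jS hj|j x y h xj yj|j x jS xj].
  + have [xj yj] := adj_mem hj; have yB := mem_atomsW yj; have xB := mem_atomsW xj.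
    rewrite inE in jS; have zy : z != y.
      by apply: contraNneq jS => ez; apply/eqP/esym/(atoms_strand_eq g.1 zi); rewrite ez.
    have aW := g.2 y yB.
    have -> : inB B [:: (y, true)] = [:: (y, true)] by rewrite inB_id //= yB.
    have -> : inB B (ginv (W y) ++ (x, true) :: W y) = ginv (W y) ++ (x, true) :: W y.
      by rewrite inB_id // all_cat /= xB aW /ginv all_rev all_map aW.
    have := @m_pass m n (W y) B W z x y true w1 w2 j pre post _ hj erefl zB zy.
    rewrite -catA; apply; rewrite -[(y, true) :: w2]/([:: (y, true)] ++ w2).
    by apply: good_upd => //; rewrite all_cat a1 /= yB.
  + have xB := mem_atomsW xj; have yB := mem_atomsW yj.
    have -> : inB B ((x, true) :: ginv h ++ (y, true) :: h) = (x, true) :: ginv (inB B h) ++ (y, true) :: inB B h.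
      by rewrite /inB /= xB filter_cat /= yB (filter_ginv (fun v => v \in atoms B)).
    have -> : inB B (ginv h ++ (y, true) :: h ++ [:: (x, true)]) = ginv (inB B h) ++ (y, true) :: inB B h ++ [:: (x, true)].
      by rewrite /inB filter_cat /= yB filter_cat /= xB (filter_ginv (fun v => v \in atoms B)).
    have := @m_comm m n (inB B h) B W z x y true true w1 w2 j; rewrite -!catA /= -!catA /=.
    apply=> //; apply: good_upd => //; rewrite all_cat a1 /= all_cat /= all_cat a2 xB yB inB_all.
    by rewrite /ginv all_rev all_map inB_all.
  + move: jS; rewrite inE => /eqP ji; rewrite ji in xj; have xB := mem_atomsW xj.
    have -> : inB B [:: (x, true)] = [:: (x, true)] by rewrite inB_id //= xB.
    apply/Meq_sym/(m_sv n _ _ zi xj); apply: good_upd => //.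
    by rewrite all_cat a1 a2.
- rewrite /inB !filter_cat -!/(inB B _) -!catA ![w1 ++ inB B p ++ _]catA.
  have {}a1 : all (fun h => h.1 \in atoms B) (w1 ++ inB B p) by rewrite all_cat a1 inB_all.
  have {}a2 : all (fun h => h.1 \in atoms B) (inB B q ++ w2) by rewrite all_cat a2 inB_all.
  have gg : good B (upd W z ((w1 ++ inB B p) ++ inB B q ++ w2)).
    by apply: good_upd => //; rewrite all_cat a1 a2.
  case: x => x t; rewrite [inB B [:: _; _]]/inB /=; case: (boolP (x \in atoms B)) => xB; last exact: Meq_refl.
  by apply: Meq_sym; apply: m_R2.
Qed.

(** The relations with strand [i] killed do not involve the words on strand [i], so they survive
    while these words are replaced one by one. *)
Lemma strand_replace B W W' i : good B W -> good B W' ->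
  (forall v, v \in atoms B -> v \notin B i -> W v = W' v) ->
  (forall z, z \in B i -> pcl (arel B W [set i]) (W z) (W' z)) -> Meq B W B W'.
Proof.
move=> g g' same h.
pose mix (zs : seq nat) z := if z \in zs then W' z else W z.
have gm zs : good B (mix zs).
  by split=> [|v vB]; [exact: g.1 | rewrite /mix; case: ifP => _; [apply: g'.2 | apply: g.2]].
suff H zs : {subset zs <= B i} -> Meq B W B (mix zs).
  apply: Meq_trans (H (B i) (fun _ => id)) _; apply: Meq_ext => // v vB.
  by rewrite /mix; case: ifP => // /negbT; apply: same.
elim: zs => [_|z zs IH sb]; first exact: Meq_refl.
have zi : z \in B i by apply: sb; rewrite mem_head.
apply: Meq_trans (IH _) _; first by move=> x xz; apply: sb; rewrite inE xz orbT.
have [zz|zz] := boolP (z \in zs).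
  by apply: Meq_ext => // v _; rewrite /mix inE; case: eqP => //= ->; rewrite zz.
have hz : pcl (arel B (mix zs) [set i]) (W z) (W' z).
  apply: pcl_sub (h z zi) => u v r; rewrite -[u]cats0 -[v]cats0; apply: (pcl_rel [::]).
  apply: arel_ext r => j y; rewrite inE => ji yj; rewrite /mix; case: ifP => // yz.
  have yi : y \in B i by apply: sb; rewrite inE yz orbT.
  by rewrite (atoms_strand_eq g.1 yj yi) eqxx in ji.
have zB := mem_atomsW zi.
have := arel_sound (gm zs) zi hz (w1 := [::]) (w2 := [::]) isT isT.
have -> : inB B (W z) = W z by apply/inB_id/g.2.
have -> : inB B (W' z) = W' z by apply/inB_id/g'.2.
rewrite !cats0 /= => hM; by apply: Meq_funext hM _ _ => v; rewrite /upd /mix ?inE; case: eqP => //= ->;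
  rewrite ?(negbTE zz).
Qed.

Section Initial.
Variables (B : 'I_m -> seq nat) (W : nat -> seq (nat * bool)).
Variables (a : 'I_m -> nat) (rest : 'I_m -> seq nat).
Hypothesis gB : good B W.
Hypothesis Brest : forall j, B j = a j :: rest j.

Definition enca (h : 'I_m * bool) : nat * bool := (a h.1, h.2).

Local Open Scope group_scope.

Section ConjLemma.
Variables (S : {set 'I_m}) (j : 'I_m).
Notation E := (pcongr (arel B W S)).
Notation gen x := (wpi E [:: (x, true)]).

Definition ctrj (y : wquot E) := forall x, x \in B j -> forall g, commute y (gen x ^ g).

Lemma wpi_conj u v : wpi E (ginv u ++ v ++ u) = wpi E v ^ wpi E u.
Proof. by rewrite !wpi_cat wpi_ginv conjgE. Qed.

Lemma ctrj_gen x : x \in B j -> ctrj (gen x).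
Proof.
move=> xj y yj g; have [w ->] := wpi_surj g; rewrite -wpi_conj /commute -!wpi_cat.
apply/wpiP; have := pcl_rel [::] [::] (ar_comm W S w xj yj).
by rewrite !cats0 /= -catA.
Qed.

Lemma ctrjJ y g : ctrj y -> ctrj (y ^ g).
Proof.
by move=> h x xj k; apply: commute_conjr; rewrite -conjgM; apply: h.
Qed.

Lemma arel_wpi u v : arel B W S u v -> wpi E u = wpi E v.
Proof. by move=> r; apply/wpiP; have := pcl_rel [::] [::] r; rewrite !cats0. Qed.

(** An element centralizing all conjugates of the arcs of [j] is unaffected when such arcs are
    removed from a conjugator; the other relations already hold before strand [j] is killed. *)
Lemma conj_drop u v : pcl (arel B W (j |: S)) u v ->
  forall y, ctrj y -> y ^ wpi E u = y ^ wpi E v.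
Proof.
elim=> {u v} [u|u v _ IH|u v w _ IH1 _ IH2|p u v q r|p x q] y hy //.
- by rewrite IH.
- by rewrite IH1 ?IH2.
- rewrite !wpi_cat !conjgM; congr (_ ^ _); have {hy} := ctrjJ (wpi E p) hy.
  move: (y ^ _) => {}y hy; case: r => [k pre x z post kS hk|k x z g xk zk|k x kS xk].
  + by congr (_ ^ _); apply/arel_wpi/(ar_pass _ _ hk); move: kS; rewrite !inE negb_or => /andP[].
  + by congr (_ ^ _); apply/arel_wpi/(ar_comm _ _ _ xk zk).
  + rewrite conjg1; move: kS; rewrite !inE => /orP[/eqP kj|kS].
      rewrite kj in xk; have := hy x xk 1; rewrite conjg1 => cx.
      by rewrite conjgE cx mulKg.
    by rewrite (arel_wpi (ar_kill _ kS xk)) conjg1.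
- by congr (_ ^ _); apply/wpiP/pcl_cancel.
Qed.
End ConjLemma.

Lemma init_strand (S : {set 'I_m}) j p x q : j \notin S -> B j = p ++ x :: q ->
  exists2 V, all (fun h => h.1 \in atoms B) V &
    pcl (arel B W S) [:: (x, true)] (ginv V ++ [:: (a j, true)] ++ V).
Proof.
move=> jS; elim/last_ind: p x q => [|p x' IH] x q hj.
  by exists [::] => //; move: hj; rewrite Brest => -[-> _]; apply: pcl_refl.
rewrite cat_rcons in hj; have [V aV hV] := IH x' _ hj.
have xB := mem_atomsW (adj_mem hj).2.
exists (V ++ W x); first by rewrite all_cat aV gB.2.
have h1 : pcl (arel B W S) [:: (x, true)] (ginv (W x) ++ [:: (x', true)] ++ W x).
  by have := pcl_rel [::] [::] (ar_pass W jS hj); rewrite !cats0.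
apply: pcl_trans h1 _; rewrite ginv_cat -!catA; apply: pcl_cat; first exact: pcl_refl.
by have := pcl_ctx [::] (W x) hV; rewrite -!catA.
Qed.

Lemma enca_ginv u : ginv (map enca u) = map enca (ginv u).
Proof. by rewrite /ginv map_rev -!map_comp. Qed.

(** An arc of [j] is a conjugate of [a j], and by [conj_drop] its conjugator need only be rewritten
    with strand [j] killed. The number of surviving strands bounds this recursion. *)
Lemma init_word k (S : {set 'I_m}) : #|~: S| = k -> forall w,
  all (fun h => h.1 \in atoms B) w -> exists w0, pcl (arel B W S) w (map enca w0).
Proof.
elim/ltn_ind: k S => k IH S hk w.
have letter x : x \in atoms B -> exists w0, pcl (arel B W S) [:: (x, true)] (map enca w0).
  case/mem_atoms=> j xj; have [jS|jS] := boolP (j \in S).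
    by exists [::]; have := pcl_rel [::] [::] (ar_kill W jS xj).
  have /mem_split[p [q hj]] := xj.
  have [V aV hV] := init_strand jS hj.
  have lt : #|~: (j |: S)| < k.
    rewrite -hk; apply: proper_card; rewrite properE; apply/andP; split.
      by apply/subsetP=> i; rewrite !inE negb_or => /andP[].
    by apply/subsetPn; exists j; rewrite !inE ?eqxx ?jS.
  have [V0 hV0] := IH _ lt (j |: S) erefl V aV.
  exists (ginv V0 ++ (j, true) :: V0); apply: pcl_trans hV _.
  rewrite map_cat -enca_ginv /= -[(a j, true) :: _]/([:: (a j, true)] ++ _).
  have aj : a j \in B j by rewrite Brest mem_head.
  have := conj_drop hV0 (ctrj_gen (S := S) aj); rewrite -!wpi_conj.
  by move/wpiP.
elim: w => [_|[x t] w IHw /= /andP[xB /IHw[w0 hw0]]]; first by exists [::]; apply: pcl_refl.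
have [x0 hx0] := letter x xB.
exists ((if t then x0 else ginv x0) ++ w0); rewrite map_cat -cat1s; apply: pcl_cat => //.
case: t => //; rewrite -enca_ginv -[[:: (x, false)]]/(ginv [:: (x, true)]).
exact: (@wc_ginv _ (pcongr (arel B W S))).
Qed.
End Initial.

(** The strands are treated in turn. Empty words stay empty, so the initial atoms, which end up with
    all the overcrossings, acquire no undercrossing. *)
Lemma to_initial B W (a : 'I_m -> nat) rest : good B W -> (forall j, B j = a j :: rest j) ->
  (forall j, W (a j) = [::]) ->
  exists w0 : nat -> seq ('I_m * bool), (forall j, w0 (a j) = [::]) /\
    exists2 W', Meq B W B W' & {in atoms B, forall z, W' z = map (enca a) (w0 z)}.
Proof.
move=> g hB Wa.
have aB i : a i \in atoms B by apply: (mem_atomsW (i := i)); rewrite hB mem_head.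
suff H (is_ : seq 'I_m) : exists W', [/\ Meq B W B W', forall j, W' (a j) = [::] &
    forall i z, i \in is_ -> z \in B i -> exists w0, W' z = map (enca a) w0].
  have [W' [h1 h2 h3]] := H (enum 'I_m).
  have : forall z, exists w0, z \in atoms B -> W' z = map (enca a) w0.
    move=> z; case: (boolP (z \in atoms B)) => [/mem_atoms[i zi]|_]; last by exists [::].
    by have [w0 ->] := h3 i z (mem_enum _ _) zi; exists w0.
  case/choice=> w0 hw0; exists w0; split; last by exists W' => // z /hw0.
  by move=> j; have := hw0 (a j) (aB j); rewrite h2; case: (w0 _).
elim: is_ => [|i is_ [W' [h1 h2 h3]]]; first by exists W; split=> //; apply: Meq_refl.
have [_ g' _] := h1.
have : forall z, exists w0, z \in B i -> pcl (arel B W' [set i]) (W' z) (map (enca a) w0) /\ (W' z = [::] -> w0 = [::]).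
  move=> z; case: (boolP (z \in B i)) => [zi|_]; last by exists [::].
  case e: (W' z) => [|h w]; first by exists [::] => _; split=> //; apply: pcl_refl.
  have [|w0 hw0] := init_word g' hB (erefl #|~: [set i]|) (w := W' z).
    exact/g'.2/mem_atomsW/zi.
  by exists w0 => _; split; [rewrite -e | ].
case/choice=> f hf.
pose W2 v := if v \in B i then map (enca a) (f v) else W' v.
have W2a j : W2 (a j) = [::].
  by rewrite /W2; case: ifP => [/hf[_ ->]|_] //; rewrite h2.
exists W2; split=> //.
  apply: Meq_trans h1 _; apply: (strand_replace (i := i)) => //.
  - split=> [|v vB]; first exact: g.1.
    rewrite /W2; case: ifP => _; last exact: g'.2.
    by rewrite all_map; apply/allP=> h _ /=.
  - by move=> v vB /negbTE vi; rewrite /W2 vi.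
  - by move=> z zi; rewrite /W2 zi; have [] := hf z zi.
move=> k z; rewrite inE => /orP[/eqP ->|kis] zk; rewrite /W2.
  by rewrite zk; exists (f z).
by case: ifP => _; [exists (f z) | apply: h3 kis zk].
Qed.

End Presentation.

(** * Normal forms with one word for each strand *)

Section TForm.
Variables (m n : nat).
Implicit Types (B : 'I_m -> seq nat) (W : nat -> seq (nat * bool)) (D : gd m)
  (w : 'I_m -> word m).
Notation Meq := (@Meq m n).

(* In [BT] every strand carries all its overcrossings (atom [2i]) before its
   undercrossings (atom [2i+1]), which spell the word [w i]. *)
Definition BT : 'I_m -> seq nat := fun i => [:: (val i).*2; (val i).*2.+1].
Definition encT (h : 'I_m * bool) : nat * bool := ((val h.1).*2, h.2).
Definition WT w (z : nat) : seq (nat * bool) :=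
  if odd z then if insub z./2 is Some i then map encT (w i) else [::] else [::].

Lemma WT_even w k : WT w k.*2 = [::].
Proof. by rewrite /WT odd_double. Qed.
Lemma WT_odd w (i : 'I_m) : WT w (val i).*2.+1 = map encT (w i).
Proof. by rewrite /WT /= odd_double /= uphalf_double valK. Qed.

Lemma atoms_uniqP B : (forall z, \sum_(i < m) count_mem z (B i) <= 1) -> uniq (atoms B).
Proof.
move=> h; have c z : count_mem z (atoms B) <= 1.
  apply: leq_trans (h z); rewrite -sum1_count /atoms big_flatten big_map big_enum /=.
  by apply/eq_leq/eq_bigr => i _; rewrite sum1_count.
elim: (atoms B) c => //= x s IH c; rewrite IH ?andbT => [|z].
  by rewrite -has_pred1 has_count -leqNgt; have := c x; rewrite eqxx add1n ltnS.
by apply: leq_trans (c z); rewrite leq_addl.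
Qed.

Lemma BT_uniq : uniq (atoms BT).
Proof.
apply: atoms_uniqP => z.
have e (i : 'I_m) : count_mem z (BT i) = (z./2 == val i) :> nat.
  rewrite /= addn0 -{1 2}(odd_double_half z); case: (odd z); rewrite /= ?add1n ?add0n ?eqSS.
    by rewrite (inj_eq double_inj) (_ : _ == z./2.*2.+1 = false) 1?[val i == _]eq_sym //; apply/eqP => /(congr1 odd); rewrite /= !odd_double.
  by rewrite (inj_eq double_inj) [X in _ + X](_ : _ = 0) ?addn0 1?[val i == _]eq_sym //; apply/eqP; rewrite eqb0; apply/eqP => /(congr1 odd); rewrite /= !odd_double.
rewrite (eq_bigr _ (fun i _ => e i)); case: (pickP (fun i : 'I_m => z./2 == val i)) => [i hi|no].
  rewrite (bigD1 i) //= hi big1 // => k ki; case: eqP => // ek; case/eqP: ki; apply: val_inj.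
  by rewrite /= -ek (eqP hi).
by rewrite big1 // => i _; rewrite no.
Qed.

Lemma BT_even (i : 'I_m) : (val i).*2 \in atoms BT.
Proof. by apply: (mem_atomsW (i := i)); rewrite mem_head. Qed.

Lemma goodT w : good BT (WT w).
Proof.
split; first exact: BT_uniq.
move=> z /mem_atoms[i]; rewrite !inE => /orP[] /eqP ->; rewrite ?WT_even ?WT_odd //.
by rewrite all_map; apply/allP=> h _ /=; apply: BT_even.
Qed.

Lemma enumBT (A : Type) (F : nat -> seq A) : flatten [seq F z | z <- atoms BT] =
  flatten [seq F (val i).*2 ++ F (val i).*2.+1 | i <- enum 'I_m].
Proof.
rewrite /atoms /BT; elim: (enum _) => //= i s IH.
by rewrite IH catA.
Qed.

Lemma enumB (A : Type) (F : nat -> seq A) B : flatten [seq F z | z <- atoms B] =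
  flatten [seq flatten [seq F z | z <- B i] | i <- enum 'I_m].
Proof. by rewrite /atoms; elim: (enum _) => //= i s <-; rewrite map_cat flatten_cat. Qed.

(** As all references go to initial atoms, the other atoms of a strand carry no overcrossing and
    merge into one. The same diagram realizes both presentations. *)
Lemma tform B W (a : 'I_m -> nat) rest (w0 : nat -> seq ('I_m * bool)) :
  good B W -> (forall j, B j = a j :: rest j) -> (forall j, w0 (a j) = [::]) ->
  {in atoms B, forall z, W z = map (enca a) (w0 z)} ->
  Meq B W BT (WT (fun i => flatten [seq w0 z | z <- rest i])).
Proof.
move=> g hB wa hW; set w := fun i => _.
have ai : injective a.
  move=> i j e; apply: (atoms_strand_eq g.1 (z := a i)); first by rewrite hB mem_head.
  by rewrite e hB mem_head.
have aB i : a i \in atoms B by apply: (mem_atomsW (i := i)); rewrite hB mem_head.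
have [_ [om [tau [r _]]]] := rz_exists g; have [h1 h2 h3] := r.
pose dec (x : nat) : nat := if [pick j | a j == x] is Some j then (val j).*2 else 0.
have deca j : dec (a j) = (val j).*2.
  rewrite /dec; case: pickP => [k /eqP/ai -> //|/(_ j)]; by rewrite eqxx.
pose rho (h : lhead) : lhead := (h.1, (dec h.2.1, h.2.2)).
have refa h : h \in allh B om -> exists j, h.2.1 = a j.
  case/allh_mem=> z zB hz; have : h.2 \in W z by rewrite -h1 //; apply: map_f.
  by rewrite hW // => /mapP[k _ ->]; exists k.1.
have oma j : om (a j) = [::].
  by have := h1 _ (aB j); rewrite hW // wa; case: (om (a j)).
pose om' z : seq lhead := if odd z then
   if insub z./2 is Some i then flatten [seq map rho (om x) | x <- rest i] else [::] else [::].
pose tau' z : seq ep := if odd z then [::] else if insub z./2 is Some i then tau (a i) else [::].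
have om'e k : om' k.*2 = [::] by rewrite /om' odd_double.
have om'o (i : 'I_m) : om' (val i).*2.+1 = flatten [seq map rho (om x) | x <- rest i].
  by rewrite /om' /= odd_double /= uphalf_double valK.
have tau'e (i : 'I_m) : tau' (val i).*2 = tau (a i) by rewrite /tau' odd_double doubleK valK.
have tau'o k : tau' k.*2.+1 = [::] by rewrite /tau' /= odd_double.
have alleq : allh BT om' = map rho (allh B om).
  rewrite map_allh [RHS]enumB /allh enumBT; congr flatten; apply: eq_map => i.
  by rewrite om'e om'o /= hB /= oma.
have tauz x : x \in atoms B -> (forall j, x <> a j) -> tau x = [::].
  move=> xB xa; apply/perm_nilP; apply: perm_trans (h3 x xB) _.
  rewrite (_ : tfil _ _ = [::]) //; apply/eqP; rewrite -size_eq0 size_map size_filter -leqn0 leqNgt -has_count.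
  by apply/hasPn => h /refa[j ->]; apply/eqP => e; case: (xa j).
have rest_a i z : z \in rest i -> z \in atoms B /\ (forall j, z <> a j).
  move=> zr; have zi : z \in B i by rewrite hB inE zr orbT.
  split=> [|j e]; first exact: mem_atomsW zi.
  have ij : i = j by apply: (atoms_strand_eq g.1 zi); rewrite e hB mem_head.
  by have := atoms_uniq_strand i g.1; rewrite hB /= -[a i]/(a i) {1}ij -e zr.
apply: Meq_same => //; first exact: goodT.
exists (realize B om tau); split; first by exists om, tau.
exists om', tau'; split.
  split=> [z /mem_atoms[i]||x /mem_atoms[i]]; rewrite ?alleq.
  - rewrite !inE => /orP[] /eqP ->; first by rewrite om'e WT_even.
    rewrite om'o WT_odd /w !map_flatten -!map_comp; congr flatten.
    apply/eq_in_map => y /rest_a[yB _] /=; rewrite -map_comp.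
    rewrite (eq_map (g := (fun q => (dec q.1, q.2)) \o snd)) // map_comp h1 // hW // -map_comp.
    by apply: eq_map => -[k b] /=; rewrite /enca /encT /= deca.
  - by rewrite -map_comp (eq_map (g := fst)).
  - rewrite !inE => /orP[] /eqP ->.
      rewrite tau'e; apply: perm_trans (h3 _ (aB i)) _.
      rewrite /tfil filter_map -map_comp (eq_map (g := tlp)) // (_ : filter _ _ = [seq h <- allh B om | h.2.1 == a i]) //.
      apply: eq_in_filter => h /refa[j /= ->]; rewrite deca (inj_eq double_inj).
      by rewrite (inj_eq ai) val_eqE.
    rewrite tau'o (_ : tfil _ _ = [::]) //; apply/eqP; rewrite -size_eq0 size_map size_filter -leqn0 leqNgt -has_count.
    apply/hasPn => h /mapP[h' /refa[j e] ->] /=; rewrite e deca; apply/eqP => /(congr1 odd).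
    by rewrite /= !odd_double.
apply: funext => i; rewrite !realizeE hB /= om'e om'o tau'e tau'o oma /= !cats0; congr (_ ++ _).
rewrite map_flatten -map_comp; congr flatten; apply/eq_in_map => z /rest_a[zB za] /=.
by rewrite tauz // cats0 -map_comp.
Qed.

(** All overcrossings lie on initial arcs, so giving each crossing the generator of its over-strand
    is a colouring, and the longitude it defines on strand [i] is [w i]. *)
Lemma muT w D J i : rz BT (WT w) D -> uniq (rcons J i) -> mu D (rcons J i) = nc (w i) J.
Proof.
move=> rD uJ; have wD := rz_wf (goodT w) rD.
case: rD => om [tau [r eD]]; have [h1 h2 h3] := r.
pose js (l : nat) : 'I_m := odflt i (insub (nth (0, (0, true)) (allh BT om) (index l (map fst (allh BT om)))).2.1./2).
pose kp l : word m := [:: (js l, true)].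
have jsE h : h \in allh BT om -> exists2 j : 'I_m, h.2.1 = (val j).*2 & js h.1 = j.
  move=> hL; have [j hj] : exists j : 'I_m, h.2.1 = (val j).*2.
    case/allh_mem: (hL) => z zB hz; have : h.2 \in WT w z by rewrite -h1 //; apply: map_f.
    case/mem_atoms: zB => k; rewrite !inE => /orP[] /eqP ->; rewrite ?WT_even ?WT_odd //.
    by case/mapP=> q _ ->; exists q.1.
  exists j => //; rewrite /js.
  set h' := nth _ _ _.
  have hl : h.1 \in map fst (allh BT om) by apply: map_f.
  have h'L : h' \in allh BT om by rewrite mem_nth // -(size_map fst) index_mem.
  have -> : h' = h.
    apply: (fst_inj_in h2) => //; rewrite -(nth_map _ 0) -?(size_map fst) ?index_mem //.
    by rewrite nth_index.
  by rewrite hj doubleK valK.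
have om0 k : k.*2 \in atoms BT -> om k.*2 = [::].
  by move=> kB; have := h1 _ kB; rewrite WT_even; case: (om _).
have oB (k : 'I_m) : (val k).*2.+1 \in atoms BT.
  by apply: (mem_atomsW (i := k)); rewrite !inE eqxx orbT.
have tau0 (k : 'I_m) : (val k).*2.+1 \in atoms BT -> tau (val k).*2.+1 = [::].
  move=> kB; apply/perm_nilP; apply: perm_trans (h3 _ kB) _.
  rewrite (_ : tfil _ _ = [::]) //; apply/eqP; rewrite -size_eq0 size_map size_filter -leqn0 leqNgt -has_count.
  apply/hasPn => h /jsE[j -> _]; apply/eqP => /(congr1 odd).
  by rewrite /= !odd_double.
have DE (k : 'I_m) : D k = tau (val k).*2 ++ map hdp (om (val k).*2.+1).
  by rewrite eD realizeE /= om0 ?BT_even //= tau0 // !cats0.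
have overs (k : 'I_m) e : e \in tau (val k).*2 -> ov e /\ js (lab e) = k.
  move=> /(tau_over r (BT_even k))[h hL [-> hk]]; split=> //.
  have [j hj] := jsE h hL; rewrite /lab /= => ->; apply: val_inj.
  by apply: double_inj; rewrite -hj hk.
have lon_over (k : 'I_m) (s : seq ep) : {subset s <= tau (val k).*2} -> lon kp s = [::].
  move=> sb; rewrite /lon (_ : filter _ _ = [::]) //; apply/eqP; rewrite -(negbK (_ == _)) -has_filter.
  by apply/hasPn => e /sb es; have [-> _] := overs _ _ es.
have lonE (k : 'I_m) : lon kp (D k) = w k.
  rewrite DE lon_cat (@lon_over k) //= /lon.
  rewrite (_ : filter _ _ = map hdp (om (val k).*2.+1)); last first.
    by apply/all_filterP; rewrite all_map; apply/allP.
  have : map encT (w k) = map snd (om (val k).*2.+1) by rewrite h1 // WT_odd.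
  have : {subset om (val k).*2.+1 <= allh BT om}.
    by move=> h hk; apply/allh_mem; exists (val k).*2.+1.
  elim: (om _) (w k) => [|[l [x c]] s IH] [|[q b] v] //= sb [e1 e2 e3].
  rewrite (IH v) //; last by move=> y ys; apply: sb; rewrite inE ys orbT.
  have [j /= hj jj] := jsE _ (sb _ (mem_head _ _)).
  have qj : q = j by apply: val_inj; apply: double_inj; rewrite -hj -e1.
  rewrite /kpow /kp /lab /sg /= jj -e2 qj; by case: (b).
have cD : colors (@mgen m 0) (fun l => wpi _ (kp l)) D.
  move=> k; rewrite -[mgen 0 k]/(wpi _ (cj k [::])); apply/gok_lon => p q e hk oe.
  have hp : e \in tau (val k).*2 /\ {subset p <= tau (val k).*2}.
    move: hk; rewrite DE => hk.
    have ne : e \notin map hdp (om (val k).*2.+1) by apply/negP => /mapP[h _ ee]; rewrite ee in oe.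
    elim: p (tau _) hk => [|x p IH] [|y t] //= hk.
    - by rewrite hk mem_head in ne.
    - by case: hk => -> _; rewrite mem_head.
    - by move: ne; rewrite hk inE mem_cat mem_head !orbT.
    - case: hk => -> /IH[h4 h5]; split; first by rewrite inE h4 orbT.
      by move=> z; rewrite !inE => /orP[->//|/h5 ->]; rewrite orbT.
  case: hp => ht hp; have [_ je] := overs k e ht.
  by rewrite (lon_over k p hp) /kp je; apply: eqm_refl.
have := mu_gend wD cD uJ (V := w i); rewrite !modz0; apply.
by rewrite -[mgen 0 i]/(wpi _ (cj i [::])) gend_lon lonE.
Qed.

End TForm.

(** * Presentation of a diagram *)

Section DiagramAtoms.
Variables (m n : nat) (D : gd m).
Hypothesis wD : wf D.
Notation Meq := (@Meq m n).

(** Odd, hence distinct from the atoms [2i] of the initial arcs; after halving, the parity separates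
    over from under and the rest is the label. *)
Definition code (l : nat) (b : bool) : nat := (b + l.*2).*2.+1.
Definition BD : 'I_m -> seq nat := fun i => (val i).*2 :: [seq code (lab e) (ov e) | e <- D i].
Definition sgn (l : nat) : bool := [exists i, has (fun e => (lab e == l) && sg e) (D i)].
Definition omD (z : nat) : seq lhead :=
  if odd z && ~~ odd z./2 then [:: (z./2./2, (code z./2./2 true, sgn z./2./2))] else [::].
Definition tauD (z : nat) : seq ep :=
  if odd z && odd z./2 then [:: (z./2./2, true, sgn z./2./2)] else [::].
Definition WD (z : nat) : seq (nat * bool) := map snd (omD z).

Lemma code_half l b : (code l b)./2 = b + l.*2.
Proof. by rewrite /code -[(_.*2).+1]/(true + _.*2) half_bit_double. Qed.
Lemma code_odd l b : odd (code l b).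
Proof. by rewrite /code /= odd_double. Qed.
Lemma code_inj l b l' b' : code l b = code l' b' -> l = l' /\ b = b'.
Proof.
move=> e; have e1 : b + l.*2 = b' + l'.*2 by rewrite -!code_half e.
split; last by have := congr1 odd e1; rewrite !oddD !odd_double !addbF !oddb.
by have := congr1 half e1; rewrite !half_bit_double.
Qed.

Lemma omD_code l b : omD (code l b) = if b then [::] else [:: (l, (code l true, sgn l))].
Proof.
rewrite /omD code_odd code_half oddD odd_double addbF oddb half_bit_double /=.
by case: b.
Qed.
Lemma tauD_code l b : tauD (code l b) = if b then [:: (l, true, sgn l)] else [::].
Proof.
rewrite /tauD code_odd code_half oddD odd_double addbF oddb half_bit_double /=.
by case: b.
Qed.
Lemma omD_even k : omD k.*2 = [::]. Proof. by rewrite /omD odd_double. Qed.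
Lemma tauD_even k : tauD k.*2 = [::]. Proof. by rewrite /tauD odd_double. Qed.

Lemma sgnE i e : e \in D i -> sg e = sgn (lab e).
Proof.
move=> ei; apply/idP/existsP => [se|[j /hasP[e' ej /andP[/eqP el se]]]].
  by exists i; apply/hasP; exists e => //; rewrite eqxx.
by have [_ h] := wD; rewrite (h i j e e' ei ej).
Qed.

Lemma BD_uniq : uniq (atoms BD).
Proof.
apply: atoms_uniqP => z; have [oz|ez] := boolP (odd z).
  have zc : z = code z./2./2 (odd z./2).
    by rewrite /code odd_double_half -{1}(odd_double_half z) oz.
  have [/(_ z./2./2) [ct cf] _] := wD.
  apply: (@leq_trans (cnt D z./2./2 (odd z./2))); last by case: (odd _); rewrite -?ct.
  apply/eq_leq/eq_bigr => i _; rewrite /= count_map.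
  have -> : ((val i).*2 == z) = false by apply/eqP => e; rewrite -e odd_double in oz.
  rewrite add0n; apply: eq_count => e /=; rewrite {1}zc.
  by apply/eqP/andP => [/code_inj[-> ->]|[/eqP -> /eqP ->]].
have e (i : 'I_m) : count_mem z (BD i) = (val i == z./2).
  rewrite /= count_map (eq_count (a2 := pred0)) ?count_pred0 ?addn0; last first.
    by move=> e /=; apply/eqP => ee; rewrite -ee code_odd in ez.
  by rewrite -{1}(odd_double_half z) (negbTE ez) (inj_eq double_inj).
rewrite (eq_bigr _ (fun i _ => e i)); case: (pickP (fun i : 'I_m => val i == z./2)) => [i hi|no].
  rewrite (bigD1 i) //= hi big1 // => k ki; case: eqP => // ek; case/eqP: ki; apply: val_inj.
  by apply: etrans ek _; apply/esym/eqP.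
by rewrite big1 // => i _; rewrite no.
Qed.

Lemma BD_code i e : e \in D i -> code (lab e) (ov e) \in BD i.
Proof. by move=> ei; rewrite inE (map_f (fun e => code (lab e) (ov e)) ei) orbT. Qed.

Lemma BD_mem z : z \in atoms BD -> (exists i : 'I_m, z = (val i).*2) \/
  exists i e, e \in D i /\ z = code (lab e) (ov e).
Proof.
case/mem_atoms=> i; rewrite inE => /orP[/eqP ->|/mapP[e ei ->]]; first by left; exists i.
by right; exists i, e.
Qed.

Lemma opposite i e : e \in D i -> exists j e', [/\ e' \in D j, lab e' = lab e & ov e' = ~~ ov e].
Proof.
move=> ei; have [/(_ (lab e)) [ct _] _] := wD.
have h b : ov e = b -> 0 < cnt D (lab e) (~~ b).
  move=> oe; have : 0 < cnt D (lab e) b.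
    apply: leq_trans (sum_count1 D _ i); rewrite -has_count; apply/hasP; exists e => //.
    by rewrite oe !eqxx.
  by case: b {oe}; rewrite ?ct.
have := h _ erefl; rewrite lt0n /cnt sum_nat_eq0 => /forallPn[j] /=.
rewrite -lt0n -has_count => /hasP[e' ej /andP[/eqP el /eqP oe]].
by exists j, e'.
Qed.

Lemma goodD : good BD WD.
Proof.
split; first exact: BD_uniq.
move=> z /BD_mem[[i ->]|[i [e [ei ->]]]]; first by rewrite /WD omD_even.
rewrite /WD omD_code; case oe: (ov e) => //=; rewrite andbT.
have [j [e' [ej el oe']]] := opposite ei; rewrite oe /= in oe'.
by apply: (mem_atomsW (i := j)); have := BD_code ej; rewrite el oe'.
Qed.

Lemma rzD : rz BD WD D.
Proof.
have hmem h : h \in allh BD omD -> exists i e, [/\ e \in D i, ~~ ov e & h = (lab e, (code (lab e) true, sgn (lab e)))].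
  case/allh_mem=> z /BD_mem[[i ->]|[i [e [ei ->]]]]; first by rewrite omD_even.
  rewrite omD_code; case oe: (ov e) => //; rewrite inE => /eqP ->.
  by exists i, e; rewrite oe.
have ufst : uniq (map fst (allh BD omD)).
  rewrite map_allh; elim: (atoms BD) BD_uniq => //= z s IH /andP[zs /IH us].
  rewrite cat_uniq us andbT; have -> : uniq (map fst (omD z)) by rewrite /omD; case: ifP.
  apply/hasPn => l /flattenP[t /mapP[y ys ->]] /=; rewrite /omD.
  case: ifP => // /andP[oy ey]; rewrite inE => /eqP ->; case: ifP => //= /andP[oz ez].
  rewrite inE; apply: contra zs => /eqP eq.
  rewrite -(odd_double_half z) oz -(odd_double_half z./2) (negbTE ez) -eq.
  move: ys; rewrite -{1}(odd_double_half y) oy -{1}(odd_double_half y./2) (negbTE ey).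
  by [].
exists omD, tauD; split; last first.
  apply: funext => i; rewrite realizeE /= omD_even tauD_even /=.
  have : {subset D i <= D i} by [].
  elim: {1 3 4}(D i) => //= e s IH sb; rewrite -IH => [|x xs]; last by apply: sb; rewrite inE xs orbT.
  rewrite omD_code tauD_code -(sgnE (sb e (mem_head _ _))).
  by case: e {sb} => [[l b] t]; rewrite /lab /ov /sg /=; case: b.
split=> // x xB; apply: uniq_perm.
- by rewrite /tauD; case: ifP.
- exact: uniq_tfil.
move=> e; apply/idP/mapP => [|[h]].
  case/BD_mem: xB => [[i ->]|[i [e' [ei ->]]]]; first by rewrite tauD_even.
  rewrite tauD_code; case oe: (ov e') => //; rewrite inE => /eqP ->.
  have [j [e2 [ej el oe2]]] := opposite ei; rewrite oe /= in oe2.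
  exists (lab e', (code (lab e') true, sgn (lab e'))) => //.
  rewrite mem_filter eqxx /=; apply/allh_mem; exists (code (lab e') false).
    by apply: (mem_atomsW (i := j)); have := BD_code ej; rewrite el oe2.
  by rewrite omD_code mem_head.
rewrite mem_filter => /andP[/eqP hx /hmem[i [e' [ei oe eh]]]] ->; subst h.
by rewrite -hx /= tauD_code mem_head.
Qed.

Lemma diagram_T : exists (w : 'I_m -> word m) E, rz (@BT m) (WT w) E /\ eqv n D E.
Proof.
have [||w0 [wa [W' hM hW]]] := @to_initial m n BD WD (fun i => (val i).*2)
   (fun i => [seq code (lab e) (ov e) | e <- D i]) goodD _ _ => //.
  by move=> j; rewrite /WD omD_even.
have [_ g' _] := hM.
have hT := @tform m n BD W' (fun i => (val i).*2) _ w0 g' (fun _ => erefl) wa hW.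
set w := fun i => _ in hT; exists w; have [E rE] := rz_exists (goodT w); exists E; split=> //.
exact: Meq_eqv (Meq_trans hM hT) rzD rE.
Qed.

End DiagramAtoms.

(** * The 2n-move on presentations *)

Section TwistSeqs.
Variables (M : nat) (s : bool).

Lemma twist_over_seq n :
  flatten [seq [:: (M + r.*2, false, s); (M + r.*2.+1, true, s)] | r <- iota 0 n] =
  [seq (M + k, odd k, s) | k <- iota 0 (2 * n)].
Proof.
elim: n => // n IH; rewrite -[n.+1]addn1 iotaD map_cat flatten_cat IH mulnDr muln1 iotaD map_cat.
by rewrite add0n /= mul2n odd_double.
Qed.

(** Regrouping along the second strand: it begins above, on the arc that enters the twist. Each
    later arc starts with an undercrossing and ends with an overcrossing, except the last, which has
    no overcrossing. *)
Lemma twist_under_seq n :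
  (if 0 < n then [:: (M, true, s)] else [::]) ++
  flatten [seq (M + r.*2.+1, false, s) ::
     (if r.+1 < n then [:: (M + r.+1.*2, true, s)] else [::]) | r <- iota 0 n] =
  [seq (M + k, ~~ odd k, s) | k <- iota 0 (2 * n)].
Proof.
have io p : iota 0 p.+1 = iota 0 p ++ [:: p] by rewrite -addn1 iotaD.
have G p : (M, true, s) :: flatten [seq [:: (M + r.*2.+1, false, s); (M + r.+1.*2, true, s)] | r <- iota 0 p] =
    [seq (M + k, ~~ odd k, s) | k <- iota 0 (p.*2.+1)].
  elim: p => [|p IH]; first by rewrite /= addn0.
  rewrite io map_cat flatten_cat -cat_cons IH doubleS !io !map_cat -!catA.
  by rewrite /= !negbK odd_double.
case: n => // n; rewrite ltn0Sn io map_cat flatten_cat mul2n doubleS !io !map_cat.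
rewrite [X in _ ++ X ++ _](_ : _ = flatten [seq [:: (M + r.*2.+1, false, s); (M + r.+1.*2, true, s)] | r <- iota 0 n]).
  by rewrite catA cat1s G io map_cat -!catA /= ltnn odd_double.
by congr flatten; apply/eq_in_map => r; rewrite mem_iota add0n /= ltnS => ->.
Qed.
End TwistSeqs.

Section Twist.
Variables (m n : nat).
Implicit Types (B : 'I_m -> seq nat) (W : nat -> seq (nat * bool)).
Notation Meq := (@Meq m n).

Lemma local_move2 (D D' : gd m) k j A0 Z0 A1 Z1 t0 t1 P : k != j -> wf D -> wf D' ->
  D k = A0 ++ Z0 -> D j = A1 ++ Z1 -> D' k = A0 ++ t0 ++ Z0 -> D' j = A1 ++ t1 ++ Z1 ->
  (forall i, i != k -> i != j -> D i = D' i) ->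
  P (fun _ => [::]) (fun h => if h == 0 then t0 else t1) ->
  local_move 2 (@no_cond m) P D D'.
Proof.
move=> kj wD wD' hk hj hk' hj' hD hP; split=> //; split=> //.
pose H : hgd m := fun i => if i == k then map inl A0 ++ inr 0 :: map inl Z0 else
  if i == j then map inl A1 ++ inr 1 :: map inl Z1 else map inl (D i).
have c0 h (t : seq ep) : count (pred1 (inr h : ep + nat)) (map inl t) = 0.
  by rewrite count_map; apply/eqP; rewrite -leqn0 leqNgt -has_count; apply/hasPn.
have fl f (t : seq ep) : flatten [seq match x with inl e => [:: e] | inr h => f h end | x <- map inl t] = t.
  by rewrite -map_comp; elim: t => //= x t ->.
have jk : (j == k) = false by rewrite eq_sym (negbTE kj).
exists H, (fun _ => [::]), (fun h => if h == 0 then t0 else t1); split=> // [h|i|i].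
- rewrite (bigD1 k) // (bigD1 j) 1?eq_sym //= big1 => [|i /andP[ik ij]].
    by rewrite /H !eqxx jk !count_cat /= !c0 !addn0 !add0n; case: h => [|[|h]].
  by rewrite /H (negbTE ik) (negbTE ij) c0.
- rewrite /fill /H; case: eqP => [->|/eqP ik]; first by rewrite hk map_cat flatten_cat /= !fl.
  case: eqP => [->|/eqP ij]; first by rewrite hj map_cat flatten_cat /= !fl.
  by rewrite fl.
- rewrite /fill /H; case: eqP => [->|/eqP ik]; first by rewrite hk' map_cat flatten_cat /= !fl.
  case: eqP => [->|/eqP ij]; first by rewrite hj' map_cat flatten_cat /= !fl.
  by rewrite fl -hD.
Qed.

Lemma arc_chain B W (S : {set 'I_m}) k pre c0 cs post : k \notin S ->
  B k = pre ++ c0 :: cs ++ post ->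
  wpi (pcongr (arel B W S)) [:: (last c0 cs, true)] =
  (wpi (pcongr (arel B W S)) [:: (c0, true)] ^ wpi _ (flatten [seq W c | c <- cs]))%g.
Proof.
move=> kS; elim: cs pre c0 => [|c1 cs IH] pre c0 hk /=; first by rewrite conjg1.
rewrite (IH (rcons pre c0)) ?cat_rcons // wpi_cat conjgM; congr (_ ^ _)%g.
by rewrite (arel_wpi (ar_pass W kS hk)) -cat1s wpi_conj.
Qed.

Lemma wpi_killed B W (S : {set 'I_m}) k u : k \in S -> all (fun h => h.1 \in B k) u ->
  wpi (pcongr (arel B W S)) u = 1%g.
Proof.
move=> kS; elim: u => [|[x t] u IH] //= /andP[xk /IH hu]; rewrite wpi_cons hu mulg1.
have hx := arel_wpi (ar_kill W kS xk).
by case: t => //; rewrite -[[:: _]]/(ginv [:: (x, true)]) wpi_ginv hx invg1.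
Qed.

Lemma wpi_sign (T : choiceType) (E : wcongr T) x y t :
  wpi E [:: (x, true)] = wpi E [:: (y, true)] -> E [:: (x, t)] [:: (y, t)].
Proof.
move=> h; apply/wpiP; case: t => //.
by rewrite -[[:: (x, _)]]/(ginv [:: (x, true)]) -[[:: (y, _)]]/(ginv [:: (y, true)]) !wpi_ginv h.
Qed.

Section Insert.
Variables (B : 'I_m -> seq nat) (W : nat -> seq (nat * bool)) (s : bool).
Variables (k j : 'I_m) (p0 q0 : nat) (xs ys pk qk pj qj : seq nat).
Hypothesis g : good B W.
Hypothesis kj : k != j.
Hypothesis Bk : B k = pk ++ p0 :: xs ++ qk.
Hypothesis Bj : B j = pj ++ q0 :: ys ++ qj.
Hypothesis sx : size xs = n.
Hypothesis sy : size ys = n.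
Hypothesis Wx : forall z, z \in xs ++ ys -> W z = [::].
Hypothesis ur : forall z, z \in xs ++ ys -> unref B W z.

(** The strands alternate: the [r]-th arc of [xs] starts below the [r]-th of [q0 :: ys], then the
    [r]-th arc of [ys] below the [r]-th of [xs], which makes [2n] crossings. *)
Definition twW (z : nat) : seq (nat * bool) :=
  if z \in xs then [:: (nth 0 (q0 :: ys) (index z xs), s)] else
  if z \in ys then [:: (nth 0 xs (index z ys), s)] else W z.

Let xk z : z \in xs -> z \in B k.
Proof. by move=> zx; rewrite Bk mem_cat inE mem_cat zx !orbT. Qed.
Let yj z : z \in q0 :: ys -> z \in B j.
Proof. by rewrite Bj mem_cat !inE mem_cat => /orP[] ->; rewrite !orbT. Qed.
Let xB z : z \in xs -> z \in atoms B. Proof. by move/xk/mem_atomsW. Qed.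
Let yB z : z \in q0 :: ys -> z \in atoms B. Proof. by move/yj/mem_atomsW. Qed.
Let xy z z' : z \in xs -> z' \in q0 :: ys -> z != z'.
Proof.
move=> /xk zk /yj zj; apply: contraNneq kj => e; rewrite -e in zj.
by rewrite (atoms_strand_eq g.1 zk zj).
Qed.
Let uqy : uniq (q0 :: ys).
Proof.
have := atoms_uniq_strand j g.1; rewrite Bj -cat_cons catA cat_uniq => /and3P[h _ _].
by move: h; rewrite cat_uniq => /and3P[].
Qed.
Let ux : uniq xs.
Proof.
have := atoms_uniq_strand k g.1; rewrite Bk -cat_cons catA cat_uniq => /and3P[h _ _].
by move: h; rewrite cat_uniq /= => /and4P[_ _ _].
Qed.
Let uy : uniq ys. Proof. by case/andP: uqy. Qed.
Let uxy : uniq (xs ++ ys).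
Proof.
rewrite cat_uniq ux uy andbT; apply/hasPn => z zy; apply/negP => zx.
by have := xy zx (z' := z); rewrite inE zy orbT eqxx => /(_ isT).
Qed.

Lemma good_tw : good B twW.
Proof.
split=> [|z zB]; first exact: g.1; rewrite /twW; case: ifP => zx /=.
  by rewrite andbT yB // mem_nth //= sy -sx ltnS ltnW // index_mem.
case: ifP => zy; last exact: g.2.
by rewrite /= andbT xB // mem_nth // sx -sy index_mem.
Qed.

(** The arcs of [xs] and [ys] are empty and unreferenced, so along each strand the new crossings are
    consecutive and form one parallel twist. *)
Lemma m_twist : Meq B W B twW.
Proof.
have [_ [om [tau [r _]]]] := rz_exists g; have [h1 h2 h3] := r.
pose M := (\max_(x <- map fst (allh B om)) x).+1.
have ltM l : l \in map fst (allh B om) -> l < M by move=> lL; rewrite ltnS leq_bigmax_seq.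
(* Labels are counted from [M], above all old ones: even offsets for the undercrossings of [xs], odd
   offsets for those of [ys], in the order of the twist. *)
pose om' z : seq lhead :=
  if z \in xs then [:: (M + (index z xs).*2, (nth 0 (q0 :: ys) (index z xs), s))] else
  if z \in ys then [:: (M + (index z ys).*2.+1, (nth 0 xs (index z ys), s))] else om z.
pose tau' z : seq ep :=
  if z \in xs then [:: (M + (index z xs).*2.+1, true, s)] else
  if z \in ys then (if (index z ys).+1 < n then [:: (M + (index z ys).+1.*2, true, s)] else [::]) else
  if z == q0 then tau z ++ (if 0 < n then [:: (M, true, s)] else [::]) else tau z.
have sxy z : z \in xs ++ ys -> z \in atoms B.
  by rewrite mem_cat => /orP[/xB //|zy]; apply: yB; rewrite inE zy orbT.
have om0 z : z \in xs ++ ys -> om z = [::].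
  by move=> zz; have := h1 z (sxy z zz); rewrite Wx //; case: (om z).
have tf0 z : z \in xs ++ ys -> tfil z (allh B om) = [::].
  move=> zz; apply/eqP; rewrite -size_eq0 size_map size_filter -leqn0 leqNgt -has_count.
  apply/hasPn => h /allh_mem[v vB hv]; have /allP := ur zz vB; apply.
  by rewrite -h1 //; apply: map_f.
have tau0 z : z \in xs ++ ys -> tau z = [::].
  by move=> zz; apply/perm_nilP; rewrite (perm_trans (h3 z (sxy z zz))) // tf0.
have pall : perm_eq (allh B om') (flatten [seq om' z | z <- xs ++ ys] ++ allh B om).
  have pat : perm_eq (atoms B) ((xs ++ ys) ++ [seq z <- atoms B | z \notin xs ++ ys]).
    apply: (@perm_trans _ ([seq z <- atoms B | z \in xs ++ ys] ++ [seq z <- atoms B | z \notin xs ++ ys])).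
      by rewrite perm_sym; exact/permEl/perm_filterC.
    rewrite perm_cat2r; apply: uniq_perm; rewrite ?filter_uniq ?g.1 // => z.
    by rewrite mem_filter; case: (boolP (z \in xs ++ ys)) => // /sxy ->.
  apply: perm_trans (perm_flatten (perm_map om' pat)) _.
  rewrite map_cat flatten_cat perm_cat2l perm_sym.
  apply: perm_trans (perm_flatten (perm_map om pat)) _; rewrite map_cat flatten_cat.
  have fl0 t : {subset t <= xs ++ ys} -> flatten [seq om z | z <- t] = [::].
    elim: t => //= z t IH sb; rewrite om0 ?IH ?sb ?mem_head // => v vt.
    by apply: sb; rewrite inE vt orbT.
  rewrite fl0 //.
  rewrite /= (_ : [seq om z | z <- _] = [seq om' z | z <- [seq z <- atoms B | z \notin xs ++ ys]]) //.
  apply/eq_in_map => z; rewrite mem_filter mem_cat negb_or => /andP[/andP[zx zy] _].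
  by rewrite /om' (negbTE zx) (negbTE zy).
pose N1 : seq lhead := [seq (M + r.*2, (nth 0 (q0 :: ys) r, s)) | r <- iota 0 n].
pose N2 : seq lhead := [seq (M + r.*2.+1, (nth 0 xs r, s)) | r <- iota 0 n].
have nx : flatten [seq om' z | z <- xs] = N1.
  rewrite -{1}[xs](mkseq_nth 0) /mkseq sx -map_comp -[RHS]flatten_map1; congr flatten.
  apply/eq_in_map => a; rewrite mem_iota => /andP[_ an] /=.
  by rewrite /om' mem_nth ?sx // index_uniq ?sx.
have ny : flatten [seq om' z | z <- ys] = N2.
  rewrite -{1}[ys](mkseq_nth 0) /mkseq sy -map_comp -[RHS]flatten_map1; congr flatten.
  apply/eq_in_map => a; rewrite mem_iota => /andP[_ an] /=.
  have yr : nth 0 ys a \in ys by rewrite mem_nth ?sy.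
  have nyx : nth 0 ys a \notin xs.
    by apply/negP => zx; have := xy zx (z' := nth 0 ys a); rewrite inE yr orbT eqxx => /(_ isT).
  by rewrite /om' (negbTE nyx) yr index_uniq ?sy.
rewrite map_cat flatten_cat nx ny in pall.
have uL : uniq (map fst ((N1 ++ N2) ++ allh B om)).
  rewrite map_cat cat_uniq h2 andbT; apply/andP; split.
    rewrite map_cat cat_uniq -!map_comp; apply/and3P; split.
    - by rewrite map_inj_uniq ?iota_uniq // => a b /= /addnI/double_inj.
    - apply/hasPn => l /mapP[a _ ->]; apply/mapP => -[b _ /= /addnI /(congr1 odd)].
      by rewrite /= !odd_double.
    - by rewrite map_inj_uniq ?iota_uniq // => a b /= /addnI [/double_inj].
  apply/hasPn => l /ltM lM; apply/negP; rewrite map_cat mem_cat -!map_comp.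
  by case/orP=> /mapP[a _ e]; move: lM; rewrite e /= ltnNge leq_addr.
have memN1 h : reflect (exists2 r, r < n & h = (M + r.*2, (nth 0 (q0 :: ys) r, s))) (h \in N1).
  by apply: (iffP mapP) => -[a ha ->]; exists a => //; move: ha; rewrite mem_iota.
have memN2 h : reflect (exists2 r, r < n & h = (M + r.*2.+1, (nth 0 xs r, s))) (h \in N2).
  by apply: (iffP mapP) => -[a ha ->]; exists a => //; move: ha; rewrite mem_iota.
have nthq a : a < n -> nth 0 (q0 :: ys) a \in q0 :: ys by move=> an; rewrite mem_nth //= sy ltnS ltnW.
have nthx a : a < n -> nth 0 xs a \in xs by move=> an; rewrite mem_nth // sx.
have ptau z : z \in atoms B -> perm_eq (tau' z) (tfil z ((N1 ++ N2) ++ allh B om)).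
  move=> zB; apply: uniq_perm; last move=> e.
  - rewrite /tau'; case: ifP => // _; case: ifP => [_|_]; first by case: ifP.
    have ut : uniq (tau z) by rewrite (perm_uniq (h3 z zB)) uniq_tfil.
    case: ifP => // _; case: ifP => _; rewrite ?cats0 // cat_uniq ut /= orbF andbT.
    apply/negP => /(tau_over r zB)[h hL [[e _] _]].
    by have := ltM h.1 (map_f _ hL); rewrite -e ltnn.
  - exact: uniq_tfil.
  have old v : v \in atoms B -> (e \in tau v) = (e \in tfil v (allh B om)) by move=> vB; apply/perm_mem/h3.
  rewrite !tfil_cat !mem_cat; apply/idP/idP.
    rewrite /tau'; case: ifP => zx.
      rewrite inE => /eqP ->; apply/orP; left; apply/orP; right.
      apply/mapP; exists (M + (index z xs).*2.+1, (z, s)) => //; rewrite mem_filter eqxx /=.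
      by apply/memN2; exists (index z xs); rewrite ?nth_index // -sx index_mem.
    case: ifP => zy.
      case: ifP => // lt; rewrite inE => /eqP ->; apply/orP; left; apply/orP; left.
      apply/mapP; exists (M + (index z ys).+1.*2, (z, s)) => //; rewrite mem_filter eqxx /=.
      by apply/memN1; exists (index z ys).+1; rewrite //= nth_index.
    case: eqP => [zq|_]; last by rewrite old // => ->; rewrite !orbT.
    rewrite mem_cat => /orP[|]; first by rewrite old // => ->; rewrite !orbT.
    case: ifP => // n0; rewrite inE => /eqP ->; apply/orP; left; apply/orP; left.
    apply/mapP; exists (M, (z, s)) => //; rewrite mem_filter eqxx /=.
    by apply/memN1; exists 0; rewrite // addn0 zq.
  case/orP=> [/orP[]|].
  - case/mapP=> h; rewrite mem_filter => /andP[/eqP hz /memN1[a an eh]] ->; subst h; rewrite /= in hz.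
    have zq : z \in q0 :: ys by rewrite -hz nthq.
    have zx : z \notin xs by apply/negP => zx; have := xy zx zq; rewrite eqxx.
    rewrite /tau' (negbTE zx); case: a an hz => [|a] an /= hz.
      have zy : z \notin ys by rewrite -hz; case/andP: uqy.
      by rewrite (negbTE zy) hz eqxx mem_cat an addn0 mem_head orbT.
    have ay : a < size ys by rewrite sy ltnW.
    by rewrite -hz mem_nth // index_uniq // an mem_head.
  - case/mapP=> h; rewrite mem_filter => /andP[/eqP hz /memN2[a an eh]] ->; subst h; rewrite /= in hz.
    by rewrite /tau' -hz nthx // index_uniq ?sx // mem_head.
  - move=> ez; have zz : z \notin xs ++ ys by apply/negP => /tf0 e0; rewrite e0 in ez.
    move: zz; rewrite mem_cat negb_or /tau' => /andP[/negbTE -> /negbTE ->].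
    by rewrite -old // in ez; case: eqP => // _; rewrite mem_cat ez.
have r' : rzl B twW om' tau'.
  apply: (rzl_intro _ pall uL) => // z zB; rewrite /om' /twW.
  by case: ifP => // _; case: ifP => // _; apply: h1.
split=> //; first exact: good_tw.
exists (realize B om tau), (realize B om' tau'); split; [by exists om, tau | by exists om', tau' |].
apply: eqv_step; right; right.
pose F z := map hdp (om z) ++ tau z; pose F' z := map hdp (om' z) ++ tau' z.
have FF z : z \notin xs ++ ys -> z != q0 -> F z = F' z.
  rewrite mem_cat negb_or /F /F' /om' /tau' => /andP[/negbTE -> /negbTE ->] /negbTE -> //.
have Fs (t : seq nat) : {in t, forall z, z \notin xs ++ ys /\ z != q0} -> map F t = map F' t.
  by move=> h; apply/eq_in_map => z /h[]; apply: FF.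
have F0 (t : seq nat) : {subset t <= xs ++ ys} -> flatten (map F t) = [::].
  by elim: t => //= z t IH sb; rewrite {1}/F om0 ?tau0 ?IH ?sb ?mem_head // => v vt; apply: sb; rewrite inE vt orbT.
have FX : flatten (map F' xs) = twist1 (iota M (2 * n)) false s.
  rewrite /twist1 size_iota.
  transitivity [seq (M + k, odd k, s) | k <- iota 0 (2 * n)]; last first.
    by apply/eq_in_map => a; rewrite mem_iota => /andP[_ an]; rewrite nth_iota // addbF.
  rewrite -twist_over_seq -{1}[xs](mkseq_nth 0) /mkseq sx -map_comp; congr flatten.
  apply/eq_in_map => a; rewrite mem_iota => /andP[_ an] /=.
  by rewrite /F' /om' /tau' nthx // index_uniq ?sx.
have FY : (if 0 < n then [:: (M, true, s)] else [::]) ++ flatten (map F' ys) = twist2 (iota M (2 * n)) false s.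
  rewrite /twist2 size_iota.
  transitivity [seq (M + k, ~~ odd k, s) | k <- iota 0 (2 * n)]; last first.
    by apply/eq_in_map => a; rewrite mem_iota => /andP[_ an]; rewrite nth_iota // addbF.
  rewrite -twist_under_seq -{1}[ys](mkseq_nth 0) /mkseq sy -map_comp; congr (_ ++ flatten _).
  apply/eq_in_map => a; rewrite mem_iota => /andP[_ an] /=.
  have yr : nth 0 ys a \in ys by rewrite mem_nth ?sy.
  have nyx : nth 0 ys a \notin xs.
    by apply/negP => zx; have := xy zx (z' := nth 0 ys a); rewrite inE yr orbT eqxx => /(_ isT).
  by rewrite /F' /om' /tau' (negbTE nyx) yr index_uniq ?sy.
have out z i : z \in B i -> i != k -> i != j -> z \notin xs ++ ys /\ z != q0.
  move=> zi ik ij; split.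
    rewrite mem_cat negb_or; apply/andP; split; apply/negP => zx.
      by rewrite (atoms_strand_eq g.1 zi (xk zx)) eqxx in ik.
    by rewrite (atoms_strand_eq g.1 zi (yj (z := z) _)) ?eqxx ?inE ?zx ?orbT // in ij.
  by apply: contraNneq ij => e; apply/eqP/(atoms_strand_eq g.1 zi)/yj; rewrite e mem_head.
have outk z : z \in pk ++ p0 :: qk -> z \notin xs ++ ys /\ z != q0.
  move=> zp; have zk : z \in B k by move: zp; rewrite Bk !mem_cat !inE mem_cat => /or3P[] -> //; rewrite !orbT.
  have zq : z \notin q0 :: ys.
    by apply/negP => /yj zj; have := kj; rewrite (atoms_strand_eq g.1 zk zj) eqxx.
  move: zq; rewrite inE negb_or mem_cat negb_or => /andP[-> ->]; rewrite andbT; split=> //.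
  apply/negP => zx; have := atoms_uniq_strand k g.1.
  rewrite Bk (perm_uniq (_ : perm_eq _ (xs ++ (pk ++ p0 :: qk)))) ?cat_uniq.
    by case/and3P=> _ /hasPn /(_ z zp); rewrite zx.
  by apply/permP => P; rewrite !count_cat /= !count_cat; lia.
have outj z : z \in pj ++ qj -> z \notin xs ++ ys /\ z != q0.
  move=> zp; have zj : z \in B j by move: zp; rewrite Bj !mem_cat !inE mem_cat => /orP[] -> //; rewrite !orbT.
  have zx : z \notin xs by apply/negP => /xk zk; have := kj; rewrite (atoms_strand_eq g.1 zk zj) eqxx.
  have : z \notin q0 :: ys.
    apply/negP => zq; have := atoms_uniq_strand j g.1.
    rewrite Bj (perm_uniq (_ : perm_eq _ ((q0 :: ys) ++ (pj ++ qj)))) ?cat_uniq.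
      by case/and3P=> _ /hasPn /(_ z zp); rewrite zq.
    by rewrite -cat_cons perm_catCA.
  by rewrite inE negb_or mem_cat negb_or zx => /andP[-> ->].
have sub1 (t t' : seq nat) : {subset t <= t'} -> {in t', forall z, z \notin xs ++ ys /\ z != q0} -> map F t = map F' t.
  by move=> sb h; apply: Fs => z /sb; apply: h.
have ek : map F pk = map F' pk by apply: (sub1 _ (pk ++ p0 :: qk)) => // z zp; rewrite mem_cat zp.
have eqk' : map F qk = map F' qk by apply: (sub1 _ (pk ++ p0 :: qk)) => // z zp; rewrite mem_cat inE zp !orbT.
have e0 : F p0 = F' p0.
  by have [|h4 h5] := outk p0; rewrite ?mem_cat ?mem_head ?orbT //; apply: FF.
have ej : map F pj = map F' pj by apply: (sub1 _ (pj ++ qj)) => // z zp; rewrite mem_cat zp.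
have eqj' : map F qj = map F' qj by apply: (sub1 _ (pj ++ qj)) => // z zp; rewrite mem_cat zp orbT.
have eq0 : F' q0 = F q0 ++ (if 0 < n then [:: (M, true, s)] else [::]).
  have q0x : q0 \notin xs by apply/negP => zx; have := xy zx (mem_head q0 ys); rewrite eqxx.
  have q0y : q0 \notin ys by case/andP: uqy.
  by rewrite /F' /F /om' /tau' (negbTE q0x) (negbTE q0y) eqxx catA.
apply: (@local_move2 _ _ k j (flatten (map F pk) ++ F p0) (flatten (map F qk))
  (flatten (map F pj) ++ F q0) (flatten (map F qj)) (twist1 (iota M (2 * n)) false s)
  (twist2 (iota M (2 * n)) false s) (twist_pat n) kj).
- exact: rzl_wf r.
- exact: rzl_wf good_tw r'.
- rewrite realizeE -/F Bk !(map_cat, flatten_cat) /= !(map_cat, flatten_cat) (F0 xs) ?catA //.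
  by move=> z zx; rewrite mem_cat zx.
- rewrite realizeE -/F Bj !(map_cat, flatten_cat) /= !(map_cat, flatten_cat) (F0 ys) ?catA //.
  by move=> z zx; rewrite mem_cat zx orbT.
- by rewrite realizeE -/F' Bk !(map_cat, flatten_cat) /= !(map_cat, flatten_cat) FX ek e0 eqk' !catA.
- by rewrite realizeE -/F' Bj !(map_cat, flatten_cat) /= !(map_cat, flatten_cat) eq0 -FY ej eqj' !catA.
- by move=> i ik ij; rewrite !realizeE; congr flatten; apply: Fs => z zi; apply: out zi ik ij.
- split=> //; split=> //; exists (iota M (2 * n)), false, s, true; split=> //.
  by rewrite size_iota.
Qed.

Definition twS (z : nat) : seq (nat * bool) :=
  if z \in xs then [:: (q0, s)] else if z \in ys then [:: (p0, s)] else W z.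

Let p0k : p0 \in B k. Proof. by rewrite Bk mem_cat mem_head orbT. Qed.
Let q0j : q0 \in B j. Proof. by apply: yj; rewrite mem_head. Qed.

Lemma good_twS : good B twS.
Proof.
split=> [|z zB]; first exact: g.1; rewrite /twS; case: ifP => zx /=; first by rewrite (mem_atomsW q0j).
by case: ifP => zy; [rewrite /= (mem_atomsW p0k) | apply: g.2].
Qed.

(* Along the twist each strand is only conjugated by the other one, so the
   undercrossings may all be taken below the entering arcs. *)
Lemma m_twist_straight : Meq B W B twS.
Proof.
apply: Meq_trans m_twist _.
(* Strand [k] is straightened first: in its group the arcs of [k] are trivial, so the arcs of [j] do
   not change along the twist. The roles are then exchanged. *)
pose W1 z := if z \in xs then [:: (q0, s)] else twW z.
have g1 : good B W1.
  split=> [|z zB]; first exact: g.1; rewrite /W1; case: ifP => zx /=; first by rewrite (mem_atomsW q0j).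
  exact: good_tw.2.
have nyx z : z \in ys -> z \notin xs.
  by move=> zy; apply/negP => zx; have := xy zx (z' := z); rewrite inE zy orbT eqxx => /(_ isT).
apply: (@Meq_trans m n _ _ B W1).
  apply: (@strand_replace m n B _ _ k) => //; first exact: good_tw.
    by move=> v _ vk; rewrite /W1; case: ifP => // /xk; rewrite (negbTE vk).
  move=> z zk; rewrite /W1; case: ifP => zx; last exact: pcl_refl.
  rewrite /twW zx; set r := index z xs.
  have rn : r < n by rewrite -sx index_mem.
  apply: (wpi_sign (E := pcongr (arel B twW [set k]))).
  have -> : nth 0 (q0 :: ys) r = last q0 (take r ys).
    by rewrite (last_nth 0) size_take sy rn -{1}(cat_take_drop r ys) -cat_cons nth_cat /= size_take sy rn ltnS leqnn.
  rewrite (arc_chain twW (S := [set k]) (k := j) (pre := pj) (post := drop r ys ++ qj)); last first.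
  - by rewrite catA cat_take_drop.
  - by rewrite inE eq_sym.
  rewrite [X in (_ ^ X)%g](@wpi_killed B _ _ k) ?conjg1 ?inE //.
  apply/allP=> h /flattenP[t /mapP[c /mem_take cy ->]].
  rewrite /twW (negbTE (nyx c cy)) cy inE => /eqP -> /=; apply: xk; rewrite mem_nth // sx -sy index_mem //.
apply: (@strand_replace m n B _ _ j) => //; first exact: good_twS.
  by move=> v _ vj; rewrite /W1 /twS /twW; case: (v \in xs) => //; case: ifP => // vy; rewrite yj // inE vy orbT in vj.
move=> z zj; rewrite /W1 /twS; case: ifP => zx; first exact: pcl_refl.
rewrite /twW zx; case: ifP => zy; last exact: pcl_refl.
set r := index z ys; have rn : r < n by rewrite -sy index_mem.
apply: (wpi_sign (E := pcongr (arel B W1 [set j]))).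
have -> : nth 0 xs r = last p0 (take r.+1 xs).
  by rewrite (last_nth 0) size_takel ?sx //= nth_take.
rewrite (arc_chain W1 (S := [set j]) (k := k) (pre := pk) (post := drop r.+1 xs ++ qk)); last first.
- by rewrite catA cat_take_drop.
- by rewrite inE.
rewrite [X in (_ ^ X)%g](@wpi_killed B _ _ j) ?conjg1 ?inE //.
apply/allP=> h /flattenP[t /mapP[c /mem_take cx ->]].
by rewrite /W1 cx inE => /eqP ->.
Qed.
End Insert.
End Twist.

(** * Classification of the normal forms *)

Section TLevel.
Variables (m n : nat).
Implicit Types (w : 'I_m -> word m) (i j k : 'I_m).
Notation Meq := (@Meq m n).

Definition dT w (z : nat) : word m :=
  if odd z then if insub z./2 is Some i then w i else [::] else [::].

Lemma WT_dT w z : WT w z = map (@encT m) (dT w z).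
Proof. by rewrite /WT /dT; case: ifP => // _; case: insub. Qed.

Lemma dT_even w a : dT w a.*2 = [::]. Proof. by rewrite /dT odd_double. Qed.
Lemma dT_odd w i : dT w (val i).*2.+1 = w i.
Proof. by rewrite /dT /= odd_double /= uphalf_double valK. Qed.
Lemma dT_big w a : m <= a -> dT w a.*2.+1 = [::].
Proof. by move=> h; rewrite /dT /= odd_double /= uphalf_double insubF // ltnNge h. Qed.

Definition Teq w w' := Meq (@BT m) (WT w) (@BT m) (WT w').

Lemma Teq_refl w : Teq w w. Proof. exact/Meq_refl/goodT. Qed.
Lemma Teq_sym w w' : Teq w w' -> Teq w' w. Proof. exact: Meq_sym. Qed.
Lemma Teq_trans w w' w'' : Teq w w' -> Teq w' w'' -> Teq w w''. Proof. exact: Meq_trans. Qed.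
Lemma Teq_ext w w' : w =1 w' -> Teq w w'.
Proof. by move/funext => ->; apply: Teq_refl. Qed.

Lemma count_atomsE (C : 'I_m -> seq nat) (P : pred nat) : count P (atoms C) = \sum_(i < m) count P (C i).
Proof.
rewrite -sum1_count /atoms big_flatten big_map big_enum /=.
by apply: eq_bigr => i _; rewrite sum1_count.
Qed.

Section TwistBase.
Variables (k j : 'I_m).
Hypothesis kj : k != j.

(** The normal form occupies the numbers below [2m]. The new atoms are odd numbers above, where [dT]
    is empty. *)
Definition xs2 := [seq (m + r).*2.+1 | r <- iota 0 n].
Definition ys2 := [seq (m + n + r).*2.+1 | r <- iota 0 n].
(** A marker on strand [k] just behind the twist region; [T_central] reads the effect of the twist
    on it. *)
Definition mk2 := (m + n + n).*2.+1.
Definition rest2 i : seq nat :=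
  if i == k then xs2 ++ [:: mk2; (val k).*2.+1] else
  if i == j then ys2 ++ [:: (val j).*2.+1] else [:: (val i).*2.+1].
Definition B2 i : seq nat := (val i).*2 :: rest2 i.

Lemma B2k : B2 k = [::] ++ (val k).*2 :: xs2 ++ [:: mk2; (val k).*2.+1].
Proof. by rewrite /B2 /rest2 eqxx. Qed.
Lemma B2j : B2 j = [::] ++ (val j).*2 :: ys2 ++ [:: (val j).*2.+1].
Proof. by rewrite /B2 /rest2 eq_sym (negbTE kj) eqxx. Qed.

Lemma new2_big z : z \in xs2 ++ ys2 ++ [:: mk2] -> exists2 a, m <= a & z = a.*2.+1.
Proof.
rewrite !mem_cat => /or3P[/mapP[r _ ->]|/mapP[r _ ->]|]; last rewrite inE => /eqP ->.
- by exists (m + r) => //; apply: leq_addr.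
- by exists (m + n + r) => //; rewrite -addnA leq_addr.
- by exists (m + n + n) => //; rewrite -addnA leq_addr.
Qed.

Lemma BT_small z : z \in atoms (@BT m) -> z < m.*2.
Proof.
case/mem_atoms=> i; rewrite !inE => /orP[] /eqP ->; rewrite ?ltn_double ?ltn_ord //.
by rewrite ltn_Sdouble ltn_ord.
Qed.

Lemma atoms_B2 : perm_eq (atoms B2) ((xs2 ++ ys2 ++ [:: mk2]) ++ atoms (@BT m)).
Proof.
apply/permP => P; rewrite count_cat !count_atomsE.
rewrite (bigD1 k) // (bigD1 j) 1?eq_sym //= [in RHS](bigD1 k) // [in RHS](bigD1 j) 1?eq_sym //=.
rewrite (eq_bigr (fun i => count P (BT i))) => [|i /andP[ik ij]]; last first.
  by rewrite /B2 /rest2 (negbTE ik) (negbTE ij).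
rewrite /rest2 eqxx eq_sym (negbTE kj) eqxx !count_cat /=; lia.
Qed.

Lemma uniq_B2 : uniq (atoms B2).
Proof.
have di (c : nat) : injective (fun r => (c + r).*2.+1) by move=> a b [/double_inj/addnI].
rewrite (perm_uniq atoms_B2) cat_uniq BT_uniq andbT; apply/andP; split.
  rewrite !cat_uniq !map_inj_uniq ?iota_uniq //= orbF.
  apply/and3P; split=> //.
    rewrite has_cat negb_or /= orbF; apply/andP; split.
      apply/hasPn => z /mapP[r _ ->]; apply/mapP => -[r']; rewrite mem_iota => /andP[_ rn] [/double_inj].
      lia.
    by apply/mapP => -[r']; rewrite mem_iota => /andP[_ rn] [/double_inj]; lia.
  by rewrite ?andbT; apply/mapP => -[r']; rewrite mem_iota => /andP[_ rn] [/double_inj]; lia.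
apply/hasPn => z /BT_small zm; apply/negP => /new2_big[a am e]; move: zm; rewrite e; lia.
Qed.

Lemma mem_B2 z : z \in atoms (@BT m) -> z \in atoms B2.
Proof. by move=> h; rewrite (perm_mem atoms_B2) mem_cat h orbT. Qed.

Lemma even_B2 i : (val i).*2 \in atoms B2. Proof. exact/mem_B2/BT_even. Qed.

Lemma good_B2 (W : nat -> seq (nat * bool)) :
  {in atoms B2, forall z, all (fun h => h.1 \in atoms B2) (W z)} -> good B2 W.
Proof. by split=> //; apply: uniq_B2. Qed.

Lemma enc_B2 (u : word m) : all (fun h => h.1 \in atoms B2) (map (@encT m) u).
Proof. by rewrite all_map; apply/allP=> h _ /=; apply: even_B2. Qed.

Lemma T_of_B2 (W : nat -> seq (nat * bool)) (w0 : nat -> word m) w :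
  (forall z, W z = map (@encT m) (w0 z)) -> (forall i, w0 (val i).*2 = [::]) ->
  (forall i, w i = flatten [seq w0 z | z <- rest2 i]) ->
  Meq B2 W (@BT m) (WT w).
Proof.
move=> hW w0e hw; have gW : good B2 W by apply: good_B2 => z _; rewrite hW enc_B2.
have -> : w = fun i => flatten [seq w0 z | z <- rest2 i] by apply: funext.
exact: (@tform m n B2 W (fun i => (val i).*2) rest2 w0 gW).
Qed.

Lemma flatten_dT0 w s : {subset s <= xs2 ++ ys2 ++ [:: mk2]} -> flatten [seq dT w z | z <- s] = [::].
Proof.
elim: s => //= z s IH sb; rewrite IH => [|v vs]; last by apply: sb; rewrite inE vs orbT.
by have [a am ->] := new2_big (sb z (mem_head _ _)); rewrite dT_big.
Qed.

Lemma odd_new i z : z \in xs2 ++ ys2 ++ [:: mk2] -> z != (val i).*2.+1.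
Proof.
move=> /new2_big[a am ->]; rewrite eqSS (inj_eq double_inj); apply: contraTneq (ltn_ord i) => <-.
by rewrite -leqNgt.
Qed.

Lemma even_new a z : z \in xs2 ++ ys2 ++ [:: mk2] -> z != a.*2.
Proof. by move=> /new2_big[b _ ->]; apply/eqP => /(congr1 odd); rewrite /= !odd_double. Qed.

Definition twd s w (z : nat) : word m :=
  if z \in xs2 then [:: (j, s)] else if z \in ys2 then [:: (k, s)] else dT w z.

Definition tww s w i : word m :=
  if i == k then nseq n (j, s) ++ w k else if i == j then nseq n (k, s) ++ w j else w i.

Lemma twd_out s w z : z \notin xs2 ++ ys2 -> twd s w z = dT w z.
Proof. by rewrite mem_cat negb_or /twd => /andP[/negbTE -> /negbTE ->]. Qed.

Lemma odd_notin i : (val i).*2.+1 \notin xs2 ++ ys2.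
Proof.
apply/negP => h; have h' : (val i).*2.+1 \in xs2 ++ ys2 ++ [:: mk2] by rewrite catA mem_cat h.
by have := odd_new i h'; rewrite eqxx.
Qed.

Lemma even_notin a : a.*2 \notin xs2 ++ ys2.
Proof.
apply/negP => h; have h' : a.*2 \in xs2 ++ ys2 ++ [:: mk2] by rewrite catA mem_cat h.
by have := even_new a h'; rewrite eqxx.
Qed.

Lemma mk_notin : mk2 \notin xs2 ++ ys2.
Proof.
have := uniq_B2; rewrite (perm_uniq atoms_B2) cat_uniq => /and3P[+ _ _].
by rewrite catA cat_uniq /= orbF => /and3P[].
Qed.

Lemma ys_notin_xs z : z \in ys2 -> z \notin xs2.
Proof.
have := uniq_B2; rewrite (perm_uniq atoms_B2) cat_uniq => /and3P[+ _ _].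
by rewrite catA cat_uniq => /and3P[+ _ _]; rewrite cat_uniq => /and3P[_ /hasPn h _] /h.
Qed.

Lemma flatten_const (A : Type) (f : nat -> seq A) (c : A) s :
  {in s, forall z, f z = [:: c]} -> flatten [seq f z | z <- s] = nseq (size s) c.
Proof.
elim: s => //= z s IH h; rewrite h ?mem_head //= IH // => v vs.
by apply: h; rewrite inE vs orbT.
Qed.

Lemma tww_flatten s w i : tww s w i = flatten [seq twd s w z | z <- rest2 i].
Proof.
have fx : flatten [seq twd s w z | z <- xs2] = nseq n (j, s).
  by rewrite (@flatten_const _ _ (j, s)) ?size_map ?size_iota // => z zx; rewrite /twd zx.
have fy : flatten [seq twd s w z | z <- ys2] = nseq n (k, s).
  rewrite (@flatten_const _ _ (k, s)) ?size_map ?size_iota // => z zy.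
  by rewrite /twd (negbTE (ys_notin_xs zy)) zy.
have fo i' : twd s w (val i').*2.+1 = w i' by rewrite twd_out ?odd_notin // dT_odd.
have fm : twd s w mk2 = [::].
  by rewrite twd_out ?mk_notin // /mk2 dT_big // -addnA leq_addr.
rewrite /tww /rest2; case: eqP => _; first by rewrite map_cat flatten_cat fx /= fm fo cats0.
by case: eqP => _; rewrite ?map_cat ?flatten_cat ?fy /= fo cats0.
Qed.

Lemma twS_twd s w (W : nat -> seq (nat * bool)) :
  (forall z, W z = map (@encT m) (dT w z)) ->
  forall z, twS W s (val k).*2 (val j).*2 xs2 ys2 z = map (@encT m) (twd s w z).
Proof. by move=> h z; rewrite /twS /twd; case: ifP => // _; case: ifP. Qed.

Lemma unref_new (W : nat -> seq (nat * bool)) z :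
  (forall v h, h \in W v -> h.1 = mk2 \/ exists a, h.1 = a.*2) ->
  z \in xs2 ++ ys2 -> unref B2 W z.
Proof.
move=> hW zz v _; apply/allP=> h /hW[->|[a ->]].
  by apply: contraTneq zz => <-; apply: mk_notin.
by rewrite eq_sym even_new // catA mem_cat zz.
Qed.

Lemma m_twist_B2 s (W : nat -> seq (nat * bool)) : good B2 W ->
  (forall z, z \in xs2 ++ ys2 -> W z = [::]) ->
  (forall v h, h \in W v -> h.1 = mk2 \/ exists a, h.1 = a.*2) ->
  Meq B2 W B2 (twS W s (val k).*2 (val j).*2 xs2 ys2).
Proof.
move=> g W0 hW; apply: (m_twist_straight s g kj B2k B2j) => //.
- by rewrite size_map size_iota.
- by rewrite size_map size_iota.
- by move=> z zz; apply: unref_new.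
Qed.

Lemma T_to_B2 w : Meq (@BT m) (WT w) B2 (WT w).
Proof.
apply/Meq_sym/(@T_of_B2 _ (dT w)) => [z|i|i]; first exact: WT_dT.
  exact: dT_even.
have fo i' : dT w (val i').*2.+1 = w i' by rewrite dT_odd.
rewrite /rest2; case: eqP => [->|_].
  rewrite map_cat flatten_cat flatten_dT0 /= => [|z zx]; last by rewrite mem_cat zx.
  by rewrite fo cats0 /mk2 dT_big // -addnA leq_addr.
case: eqP => [->|_]; last by rewrite /= fo cats0.
rewrite map_cat flatten_cat flatten_dT0 /= => [|z zx]; last by rewrite !mem_cat zx orbT.
by rewrite fo cats0.
Qed.

Lemma good_WT2 w : good B2 (WT w).
Proof. by apply: good_B2 => z _; rewrite WT_dT enc_B2. Qed.

Lemma WT_new w z : z \in xs2 ++ ys2 ++ [:: mk2] -> WT w z = [::].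
Proof. by move=> /new2_big[a am ->]; rewrite WT_dT dT_big. Qed.

Lemma T_twist s w : Teq w (tww s w).
Proof.
apply: Meq_trans (T_to_B2 w) _.
apply: Meq_trans (@m_twist_B2 s _ (good_WT2 w) _ _) _.
- by move=> z zz; apply: WT_new; rewrite catA mem_cat zz.
- by move=> v h; rewrite WT_dT => /mapP[q _ ->]; right; exists (val q.1).
apply: (@T_of_B2 _ (twd s w)) => [|i|i].
- exact/twS_twd/WT_dT.
- by rewrite twd_out ?even_notin // dT_even.
- exact: tww_flatten.
Qed.

Definition updw w i (u : word m) : 'I_m -> word m := fun i' => if i' == i then u else w i'.

(** The reference to [k] is moved to [mk2] while the region before it is still empty. After the
    twist, [mk2] is the initial arc of [k] conjugated by [n] copies of that of [j], and the letter
    is rewritten accordingly. *)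
Lemma T_central i w p q : i != k -> i != j ->
  Teq (updw w i (p ++ [:: (k, true)] ++ q))
      (updw w i (p ++ (nseq n (j, false) ++ (k, true) :: nseq n (j, true)) ++ q)).
Proof.
move=> ik ij; set w1 := updw w i _; set w2 := updw w i _.
pose zi := (val i).*2.+1.
have zii : zi \in B2 i by rewrite /B2 /rest2 (negbTE ik) (negbTE ij) !inE eqxx orbT.
have ziu z : z \in B2 i -> z = zi \/ z = (val i).*2.
  by rewrite /B2 /rest2 (negbTE ik) (negbTE ij) !inE => /orP[] /eqP ->; [right | left].
have mkB : mk2 \in atoms B2 by rewrite (perm_mem atoms_B2) !mem_cat mem_head !orbT.
pose W0 := upd (WT w1) zi (map (@encT m) p ++ [:: (mk2, true)] ++ map (@encT m) q).
have g0 : good B2 W0.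
  by apply: good_upd; [apply: good_WT2 | rewrite !all_cat !enc_B2 /= mkB].
have kNi : k \notin [set i] by rewrite inE eq_sym.
have B2mk : B2 k = [::] ++ (val k).*2 :: (xs2 ++ [:: mk2]) ++ [:: (val k).*2.+1].
  by rewrite B2k /= -catA.
apply: Meq_trans (T_to_B2 w1) _; apply: (@Meq_trans m n _ _ B2 W0).
  apply: (@strand_replace m n B2 _ _ i) => //; first exact: good_WT2.
    by move=> v vB vi; rewrite /W0 upd_other //; apply: contraNneq vi => ->.
  move=> z /ziu[->|->]; last first.
    rewrite /W0 upd_other ?WT_even; first exact: pcl_refl.
    by apply/eqP => /(congr1 odd); rewrite /= !odd_double.
  rewrite /W0 upd_same WT_odd /w1 /updw eqxx !map_cat; apply: pcl_ctx; apply: pcl_sym.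
  apply: (wpi_sign (E := pcongr (arel B2 (WT w1) [set i]))).
  have := arc_chain (WT w1) kNi B2mk; rewrite last_cat /= => ->.
  rewrite (_ : flatten _ = [::]) ?conjg1 //.
  have : {subset xs2 ++ [:: mk2] <= xs2 ++ ys2 ++ [:: mk2]}.
    by move=> y; rewrite !mem_cat => /orP[] ->; rewrite ?orbT.
  elim: (xs2 ++ [:: mk2]) => //= y t IH sb; rewrite IH => [|v vt]; last by apply: sb; rewrite inE vt orbT.
  by rewrite WT_new // sb // mem_head.
have W0new z : z \in xs2 ++ ys2 ++ [:: mk2] -> W0 z = [::].
  by move=> zz; rewrite /W0 upd_other ?WT_new //; apply: odd_new.
have W0xy z : z \in xs2 ++ ys2 -> W0 z = [::] by move=> zz; apply: W0new; rewrite catA mem_cat zz.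
apply: Meq_trans (@m_twist_B2 true W0 g0 W0xy _) _.
  move=> v h; rewrite /W0 /upd; case: eqP => _; last by rewrite WT_dT => /mapP[q' _ ->]; right; exists (val q'.1).
  rewrite !mem_cat inE => /or3P[/mapP[q' _ ->]|/eqP ->|/mapP[q' _ ->]]; [right | left | right] => //.
    by exists (val q'.1).
  by exists (val q'.1).
set W1 := twS _ _ _ _ _ _.
pose new := p ++ (nseq n (j, false) ++ (k, true) :: nseq n (j, true)) ++ q.
have W1o : forall z, z \notin xs2 ++ ys2 -> W1 z = W0 z.
  by move=> z; rewrite mem_cat negb_or /W1 /twS => /andP[/negbTE -> /negbTE ->].
have ziN : zi \notin xs2 ++ ys2 by apply: odd_notin.
have g1 : good B2 W1 by apply: (good_twS _ g0 B2k B2j).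
pose W2 := upd W1 zi (map (@encT m) new).
have g2 : good B2 W2 by apply: good_upd => //; apply: enc_B2.
apply: (@Meq_trans m n _ _ B2 W2).
  apply: (@strand_replace m n B2 _ _ i) => //.
    by move=> v vB vi; rewrite /W2 upd_other //; apply: contraNneq vi => ->.
  move=> z /ziu[->|->]; last first.
    rewrite /W2 upd_other; first exact: pcl_refl.
    by apply/eqP => /(congr1 odd); rewrite /= !odd_double.
  rewrite W1o // /W0 upd_same /W2 upd_same /new !map_cat; apply: pcl_ctx.
  apply/(@wpiP _ (pcongr (arel B2 W1 [set i]))).
  have := arc_chain W1 kNi B2mk; rewrite last_cat /= => ->.
  have -> : flatten [seq W1 c | c <- xs2 ++ [:: mk2]] = nseq n ((val j).*2, true).
    rewrite map_cat flatten_cat /= W1o ?mk_notin // W0new ?cats0.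
      by rewrite (@flatten_const _ _ ((val j).*2, true)) ?size_map ?size_iota // => y yx; rewrite /W1 /twS yx.
    by rewrite !mem_cat mem_head !orbT.
  rewrite -wpi_conj /=; congr wpi; rewrite ?map_cat /= !map_nseq; congr (_ ++ _).
  by rewrite /ginv map_nseq rev_nseq.
(* All references being initial again, the diagram is a twisted normal form, and [T_twist] read
   backwards removes the twist. *)
apply: (@Meq_trans m n _ _ (@BT m) (WT (tww true w2))); last exact/Meq_sym/T_twist.
apply: (@T_of_B2 _ (twd true w2)) => [z|i'|i'].
- rewrite /W2 /upd; case: eqP => [->|/eqP nz].
    by rewrite twd_out // dT_odd /w2 /updw eqxx.
  rewrite /W1 /twS /twd; case: ifP => // _; case: ifP => // _.
  rewrite /W0 upd_other // WT_dT; congr map; rewrite /dT; case: ifP => // oz.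
  case: insubP => // i' _ ei; rewrite /w1 /w2 /updw; case: eqP => // e.
  by case/eqP: nz; rewrite /zi -e ei -[LHS](odd_double_half z) oz.
- by rewrite twd_out ?even_notin // dT_even.
- exact: tww_flatten.
Qed.

End TwistBase.
End TLevel.

(** * Completeness of the coefficients *)

Section Classify.
Variables (m n : nat).
Implicit Types (w : 'I_m -> word m) (i j k : 'I_m).
Notation Teq := (@Teq m n).

(** Presents the reduced free group on the strands other than [i] with central [n]-th powers of
    generators, the group in which words on strand [i] are compared. *)
Inductive qrel i : word m -> word m -> Prop :=
| q_comm j g : qrel i ((j, true) :: ginv g ++ (j, true) :: g) (ginv g ++ (j, true) :: g ++ [:: (j, true)])
| q_kill : qrel i [:: (i, true)] [::]
| q_cent j k : k != j -> i != k -> i != j ->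
    qrel i [:: (k, true)] (nseq n (j, false) ++ (k, true) :: nseq n (j, true)).

Lemma updwE w i u : updw w i u i = u. Proof. by rewrite /updw eqxx. Qed.

Lemma T_arel w i u v :
  (forall W, pcl (arel (@BT m) W [set i]) (map (@encT m) u) (map (@encT m) v)) ->
  Teq (updw w i u) (updw w i v).
Proof.
move=> h; apply: (@strand_replace m n _ _ _ i); try exact: goodT.
  move=> z /mem_atoms[i' zi'] zi; move: zi'; rewrite !inE => /orP[] /eqP ez; rewrite ez ?WT_even // !WT_odd.
  rewrite /updw; case: eqP => // e; by rewrite ez e !inE eqxx orbT in zi.
move=> z; rewrite !inE => /orP[] /eqP ->; rewrite ?WT_even; first exact: pcl_refl.
by rewrite !WT_odd !updwE; apply: h.
Qed.

Lemma encT_ginv (g : word m) : map (@encT m) (ginv g) = ginv (map (@encT m) g).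
Proof. by rewrite /ginv map_rev -!map_comp. Qed.

Lemma T_sound i u v : pcl (qrel i) u v -> forall w, Teq (updw w i u) (updw w i v).
Proof.
elim=> {u v} [u|u v _ IH|u v x _ IH1 _ IH2|p u v q r|p x q] w.
- exact: Teq_refl.
- exact/Teq_sym/IH.
- exact: Teq_trans (IH1 w) (IH2 w).
- case: r => [j g||j k kj ik ij].
  + apply: T_arel => W; rewrite !map_cat; apply: pcl_rel.
    rewrite /= ?map_cat /= ?map_cat /= ?encT_ginv; apply: (@ar_comm m _ _ _ j); exact: mem_head.
  + apply: T_arel => W; rewrite !map_cat; apply: pcl_rel.
    by apply: (@ar_kill m _ _ _ i); rewrite ?inE ?eqxx //; apply: mem_head.
  + exact: T_central.
- by apply: T_arel => W; rewrite !map_cat; case: x => x t; apply: pcl_cancel.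
Qed.

(** [magnus_trivial] is applied to the quotient of the two words with the letters [i] deleted.
    Degree one must agree over the integers, because the relations make [n]-th powers of generators
    central rather than trivial. *)
Lemma word_classify i (u v : word m) :
  (forall J, uniq J -> i \notin J -> (nc u J = nc v J %[mod n%:Z])%Z) ->
  (forall j, j != i -> nc u [:: j] = nc v [:: j]) -> pcl (qrel i) u v.
Proof.
move=> hJ h1; pose E := pcongr (qrel i); pose a j : wquot E := wpi E [:: (j, true)].
have qw x y : qrel i x y -> wpi E x = wpi E y.
  by move=> r; apply/wpiP; have := pcl_rel [::] [::] r; rewrite !cats0.
have red : reduced a.
  move=> j g; have [x ->] := wpi_surj g.
  have -> : (a j ^ wpi E x)%g = wpi E (ginv x ++ [:: (j, true)] ++ x).
    by rewrite conjgE !wpi_cat wpi_ginv.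
  by rewrite /commute /a -!wpi_cat -!catA; apply: qw; apply: q_comm.
have ai : a i = 1%g by rewrite /a (qw _ _ (q_kill i)).
have cent j k : commute (a j ^+ n)%g (a k).
  have [->|ij] := eqVneq j i; first by rewrite ai expg1n; apply/commute_sym/commute1.
  have [->|ik] := eqVneq k i; first by rewrite ai; apply: commute1.
  have [->|kj] := eqVneq k j; first exact/commute_sym/commuteX.
  have nE : wpi E (nseq n (j, true)) = (a j ^+ n)%g.
    by elim: (n) => // r IH; rewrite expgS -IH -[nseq r.+1 _]/([:: (j, true)] ++ nseq r _) wpi_cat.
  have nE' : wpi E (nseq n (j, false)) = (a j ^- n)%g.
    by rewrite -nE -wpi_ginv /ginv map_nseq rev_nseq.
  have := qw _ _ (q_cent kj _ _); rewrite eq_sym ik eq_sym ij => /(_ isT isT).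
  rewrite wpi_cat [wpi E ((k, true) :: nseq _ _)]wpi_cons nE nE' -/(a k) => e.
  by rewrite /commute {1}e mulVKg.
pose x := [seq y <- u ++ ginv v | y.1 != i].
have nx J : uniq J -> (nc x J = (J == [::])%:R %[mod n%:Z])%Z.
  move=> uJ; have [iJ|iJ] := boolP (i \in J).
    rewrite (@nc_notin _ i) //; last by apply/allP=> y; rewrite mem_filter => /andP[].
    by case: J iJ {uJ}.
  rewrite /x nc_filter // -(nc_catV v uJ); apply: nc_cat_mod => r _ //.
  apply: hJ; first exact: take_uniq.
  by apply: contra iJ; apply: mem_take.
have ex : ev a x = 1%g.
  apply: (magnus_trivial red cent) => [k|J uJ J0].
    have [->|ki] := eqVneq k i.
      rewrite (@nc_notin _ i) ?mem_head //; by apply/allP=> y; rewrite mem_filter => /andP[].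
    by rewrite /x nc_filter ?inE 1?eq_sym // nc_cat1 nc_ginv1 h1 // subrr.
  have := nx J uJ; rewrite (negbTE J0) => /eqP; rewrite eqz_mod_dvd subr0.
  by [].
have fe (y : word m) : ev a [seq z <- y | z.1 != i] = ev a y.
  elim: y => //= z y IH; case: eqP => [zi|_] /=; rewrite !ev_cons IH //.
  by rewrite /evl zi ai; case: z.2; rewrite ?invg1 mul1g.
apply/(@wpiP _ E); rewrite [LHS]wpi_ev [RHS]wpi_ev.
by apply/divg1_eq; rewrite -ev_ginv -ev_cat -fe.
Qed.

Lemma T_classify w w' :
  (forall i J, uniq (rcons J i) -> (nc (w i) J = nc (w' i) J %[mod n%:Z])%Z) ->
  (forall i j, j != i -> nc (w i) [:: j] = nc (w' i) [:: j]) -> Teq w w'.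
Proof.
move=> hJ h1; pose mix (s : seq 'I_m) i := if i \in s then w' i else w i.
suff H s : Teq w (mix s).
  by apply: Teq_trans (H (enum 'I_m)) (Teq_ext _ _) => i; rewrite /mix mem_enum.
elim: s => [|i s IH]; first by apply: Teq_ext => i; rewrite /mix.
have [is_|is_] := boolP (i \in s).
  by apply: Teq_trans IH (Teq_ext _ _) => j; rewrite /mix inE; case: eqP => //= ->; rewrite is_.
apply: Teq_trans IH _.
have := @T_sound i (w i) (w' i) _ (mix s); move=> hs.
apply: Teq_trans (Teq_trans (Teq_ext _ _) (hs _)) (Teq_ext _ _).
- by move=> j; rewrite /updw; case: eqP => // ->; rewrite /mix (negbTE is_).
- apply: word_classify => [J uJ iJ|j ji]; last exact: h1.
  by apply: hJ; rewrite rcons_uniq iJ.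
- by move=> j; rewrite /updw /mix inE; case: eqP => // ->.
Qed.

Lemma tww_nc k j s w a b : k != j -> b != a ->
  nc (tww n k j s w a) [:: b] = (nc (w a) [:: b] +
    (((a == k) && (b == j)) || ((a == j) && (b == k)))%:R * (sgi s * n%:R))%R.
Proof.
move=> kj ba.
have ns c d : nc (nseq n (c, s)) [:: d] = ((c == d)%:R * (sgi s * n%:R))%R.
  have [->|cd] := eqVneq c d.
    by rewrite nc_nseq ?mem_head // nc1 /= eqseq_cons eqxx /= add0r !mul1r mulrC.
  rewrite (@nc_notin _ d) ?mem_head ?mul0r //; apply/allP=> y; rewrite mem_nseq => /andP[_ /eqP ->] //=.
rewrite /tww; case: (eqVneq a k) => [ak|ak].
  by rewrite nc_cat1 ns ak (negbTE kj) orbF addrC [j == b]eq_sym.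
case: (eqVneq a j) => [aj|aj]; last by rewrite /= mul0r addr0.
by rewrite nc_cat1 ns aj addrC [k == b]eq_sym.
Qed.

Lemma T_twists k j (t : int) w : k != j -> exists2 w', Teq w w' &
  forall a b, b != a -> nc (w' a) [:: b] = (nc (w a) [:: b] +
    (((a == k) && (b == j)) || ((a == j) && (b == k)))%:R * (t * n%:R))%R.
Proof.
move=> kj; pose st s (r : nat) := iter r (tww n k j s) w.
have h s r : Teq w (st s r) /\ forall a b, b != a -> nc (st s r a) [:: b] = (nc (w a) [:: b] +
    (((a == k) && (b == j)) || ((a == j) && (b == k)))%:R * (sgi s * r%:R * n%:R))%R.
  elim: r => [|r [IH1 IH2]].
    split=> [|a b _]; first exact: Teq_refl.
    by rewrite mulr0 mul0r mulr0 addr0.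
  split=> [|a b ba]; first exact: Teq_trans IH1 (T_twist n kj s _).
  rewrite /st iterS tww_nc // -/(st s r) IH2 // -addrA -mulrDr; congr (_ + _ * _)%R.
  by rewrite -natr1 mulrDr mulrDl mulr1.
case: t => r.
  have [h1 h2] := h true r; exists (st true r) => // a b ba; rewrite h2 //.
  by rewrite [(sgi true * _)%R]mul1r [(r%:R)%R]natz.
have [h1 h2] := h false r.+1; exists (st false r.+1) => // a b ba; rewrite h2 //.
by rewrite NegzE [(sgi false * _)%R]mulN1r [(r.+1%:R)%R]natz.
Qed.

(** Pairs of strands are corrected one at a time. The congruence makes the number of twists an
    integer, and the equality of differences ensures that the twists correcting one linking number
    of a pair also correct the other. *)
Lemma T_adjust w w' :
  (forall a b, b != a -> (nc (w a) [:: b] = nc (w' a) [:: b] %[mod n%:Z])%Z) ->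
  (forall a b, b != a -> (nc (w a) [:: b] - nc (w b) [:: a] = nc (w' a) [:: b] - nc (w' b) [:: a])%R) ->
  exists2 w'', Teq w' w'' & forall a b, b != a -> nc (w a) [:: b] = nc (w'' a) [:: b].
Proof.
move=> hm hd.
suff H (L : seq ('I_m * 'I_m)) : exists2 w'', Teq w' w'' & forall a b, b != a ->
   nc (w'' a) [:: b] = if ((a, b) \in L) || ((b, a) \in L) then nc (w a) [:: b] else nc (w' a) [:: b].
  have [w'' h1 h2] := H (enum {: 'I_m * 'I_m}); exists w'' => // a b ba.
  by rewrite h2 // mem_enum.
elim: L => [|[k j] L [w1 h1 h2]]; first by exists w' => //; apply: Teq_refl.
have [e|kj] := eqVneq k j.
  exists w1 => // a b ba; rewrite h2 // !inE e !xpair_eqE.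
  have -> : (a == j) && (b == j) = false by apply/negP => /andP[/eqP e1 /eqP e2]; rewrite e1 e2 eqxx in ba.
  by have -> : (b == j) && (a == j) = false by apply/negP => /andP[/eqP e1 /eqP e2]; rewrite e1 e2 eqxx in ba.
have jk : j != k by rewrite eq_sym.
have dv : (n%:Z %| (nc (w k) [:: j] - nc (w1 k) [:: j])%R)%Z.
  rewrite -eqz_mod_dvd; apply/eqP; rewrite h2 //; case: ifP => // _; exact: hm.
have sy : (nc (w j) [:: k] - nc (w1 j) [:: k] = nc (w k) [:: j] - nc (w1 k) [:: j])%R.
  rewrite !h2 // [((j, k) \in L) || _]orbC; case: ifP => _; first by rewrite !subrr.
  have := hd j k kj; move: (nc (w j) _) (nc (w k) _) (nc (w' j) _) (nc (w' k) _); clear; lia.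
case/dvdzP: dv => t et.
have [w2 h3 h4] := T_twists t w1 kj.
exists w2; first exact: Teq_trans h1 h3.
move=> a b ba; rewrite h4 // !inE !xpair_eqE [(n%:R)%R]natz -et.
have [/andP[/eqP -> /eqP ->]|n1] := boolP ((a == k) && (b == j)).
  by rewrite ?eqxx /= mul1r addrC subrK.
have [/andP[/eqP -> /eqP ->]|n2] := boolP ((a == j) && (b == k)).
  by rewrite ?eqxx /= ?orbT mul1r -sy addrC subrK.
by rewrite /= mul0r addr0 h2 // [(b == k) && _]andbC (negbTE n2).
Qed.

End Classify.

Theorem theorem1p2 (m n : nat) (D D' : gd m) :
  (0 < n)%N -> wf D -> wf D' ->
  (equiv_2n_sv n D D' <->
   (forall I : seq 'I_m, uniq I -> (mu D I = mu D' I %[mod n%:Z])%Z) /\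
   (forall i j : 'I_m, (i < j)%N ->
      (mu D [:: i; j] - mu D [:: j; i] = mu D' [:: i; j] - mu D' [:: j; i])%R)).
Proof.
move=> _ wD wD'; split; first exact: forward.
case=> hm hl.
have [w [E [rE eE]]] := diagram_T n wD; have [w' [E' [rE' eE']]] := diagram_T n wD'.
have [fm fl] := forward eE; have [fm' fl'] := forward eE'.
have lk i j (v : 'I_m -> word m) F : j != i -> rz (@BT m) (WT v) F -> nc (v i) [:: j] = mu F [:: j; i].
  by move=> ji rF; rewrite -[[:: j; i]]/(rcons [:: j] i) (muT rF) //= inE ji.
have cw i J : uniq (rcons J i) -> (nc (w i) J = nc (w' i) J %[mod n%:Z])%Z.
  by move=> u; rewrite -(muT rE u) -(muT rE' u) -fm // hm // fm'.
have lt_lk (i j : 'I_m) : (i < j)%N ->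
    (mu E [:: i; j] - mu E [:: j; i] = mu E' [:: i; j] - mu E' [:: j; i])%R.
  by move=> lt; rewrite -fl // hl // fl'.
(* Twists first make all linking numbers equal as integers. *)
have [|a b ba|w'' t1 t2] := @T_adjust m n w w'.
- by move=> a b ba; apply: cw; rewrite /= inE ba.
- have ab : a != b by rewrite eq_sym.
  rewrite (lk a b w E) // (lk b a w E) // (lk a b w' E') // (lk b a w' E') //.
  case: (ltngtP a b) => [lt|lt|/val_inj e]; last by rewrite e eqxx in ba.
    have := lt_lk a b lt.
    by move: (mu E [:: a; b]) (mu E [:: b; a]) (mu E' [:: a; b]) (mu E' [:: b; a]); clear; lia.
  exact: lt_lk.
have [E'' rE''] := rz_exists (goodT w'').
have e2 : eqv n E' E'' := Meq_eqv t1 rE' rE''.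
(* The twists may have altered the higher coefficients of [w'], but only by multiples of [n], by the
   implication already proved. *)
have [fm2 _] := forward e2.
have t3 : Teq n w w''.
  apply: T_classify t2 => i J u.
  by rewrite cw // -(muT rE' u) -(muT rE'' u) fm2.
apply: eqv_trans eE _; apply: eqv_trans (eqv_sym eE').
apply: eqv_trans (Meq_eqv t3 rE rE'') _; exact: eqv_sym.
Qed.
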